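(* Let $\varphi: M^n=N_T\times_f N_\perp\to\tilde M^{2m}(c)$ be an isometric immersion of a CR-warped product submanifold into a complex space form of constant holomorphic sectional curvature $c\in\mathbb R$. Let $n_1=\dim N_T$ (necessarily even), $n_2=\dim N_\perp$, $n=n_1+n_2$. Then for each $x\in M^n$ the following hold. (i) If $n_1\ge 2$, then $$\hat\delta(T_xN_T)(x)\le \frac{n^2}{2}\|\vec H\|^2-\frac{n_2\,\Delta f}{f}+\frac{n_1(n_1+2n_2+2)}{2}\cdot\frac c4-\tilde K_{\min}(T_xN_T).$$ (ii) If $n_2\ge 2$, then $$\hat\delta(T_xN_\perp)(x)\le \frac{n^2}{2}\|\vec H\|^2-\frac{n_2\,\Delta f}{f}+\frac{n_2(n_2+2n_1-1)}{2}\cdot\frac c4-\frac c4.$$ Equality holds at $x$ in (i) (resp. in (ii)) if and only if both of the following are satisfied: (E1) the infimum of $K^M(\pi)$ over 2-planes $\pi\subseteq T_xN_T$ (resp. $\pi\subseteq T_xN_\perp$) in the definition of $\hat\delta(T_xN_T)$ (resp. $\hat\delta(T_xN_\perp)$) is attained on a 2-plane $\pi_*$ with $\tilde K(\pi_* )=\tilde K_{\min}(T_xN_T)$ (resp. $\tilde K(\pi_* )=c/4$, which is automatic); (E2) there exist an orthonormal basis $\{e_1,\dots,e_n\}$ of $T_xM^n$, with $e_1,\dots,e_{n_1}\in T_xN_T$ and $e_{n_1+1},\dots,e_n\in T_xN_\perp$, and an orthonormal basis $\{e_{n+1},\dots,e_{2m}\}$ of $T_x^\perp M^n$, with $\pi_*=\mathrm{Span}\{e_1,e_2\}$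 (resp. $\pi_*=\mathrm{Span}\{e_{n_1+1},e_{n_1+2}\}$), such that for every $r\in\{n+1,\dots,2m\}$ the shape operator $A_{e_r}$ has the block-diagonal matrix $$A_{e_r}=\begin{pmatrix}P_r&0\\0&Q_r\end{pmatrix}$$ ($P_r$ of size $n_1\times n_1$, $Q_r$ of size $n_2\times n_2$), where in case (i) $$P_r=\begin{pmatrix}h^r_{11}&h^r_{12}&0&\cdots&0\\ h^r_{12}&-h^r_{11}&0&\cdots&0\\ 0&0&0&\cdots&0\\ \vdots&\vdots&\vdots&\ddots&\vdots\\ 0&0&0&\cdots&0\end{pmatrix}$$ and $Q_r$ is a symmetric matrix with $\mathrm{tr}\,Q_r=0$; and in case (ii) the roles are interchanged, i.e. $P_r$ is a symmetric matrix with $\mathrm{tr}\,P_r=0$, and $Q_r$ has all entries zero except possibly for a symmetric trace-free $2\times2$ block in the rows and columns corresponding to $e_{n_1+1},e_{n_1+2}$. Moreover, in every such equality case, $M^n$ is at $x$ mixed totally geodesic in $\tilde M^{2m}(c)$, both $\mathfrak D_T$-minimal and $\mathfrak D_\perp$-minimal, and consequently minimal in $\tilde M^{2m}(c)$ at $x$.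
   Context: A complex space form $\tilde M^{2m}(c)$ is a Kähler manifold $(\tilde M,J,\tilde g)$ of real dimension $2m$ with constant holomorphic sectional curvature $c\in\mathbb R$; for orthonormal $X,Y$ its sectional curvature is $\tilde K(X\wedge Y)=\frac c4(1+3\tilde g(JX,Y)^2)$. Warped product: for Riemannian manifolds $(N_1,g_{N_1})$, $(N_2,g_{N_2})$ and a smooth $f>0$ on $N_1$, $N_1\times_fN_2$ is $N_1\times N_2$ with metric $g_{N_1}+f^2g_{N_2}$. For $x=(p,q)$, $T_xN_1$ and $T_xN_2$ denote the subspaces of $T_x(N_1\times_fN_2)$ tangent to $N_1\times\{q\}$ and $\{p\}\times N_2$. A CR-warped product submanifold is a warped product $M^n=N_T\times_fN_\perp$ (with $f>0$ smooth on $N_T$) isometrically immersed in $\tilde M^{2m}(c)$ such that $\mathfrak D_T=TN_T$ is holomorphic ($J\mathfrak D_T=\mathfrak D_T$) and $\mathfrak D_\perp=TN_\perp$ is totally real ($J\mathfrak D_\perp\subseteq T^\perp M^n$). $\Delta f$ is the Laplacian of $f$ on $N_T$ with the sign convention $\Delta=-\mathrm{div}\,\mathrm{grad}$, i.e. $\Delta\psi=\sum_i((\nabla_{e_i}e_i)\psi-e_ie_i\psi)$ in an orthonormal frame. $h$ is the second fundamental form, $A_\xi$ the shape operator ($g(A_\xi X,Y)=g(h(X,Y),\xi)$), $h^r_{ij}=g(h(e_i,e_j),e_r)$, and $\vec H=\frac1n\sum_{i=1}^nh(e_i,e_i)$ the mean curvature vector. $K^M$ is the sectional curvature of $M^n$.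 For a subspace $V\subseteq T_xM^n$ with $\dim V=k\ge2$ and orthonormal basis $v_1,\dots,v_k$, $\tau^M(V)=\sum_{1\le i<j\le k}K^M(v_i\wedge v_j)$. The leaf-wise first Chen invariant of $V\in\{T_xN_T,T_xN_\perp\}$ (with $\dim V\ge2$) is $$\hat\delta(V)(x)=\tau^M(V)-\inf\{K^M(\pi):\pi\subseteq V,\ \dim\pi=2\}.$$ For a subspace $V$ of a tangent space of $\tilde M^{2m}(c)$ of real dimension $\ge2$, $\tilde K_{\min}(V)=\inf\{\tilde K(\pi):\pi\subseteq V,\ \dim\pi=2\}$. At $x$: $M^n$ is mixed totally geodesic if $h(\mathfrak D_T,\mathfrak D_\perp)=0$; $\mathfrak D_T$-minimal (resp. $\mathfrak D_\perp$-minimal) if the trace of $h$ over an orthonormal basis of $\mathfrak D_T$ (resp. $\mathfrak D_\perp$) vanishes; minimal if $\vec H=0$. *)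

(* Defs.v *)
From HB Require Import structures.
From mathcomp Require Import all_boot all_order all_algebra.
From mathcomp Require Import all_classical all_reals topology normedtype derive.
Set Implicit Arguments.
Unset Strict Implicit.
Unset Printing Implicit Defensive.
Import Order.TTheory GRing.Theory Num.Theory.
Import numFieldNormedType.Exports.
Local Open Scope classical_set_scope.
Local Open Scope ring_scope.

(* Tangent vectors are written in coordinates as row vectors and linear maps   *)
(* act on the right, following the convention of [jacobian] in derive.v:       *)
(* the i-th row of ['J F y] is the partial derivative of F in direction e_i.   *)

Section Smoothness.
Context {R : realType} {n : nat} {W : normedModType R}.

Definition basis_vec (i : 'I_n) : 'rV[R]_n := delta_mx 0 i.

(* For U open this is the usual class C^k. *)
Fixpoint Ck (k : nat) (U : set 'rV[R]_n) (F : 'rV[R]_n -> W) : Prop :=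
  match k with
  | 0%N => forall y, U y -> {for y, continuous F}
  | k'.+1 => (forall y, U y -> differentiable F y) /\
             forall i, Ck k' U (fun y => 'D_(basis_vec i) F y)
  end.

Definition smooth_on (U : set 'rV[R]_n) (F : 'rV[R]_n -> W) : Prop :=
  forall k, Ck k U F.

End Smoothness.

(* A space with a family of charts; [chart_inv a] is meaningful only on        *)
(* [chart_im a] and [chart_map a] only on [chart_dom a].                       *)
Record chartedSpace (R : realType) (n : nat) := ChartedSpace {
  carrier :> topologicalType;
  chart : Type;
  chart_dom : chart -> set carrier;
  chart_map : chart -> carrier -> 'rV[R]_n;
  chart_inv : chart -> 'rV[R]_n -> carrier }.

Arguments chart_dom {R n M} a : rename.
Arguments chart_map {R n M} a : rename.
Arguments chart_inv {R n M} a : rename.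

Section Manifolds.
Context {R : realType}.

Definition chart_im n (M : chartedSpace R n) (a : chart M) : set 'rV[R]_n :=
  chart_map a @` chart_dom a.

Definition overlap n (M : chartedSpace R n) (a b : chart M) : set 'rV[R]_n :=
  chart_map a @` (chart_dom a `&` chart_dom b).

Definition transition n (M : chartedSpace R n) (a b : chart M) :
  'rV[R]_n -> 'rV[R]_n := fun y => chart_map b (chart_inv a y).

Record is_manifold n (M : chartedSpace R n) : Prop := IsManifold {
  manifold_hausdorff : hausdorff_space M;
  manifold_second_countable : @second_countable M;
  manifold_cover : forall x : M, exists a : chart M, chart_dom a x;
  manifold_dom_open : forall a : chart M, open (chart_dom a);
  manifold_im_open : forall a : chart M, open (chart_im a);
  manifold_chartK : forall (a : chart M) (x : M),
    chart_dom a x -> chart_inv a (chart_map a x) = x;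
  manifold_chart_continuous : forall (a : chart M) (x : M),
    chart_dom a x -> {for x, continuous (chart_map a)};
  manifold_inv_continuous : forall (a : chart M) (y : 'rV[R]_n),
    chart_im a y -> {for y, continuous (chart_inv a)};
  manifold_transition_smooth : forall a b : chart M,
    smooth_on (overlap a b) (transition a b) }.

Definition prod_manifold n1 n2 (M : chartedSpace R n1) (N : chartedSpace R n2) :
    chartedSpace R (n1 + n2) :=
  @ChartedSpace R (n1 + n2) (M * N)%type (chart M * chart N)%type
    (fun a => chart_dom a.1 `*` chart_dom a.2)
    (fun a x => row_mx (chart_map a.1 x.1) (chart_map a.2 x.2))
    (fun a y => (chart_inv a.1 (lsubmx y), chart_inv a.2 (rsubmx y))).

Definition smooth_function n (M : chartedSpace R n) (f : M -> R) : Prop :=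
  forall a : chart M, smooth_on (chart_im a) (f \o chart_inv a).

Definition local_rep n p (M : chartedSpace R n) (N : chartedSpace R p)
    (phi : M -> N) (a : chart M) (b : chart N) : 'rV[R]_n -> 'rV[R]_p :=
  chart_map b \o phi \o chart_inv a.

Definition local_rep_dom n p (M : chartedSpace R n) (N : chartedSpace R p)
    (phi : M -> N) (a : chart M) (b : chart N) : set 'rV[R]_n :=
  chart_map a @` (chart_dom a `&` phi @^-1` chart_dom b).

Definition smooth_map n p (M : chartedSpace R n) (N : chartedSpace R p)
    (phi : M -> N) : Prop :=
  continuous phi /\
  forall (a : chart M) (b : chart N),
    smooth_on (local_rep_dom phi a b) (local_rep phi a b).

Definition matrix_field n (M : chartedSpace R n) := chart M -> 'rV[R]_n -> 'M[R]_n.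

Definition inner n (G : 'M[R]_n) (u v : 'rV[R]_n) : R := (u *m G *m v^T) 0 0.

(* Component matrices [g a y] i j = g(d_i, d_j).                               *)
Record is_metric n (M : chartedSpace R n) (g : matrix_field M) : Prop := IsMetric {
  metric_smooth : forall a, smooth_on (chart_im a) (g a);
  metric_sym : forall a y, chart_im a y -> (g a y)^T = g a y;
  metric_pos : forall a y, chart_im a y ->
    forall u : 'rV[R]_n, u != 0 -> 0 < inner (g a y) u u;
  metric_change : forall a b y, overlap a b y ->
    g a y = 'J (transition a b) y *m g b (transition a b y)
              *m ('J (transition a b) y)^T }.

(* Components of a (1,1)-tensor: a tangent vector v is mapped to v *m A a y.   *)
Record is_endomorphism_field n (M : chartedSpace R n) (A : matrix_field M) : Prop :=
  IsEndomorphismField {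
    endo_smooth : forall a, smooth_on (chart_im a) (A a);
    endo_change : forall a b y, overlap a b y ->
      A a y *m 'J (transition a b) y =
      'J (transition a b) y *m A b (transition a b y) }.

End Manifolds.

Section LocalGeometry.
Context {R : realType} {n : nat}.
Variable g : 'rV[R]_n -> 'M[R]_n.
Implicit Types (y u v w : 'rV[R]_n) (X : 'rV[R]_n -> 'rV[R]_n).

Definition dmetric (i j k : 'I_n) y : R := 'D_(basis_vec i) (fun z => g z j k) y.

(* [christoffel y i j k] is the symbol with lower indices i j and upper index k. *)
Definition christoffel y (i j k : 'I_n) : R :=
  2^-1 * \sum_l invmx (g y) k l * (dmetric i j l y + dmetric j i l y - dmetric l i j y).

Definition christoffel_form y u v : 'rV[R]_n :=
  \row_k \sum_i \sum_j christoffel y i j k * u 0 i * v 0 j.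

(* Levi-Civita derivative at y of the vector field X in direction u. *)
Definition cov u X y : 'rV[R]_n := 'D_u X y + christoffel_form y u (X y).

(* R(u,v)w = D_u D_v w - D_v D_u w - D_[u,v] w, where u, v, w are extended to  *)
(* fields with constant components, so that the bracket [u,v] vanishes.        *)
Definition curvature y u v w : 'rV[R]_n :=
  cov u (cov v (cst w)) y - cov v (cov u (cst w)) y.

Definition sect y u v : R :=
  inner (g y) (curvature y u v v) u /
  (inner (g y) u u * inner (g y) v v - inner (g y) u v ^+ 2).

Definition planes (V : {vspace 'rV[R]_n}) : set {vspace 'rV[R]_n} :=
  [set P | (P <= V)%VS /\ \dim P = 2%N].

Definition plane_sect y (P : {vspace 'rV[R]_n}) : R :=
  sect y (vbasis P)`_0 (vbasis P)`_1.

Definition inf_sect y (V : {vspace 'rV[R]_n}) : R :=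
  inf [set plane_sect y P | P in planes V].

Definition orthonormal_basis y (V : {vspace 'rV[R]_n}) (e : seq 'rV[R]_n) : Prop :=
  basis_of V e /\
  forall i j, (i < size e)%N -> (j < size e)%N -> inner (g y) e`_i e`_j = (i == j)%:R.

(* An arbitrary orthonormal basis; it is only used in expressions that do not  *)
(* depend on its choice.                                                       *)
Definition onb y (V : {vspace 'rV[R]_n}) : seq 'rV[R]_n :=
  xget [::] [set e | orthonormal_basis y V e].

Definition scalar_curv y (V : {vspace 'rV[R]_n}) : R :=
  let e := onb y V in
  \sum_(j < size e) \sum_(i < size e | (i < j)%N) sect y e`_i e`_j.

Definition delta_hat y (V : {vspace 'rV[R]_n}) : R := scalar_curv y V - inf_sect y V.

Definition grad (psi : 'rV[R]_n -> R) y : 'rV[R]_n :=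
  (\row_j 'D_(basis_vec j) psi y) *m invmx (g y).

Definition divergence X y : R := \sum_i cov (basis_vec i) X y 0 i.

Definition laplacian (psi : 'rV[R]_n -> R) y : R := - divergence (grad psi) y.

End LocalGeometry.

(* [Phi] is the coordinate expression of an isometric immersion of a           *)
(* Riemannian manifold (metric g) in another one (metric G).                   *)
Section LocalImmersion.
Context {R : realType} {n p : nat}.
Variables (g : 'rV[R]_n -> 'M[R]_n) (G : 'rV[R]_p -> 'M[R]_p).
Variable Phi : 'rV[R]_n -> 'rV[R]_p.
Implicit Types (y u v : 'rV[R]_n) (xi : 'rV[R]_p).

(* Gauss formula h(u,v) = D~_u (Phi_* v) - Phi_* (D_u v), for u and v extended *)
(* to fields with constant components.                                         *)
Definition second_ff y u v : 'rV[R]_p :=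
  'D_u (fun z => 'D_v Phi z) y
  + christoffel_form G (Phi y) ('D_u Phi y) ('D_v Phi y)
  - cov g u (cst v) y *m 'J Phi y.

Definition differential y : 'Hom('rV[R]_n, 'rV[R]_p) := linfun (mulmxr ('J Phi y)).

Definition normal_subspace y : {vspace 'rV[R]_p} :=
  lker (linfun (mulmxr (G (Phi y) *m ('J Phi y)^T))).

(* The vector A_xi u with g(A_xi u, v) = G(h(u,v), xi) for all v. *)
Definition shape_operator y xi u : 'rV[R]_n :=
  (\row_j inner (G (Phi y)) (second_ff y u (basis_vec j)) xi) *m invmx (g y).

(* Matrix of A_xi in an orthonormal basis e. *)
Definition shape_operator_mx y xi (e : seq 'rV[R]_n) : 'M[R]_n :=
  \matrix_(i, j) inner (g y) (shape_operator y xi e`_j) e`_i.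

Definition trace_ff y (V : {vspace 'rV[R]_n}) : 'rV[R]_p :=
  \sum_(e <- onb g y V) second_ff y e e.

Definition mean_curvature y : 'rV[R]_p := n%:R^-1 *: trace_ff y fullv.

Definition mixed_totally_geodesic_at y (V W : {vspace 'rV[R]_n}) : Prop :=
  forall u v, u \in V -> v \in W -> second_ff y u v = 0.

Definition partial_minimal_at y (V : {vspace 'rV[R]_n}) : Prop := trace_ff y V = 0.

Definition minimal_at y : Prop := mean_curvature y = 0.

End LocalImmersion.

Definition endo_at (R : realType) n (A : 'M[R]_n) : 'End('rV[R]_n) :=
  linfun (mulmxr A).

Record is_kaehler (R : realType) n (M : chartedSpace R n) (g J : matrix_field M) :
    Prop := IsKaehler {
  kaehler_metric : is_metric g;
  kaehler_endo : is_endomorphism_field J;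
  kaehler_square : forall a y, chart_im a y -> J a y *m J a y = - 1%:M;
  kaehler_hermitian : forall a y, chart_im a y ->
    forall u v : 'rV[R]_n, inner (g a y) (u *m J a y) (v *m J a y) = inner (g a y) u v;
  kaehler_parallel : forall a y, chart_im a y -> forall u v : 'rV[R]_n,
    cov (g a) u (fun z => v *m J a z) y = cov (g a) u (cst v) y *m J a y }.

Record is_complex_space_form (R : realType) n (M : chartedSpace R n)
    (g J : matrix_field M) (c : R) : Prop := IsComplexSpaceForm {
  csf_manifold : is_manifold M;
  csf_kaehler : is_kaehler g J;
  csf_holomorphic_curvature : forall a y, chart_im a y ->
    forall u : 'rV[R]_n, u != 0 -> sect (g a) y u (u *m J a y) = c }.

Section CRWarpedProducts.
Context {R : realType} {n1 n2 : nat}.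

Definition tangent_left : {vspace 'rV[R]_(n1 + n2)} := lker (linfun (@rsubmx R 1 n1 n2)).
Definition tangent_right : {vspace 'rV[R]_(n1 + n2)} := lker (linfun (@lsubmx R 1 n1 n2)).

Definition warped_metric (N1 : chartedSpace R n1) (N2 : chartedSpace R n2)
    (g1 : matrix_field N1) (f : N1 -> R) (g2 : matrix_field N2) :
    matrix_field (prod_manifold N1 N2) :=
  fun a y => block_mx (g1 a.1 (lsubmx y)) 0
                      0 (f (chart_inv a.1 (lsubmx y)) ^+ 2 *: g2 a.2 (rsubmx y)).

Record is_warping_data (N1 : chartedSpace R n1) (N2 : chartedSpace R n2)
    (g1 : matrix_field N1) (f : N1 -> R) (g2 : matrix_field N2) : Prop :=
  IsWarpingData {
    warped_manifold1 : is_manifold N1;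
    warped_manifold2 : is_manifold N2;
    warped_metric1 : is_metric g1;
    warped_metric2 : is_metric g2;
    warped_smooth : smooth_function f;
    warped_pos : forall x, 0 < f x }.

(* The immersion property is part of [is_isometric]: the pulled back form is   *)
(* positive definite, hence the differential is injective.                     *)
Definition is_isometric n p (M : chartedSpace R n) (N : chartedSpace R p)
    (g : matrix_field M) (G : matrix_field N) (phi : M -> N) : Prop :=
  forall a b y, local_rep_dom phi a b y ->
    let Phi := local_rep phi a b in
    g a y = 'J Phi y *m G b (Phi y) *m ('J Phi y)^T.

Record is_cr_warped_product p (N1 : chartedSpace R n1) (N2 : chartedSpace R n2)
    (g1 : matrix_field N1) (f : N1 -> R) (g2 : matrix_field N2)
    (N : chartedSpace R p) (G J : matrix_field N)
    (phi : prod_manifold N1 N2 -> N) : Prop := IsCRWarpedProduct {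
  crw_warping : is_warping_data g1 f g2;
  crw_smooth : smooth_map phi;
  crw_isometric : is_isometric (warped_metric g1 f g2) G phi;
  crw_holomorphic : forall a b y, local_rep_dom phi a b y ->
    let Phi := local_rep phi a b in
    (endo_at (J b (Phi y)) @: (differential Phi y @: tangent_left)
      = differential Phi y @: tangent_left)%VS;
  crw_totally_real : forall a b y, local_rep_dom phi a b y ->
    let Phi := local_rep phi a b in
    (endo_at (J b (Phi y)) @: (differential Phi y @: tangent_right)
      <= normal_subspace (G b) Phi y)%VS }.

End CRWarpedProducts.

Arguments tangent_left {R} n1 n2.
Arguments tangent_right {R} n1 n2.

(* The k x k matrix whose only nonzero entries form the upper left block       *)
(* (s, t; t, -s).                                                              *)
Definition corner_mx (R : realType) (k : nat) (s t : R) : 'M[R]_k :=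
  \matrix_(i, j)
    (if (i == 0%N :> nat) && (j == 0%N :> nat) then s
     else if (i == 1%N :> nat) && (j == 1%N :> nat) then - s
     else if (i + j == 1)%N then t else 0).

(* Main.v *)
From HB Require Import structures.
Require Import Defs.
From mathcomp Require Import all_boot all_order all_algebra.
From mathcomp Require Import all_classical all_reals topology normedtype derive.
From mathcomp Require Import landau ring lra.
Import Order.TTheory GRing.Theory Num.Theory.
Import numFieldNormedType.Exports.
Local Open Scope classical_set_scope.
Local Open Scope ring_scope.

Set Implicit Arguments.
Unset Strict Implicit.
Unset Printing Implicit Defensive.

(** The whole argument is the Gauss equation, read in an orthonormal basis.
    Let e_1, ..., e_k be an orthonormal basis of one of the two leaf tangent
    spaces V, let f_1, ..., f_l be one of the other, and write h for the second
    fundamental form, a for its trace over the e_i and b for its trace over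
    the f_j.  Gauss expresses the sectional curvatures of the e_i, e_j and of
    the e_i, f_j by those of the ambient space and by h.  Adding the ones of
    all pairs e_i, e_j and of all mixed pairs e_i, f_j, and subtracting the one
    of the plane of e_1, e_2, the terms in h add up to
<<
      |a + b|^2 / 2 - |b|^2 / 2 - |h(e_1,e_1) + h(e_2,e_2)|^2 / 2
        - (sum of |h(e_i,e_j)|^2, i or j > 2) / 2 - sum of |h(e_i,f_j)|^2,
>>
    where a + b = n H ([leaf_identity]).  On the intrinsic side, the mixed
    sectional curvatures of a warped product are - Hess f / f, so their total
    is n_2 Delta f / f whatever the bases ([warped_sect], [laplacian_trace]).
    On the ambient side the curvature of a complex space form is explicit
    ([space_form_sect]); since one factor is holomorphic and the other totally
    real, the sums are constants.  Dropping the negative squares, and bounding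
    the ambient curvature of the plane of e_1, e_2 by its minimum, gives the
    inequality for every plane, hence for one on which the sectional curvature
    of V is minimal.

    Such a plane exists because the orthonormal pairs of V form a compact set
    ([inf_sect_attained]).  Equality therefore forces, at this plane, every
    dropped square to vanish and the ambient curvature to be minimal, and this
    is the stated form of the shape operators; conversely that form makes all
    the squares vanish.  The vanishing of a, of b and of the mixed terms gives
    minimality ([leaf_equality], [extremal_shape], [extremal_minimal]).

    Everything is computed in one chart of each manifold, with fields of
    constant components.  The tools are the covariant derivative along a map, which is compatible
    with the metric, torsion free, and whose commutators are the curvature
    ([nabla_compat], [nabla_symm], [ricci_identity]); for the identity map
    these give the symmetries of the curvature tensor, and for the immersion
    the Gauss equation.  Torsion freeness and the commutator formula rest on
    the symmetry of second derivatives ([young_mx]). *)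

(** * Directional derivatives *)

(** A sealed copy of the derivative.  Comparing derivatives of the same function
    in two different directions would otherwise unfold both of them down to the
    choice operator behind limits, at every rewriting step. *)
HB.lock Definition ddir (R : realType) (V W : normedModType R) (F : V -> W) (u y : V) : W :=
  derive F y u.
Canonical ddir_unlockable := Unlockable ddir.unlock.

Section Calculus.
Context {R : realType}.
Implicit Types V W : normedModType R.

Lemma ddirE V W (F : V -> W) u y : ddir F u y = 'D_u F y.
Proof. by rewrite unlock. Qed.

Lemma ddir_near_eq V W (F F' : V -> W) u y :
  (\forall z \near y, F z = F' z) -> ddir F u y = ddir F' u y.
Proof. by move=> e; rewrite !ddirE; exact: near_eq_derive. Qed.

Lemma ddirD V W (F F' : V -> W) u y : differentiable F y -> differentiable F' y ->
  ddir (fun z => F z + F' z) u y = ddir F u y + ddir F' u y.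
Proof. by move=> d d'; rewrite !ddirE; apply: deriveD; exact: diff_derivable. Qed.

Lemma ddirZ V W a (F : V -> W) u y : differentiable F y ->
  ddir (fun z => a *: F z) u y = a *: ddir F u y.
Proof. by move=> d; rewrite !ddirE; apply: deriveZ; exact: diff_derivable. Qed.

Lemma ddirM V (F F' : V -> R) u y : differentiable F y -> differentiable F' y ->
  ddir (fun z => F z * F' z) u y = ddir F u y * F' y + F y * ddir F' u y.
Proof.
move=> d d'; rewrite !ddirE addrC [_ * F' y]mulrC.
by apply: deriveM; exact: diff_derivable.
Qed.

Lemma ddir_cst V W (w : W) u (y : V) : ddir (cst w) u y = 0.
Proof. by rewrite ddirE derive_cst. Qed.

Lemma diff_sum V W (I : Type) (r : seq I) (P : pred I) (F : I -> V -> W) y :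
  (forall i, differentiable (F i) y) ->
  differentiable (fun z => \sum_(i <- r | P i) F i z) y.
Proof.
move=> dF; elim: r => [|i r IH].
  by rewrite (_ : (fun z => _) = cst 0) //; apply/funext=> z; rewrite big_nil.
case Pi : (P i); last first.
  by rewrite (_ : (fun z => _) = (fun z => \sum_(i <- r | P i) F i z)) //;
     apply/funext=> z; rewrite big_cons Pi.
rewrite (_ : (fun z => _) = (F i + fun z => \sum_(i <- r | P i) F i z)).
  exact: differentiableD.
by apply/funext=> z; rewrite big_cons Pi.
Qed.

Lemma ddir_sum V W (I : Type) (r : seq I) (P : pred I) (F : I -> V -> W) u y :
  (forall i, differentiable (F i) y) ->
  ddir (fun z => \sum_(i <- r | P i) F i z) u y = \sum_(i <- r | P i) ddir (F i) u y.
Proof.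
move=> dF; elim: r => [|i r IH].
  rewrite big_nil (_ : (fun z => _) = cst 0) ?ddir_cst //.
  by apply/funext=> z; rewrite big_nil.
rewrite big_cons -IH; case Pi : (P i); last first.
  by congr (ddir _ _ _); apply/funext=> z; rewrite big_cons Pi.
rewrite (_ : (fun z => _) = (fun z => F i z + \sum_(i <- r | P i) F i z)).
  by rewrite ddirD //; exact: diff_sum.
by apply/funext=> z; rewrite big_cons Pi.
Qed.

(** k-fold differentiability near y.  Unlike the class C^k it mentions all
    directions and not only the coordinate ones, so that the closure properties
    below are plain inductions on k; Young's theorem holds at this
    regularity. *)
Fixpoint diffn (k : nat) V W (F : V -> W) (y : V) : Prop :=
  match k with
  | 0%N => True
  | k'.+1 => (\forall z \near y, differentiable F z) /\
             forall v, diffn k' (ddir F v) y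
  end.

(** The differential is defined by choice, so that its value at the second
    function has to be recovered from the uniqueness of first order
    expansions. *)
Lemma differentiable_near_eq V W (F F' : V -> W) y :
  (\forall z \near y, F z = F' z) -> differentiable F y -> differentiable F' y.
Proof.
move=> FF' dF.
have [cdF /eqaddoP eF] := iffLR (diff_locallyP _ _) dF.
have e0 : F' \o shift y = cst (F' y) + 'd F y +o_ (nbhs (0:V)) id.
  apply/eqaddoP => e e0; have := eF e e0; apply: filter_app.
  have : \forall h \near (0:V), F (h + y) = F' (h + y).
    by move: FF'; rewrite (near_shift 0 y) /=; apply: filter_app; near=> h; rewrite /= subr0.
  apply: filter_app; near=> h => eh.
  rewrite /= -![(_ + _ : _ -> _) _]/(_ + _) -![(- _ : _ -> _) _]/(- _) /=.
  rewrite -![(_ + _ : _ -> _) _]/(_ + _) /cst /= eh.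
  by rewrite (nbhs_singleton FF').
have edF := diff_unique cdF e0.
by apply/diff_locallyP; rewrite edF.
Unshelve. all: by end_near. Qed.

Lemma diffn_near_eq k V W (F F' : V -> W) y :
  (\forall z \near y, F z = F' z) -> diffn k F y -> diffn k F' y.
Proof.
elim: k F F' => [//|k IH] F F' FF' [dF DF]; have NFF := near_join FF'.
split.
  near=> z; apply: (@differentiable_near_eq _ _ F); near: z => //.
move=> v; apply: IH (DF v); near=> z; apply: ddir_near_eq; near: z => //.
Unshelve. all: by end_near. Qed.

Lemma diffn_diff k V W (F : V -> W) y : diffn k.+1 F y -> differentiable F y.
Proof. by case=> /nbhs_singleton. Qed.

Lemma diffn_ddir k V W (F : V -> W) u y : diffn k.+1 F y -> diffn k (ddir F u) y.
Proof. by case=> _; apply. Qed.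

Lemma diffnS k V W (F : V -> W) y : diffn k.+1 F y -> diffn k F y.
Proof.
elim: k F => [//|k IH] F [dF DF]; split => // v; exact/IH.
Qed.

Lemma diffn_cst k V W (w : W) y : diffn k (cst w : V -> W) y.
Proof.
elim: k w => [//|k IH] w; split; first exact: nearW.
move=> v; rewrite (_ : ddir _ v = cst 0); first exact: IH.
by apply/funext => z; rewrite ddir_cst.
Qed.

Lemma diffnD k V W (F F' : V -> W) y : diffn k F y -> diffn k F' y -> diffn k (F + F') y.
Proof.
elim: k F F' => [//|k IH] F F' [dF DF] [dF' DF']; split.
  by near=> z; apply: differentiableD; near: z.
move=> v; apply: diffn_near_eq (IH _ _ (DF v) (DF' v)).
by near=> z; rewrite [RHS]ddirD //; near: z.
Unshelve. all: by end_near. Qed.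

Lemma diffnZ k V W (a : R) (F : V -> W) y : diffn k F y -> diffn k (a *: F) y.
Proof.
elim: k F => [//|k IH] F [dF DF]; split.
  by near=> z; apply: differentiableZ; near: z.
move=> v; apply: diffn_near_eq (IH _ (DF v)).
by near=> z; rewrite [RHS]ddirZ //; near: z.
Unshelve. all: by end_near. Qed.

Lemma diffn_sum k V W (I : Type) (r : seq I) (P : pred I) (F : I -> V -> W) y :
  (forall i, diffn k (F i) y) -> diffn k (fun z => \sum_(i <- r | P i) F i z) y.
Proof.
move=> dF; elim: r => [|i r IH].
  by rewrite (_ : (fun z => _) = cst 0); [exact: diffn_cst|apply/funext=> z; rewrite big_nil].
case Pi : (P i); last first.
  by rewrite (_ : (fun z => _) = (fun z => \sum_(i <- r | P i) F i z)) //;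
     apply/funext=> z; rewrite big_cons Pi.
rewrite (_ : (fun z => _) = (F i + fun z => \sum_(i <- r | P i) F i z)); first exact: diffnD.
by apply/funext=> z; rewrite big_cons Pi.
Qed.

Lemma diffnM k V (F F' : V -> R) y : diffn k F y -> diffn k F' y -> diffn k (fun z => F z * F' z) y.
Proof.
elim: k F F' => [//|k IH] F F' F1 F1'; have F2 := diffnS F1; have F2' := diffnS F1'.
move: F1 F1' => [dF DF] [dF' DF']; split.
  by near=> z; apply: differentiableM; near: z.
move=> v; apply: diffn_near_eq (diffnD (IH _ _ F2 (DF' v)) (IH _ _ (DF v) F2')).
near=> z; rewrite ddirM; last 2 first.
- by near: z.
- by near: z.
by rewrite -![(_ + _ : _ -> _) _]/(_ + _) /= addrC.
Unshelve. all: by end_near. Qed.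

Lemma diffn_prod k V (I : Type) (r : seq I) (P : pred I) (F : I -> V -> R) y :
  (forall i, diffn k (F i) y) -> diffn k (fun z => \prod_(i <- r | P i) F i z) y.
Proof.
move=> dF; elim: r => [|i r IH].
  by rewrite (_ : (fun z => _) = cst 1); [exact: diffn_cst|apply/funext=> z; rewrite big_nil].
case Pi : (P i); last first.
  by rewrite (_ : (fun z => _) = (fun z => \prod_(i <- r | P i) F i z)) //;
     apply/funext=> z; rewrite big_cons Pi.
rewrite (_ : (fun z => _) = (fun z => F i z * \prod_(i <- r | P i) F i z)); first exact: diffnM.
by apply/funext=> z; rewrite big_cons Pi.
Qed.

(** By induction on k: the derivative of 1/F involves only 1/F and the
    derivatives of F. *)
Lemma diffnV k V (F : V -> R) y : F y != 0 -> diffn k F y -> diffn k (fun z => (F z)^-1) y.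
Proof.
move=> F0; elim: k => [//|k IH] F1; have IH' := IH (diffnS F1).
move: F1 => [dF DF].
have NF0 : \forall z \near y, F z != 0.
  have cF : {for y, continuous F} by apply: differentiable_continuous; exact: nbhs_singleton dF.
  exact: (cvgr_neq0 _ cF F0).
split.
  by near=> z; apply: differentiableV; near: z.
move=> v; apply: diffn_near_eq (diffnZ (-1) (diffnM (diffnM IH' IH') (DF v))).
near=> z; rewrite ddirE deriveV; last 2 first.
- by near: z.
- by apply: diff_derivable; near: z.
by rewrite -![(_ *: _ : _ -> _) _]/(_ *: _) /= /GRing.scale /= expr2 invfM mulNr mul1r mulNr ddirE.
Unshelve. all: by end_near. Qed.

Lemma diff_mx V p q (F : V -> 'M[R]_(p,q)) y :
  (forall i j, differentiable (fun z => F z i j) y) -> differentiable F y.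
Proof.
move=> dF.
rewrite (_ : F = \sum_(i < p) \sum_(j < q) (fun z => F z i j *: delta_mx i j)).
  apply: differentiable_sum => i; apply: differentiable_sum => j.
  exact: differentiableZl.
apply/funext => z; rewrite [LHS]matrix_sum_delta fct_sumE; apply: eq_bigr => i _.
by rewrite fct_sumE.
Qed.

Lemma diff_entry V p q (F : V -> 'M[R]_(p,q)) y i j :
  differentiable F y -> differentiable (fun z => F z i j) y.
Proof.
move=> dF; apply: (@differentiable_comp _ _ _ _ F (fun N : 'M_(p,q) => N i j : R)) => //.
exact: differentiable_coord.
Qed.

Lemma ddir_entry V p q (F : V -> 'M[R]_(p,q)) y v i j :
  differentiable F y -> ddir (fun z => F z i j) v y = ddir F v y i j.
Proof. by rewrite !ddirE; move=> dF; rewrite derive_mx ?mxE //; exact: diff_derivable. Qed.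

(** Differentiability of matrix valued maps is reduced to the scalar case, where
    products, determinants and inverses are available. *)
Lemma diffn_mxP k V p q (F : V -> 'M[R]_(p,q)) y :
  diffn k F y <-> forall i j, diffn k (fun z => F z i j) y.
Proof.
elim: k F => [//|k IH] F; split=> [[dF DF] i j|dF].
  split; first by near=> z; apply: diff_entry; near: z.
  move=> v; have /IH/(_ i j) := DF v; apply: diffn_near_eq.
  by near=> z; rewrite ddir_entry //; near: z.
have DF : \forall z \near y, differentiable F z.
  have : \forall z \near y, forall ij : 'I_p * 'I_q, differentiable (fun z => F z ij.1 ij.2) z.
    apply: filter_forall => ij; by case: (dF ij.1 ij.2).
  by apply: filter_app; near=> z => H; apply: diff_mx => i j; exact: (H (i,j)).
split=> // v; apply/IH => i j; case: (dF i j) => _ /(_ v); apply: diffn_near_eq.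
by near=> z; rewrite ddir_entry //; near: z.
Unshelve. all: by end_near. Qed.


Lemma diffn_mulmx k V p q r (F : V -> 'M[R]_(p,q)) (F' : V -> 'M[R]_(q,r)) y :
  diffn k F y -> diffn k F' y -> diffn k (fun z => F z *m F' z) y.
Proof.
move=> /diffn_mxP dF /diffn_mxP dF'; apply/diffn_mxP => i j.
rewrite (_ : (fun z => _) = (fun z => \sum_l F z i l * F' z l j)).
  by apply: diffn_sum => l; exact: diffnM.
by apply/funext => z; rewrite mxE.
Qed.

Lemma diffn_det k V p (F : V -> 'M[R]_p) y : diffn k F y -> diffn k (fun z => \det (F z)) y.
Proof.
move=> /diffn_mxP dF; apply: diffn_sum => s; apply: diffnM; first exact: diffn_cst.
exact: diffn_prod.
Qed.

(** Cramer's rule. *)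
Lemma diffn_invmx k V p (F : V -> 'M[R]_p) y : 
  (\forall z \near y, F z \in unitmx) -> diffn k F y -> diffn k (fun z => invmx (F z)) y.
Proof.
move=> uF dF; have detF : \det (F y) != 0.
  by rewrite -unitfE -unitmxE; exact: nbhs_singleton uF.
apply: (@diffn_near_eq k _ _ (fun z => (\det (F z))^-1 *: \adj (F z))).
  by near=> z; rewrite /invmx ifT //; near: z.
apply/diffn_mxP => i j.
rewrite (_ : (fun z => _) = (fun z => (\det (F z))^-1 *
  ((-1) ^+ (j + i) * \det (row' j (col' i (F z)))))); last first.
  by apply/funext => z; rewrite !mxE.
apply: diffnM; first by apply: diffnV => //; exact: diffn_det.
apply: diffnM; first exact: diffn_cst.
apply: diffn_det; apply/diffn_mxP => k1 k2.
rewrite (_ : (fun z => _) = (fun z => F z (lift j k1) (lift i k2))); last first.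
  by apply/funext=> z; rewrite !mxE.
by move: dF => /diffn_mxP.
Unshelve. all: by end_near. Qed.

Lemma diff_mulmx V p q r (F : V -> 'M[R]_(p,q)) (F' : V -> 'M[R]_(q,r)) y :
  differentiable F y -> differentiable F' y ->
  differentiable (fun z => F z *m F' z) y.
Proof.
move=> dF dF'; apply: diff_mx => i j.
rewrite (_ : (fun z => _) = \sum_l (fun z => F z i l * F' z l j)).
  by apply: differentiable_sum => l; apply: differentiableM; apply: diff_entry.
by apply/funext => z; rewrite mxE fct_sumE.
Qed.

Lemma ddir_mulmx V p q r (F : V -> 'M[R]_(p,q)) (F' : V -> 'M[R]_(q,r)) v y :
  differentiable F y -> differentiable F' y ->
  ddir (fun z => F z *m F' z) v y = ddir F v y *m F' y + F y *m ddir F' v y.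
Proof.
move=> dF dF'; apply/matrixP => i j.
rewrite -ddir_entry; last exact: diff_mulmx.
rewrite (_ : (fun z => _) = (fun z => \sum_l F z i l * F' z l j)); last first.
  by apply/funext => z; rewrite mxE.
rewrite ddir_sum; last first.
  by move=> l; apply: differentiableM; exact: diff_entry.
rewrite !mxE -big_split; apply: eq_bigr => l _.
by rewrite ddirM ?ddir_entry //; exact: diff_entry.
Qed.

Lemma diff_tr V p q (F : V -> 'M[R]_(p,q)) y :
  differentiable F y -> differentiable (fun z => (F z)^T) y.
Proof.
move=> dF; apply: diff_mx => i j.
rewrite (_ : (fun z => _) = (fun z => F z j i)); first exact: diff_entry.
by apply/funext => z; rewrite mxE.
Qed.

Lemma ddir_tr V p q (F : V -> 'M[R]_(p,q)) v y :
  differentiable F y -> ddir (fun z => (F z)^T) v y = (ddir F v y)^T.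
Proof.
move=> dF; apply/matrixP => i j; rewrite -ddir_entry ?mxE; last exact: diff_tr.
rewrite -ddir_entry //; congr (ddir _ _ y); by apply/funext => z; rewrite mxE.
Qed.

Lemma ddir_chain V V' W (F : V' -> W) (P : V -> V') v y :
  differentiable P y -> differentiable F (P y) ->
  ddir (fun z => F (P z)) v y = ddir F (ddir P v y) (P y).
Proof.
move=> dP dF; rewrite !ddirE deriveE; last exact: differentiable_comp.
by rewrite diff_comp //= [in RHS]deriveE // [in RHS]deriveE.
Qed.

Lemma ddir_linD V W (F : V -> W) u v y : differentiable F y ->
  ddir F (u + v) y = ddir F u y + ddir F v y.
Proof. by move=> dF; rewrite !ddirE !deriveE // linearD. Qed.

Lemma ddir_linZ V W (F : V -> W) a u y : differentiable F y ->
  ddir F (a *: u) y = a *: ddir F u y.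
Proof. by move=> dF; rewrite !ddirE !deriveE // linearZ. Qed.

Lemma ddir_basis n W (F : 'rV[R]_n -> W) v y : differentiable F y ->
  ddir F v y = \sum_i v 0 i *: ddir F (basis_vec i) y.
Proof.
move=> dF; rewrite ddirE [v in LHS]row_sum_delta deriveE // linear_sum; apply: eq_bigr => i _.
by rewrite linearZ ddirE deriveE.
Qed.

Lemma Ck_diffn k n W (U : set 'rV[R]_n) (F : 'rV[R]_n -> W) y :
  nbhs y U -> Ck k U F -> diffn k F y.
Proof.
move=> yU; elim: k F => [//|k IH] F [dF DF].
have ndF : \forall z \near y, differentiable F z by apply: filterS yU; exact: dF.
split=> // v.
apply: (@diffn_near_eq k _ _ (fun z => \sum_i v 0 i *: ddir F (basis_vec i) z)).
  by near=> z; rewrite [RHS]ddir_basis //; near: z.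
apply: diffn_sum => i; apply/diffnZ/IH.
by rewrite (_ : ddir F _ = (fun y => 'D_(basis_vec i) F y)); [exact: DF|apply/funext => z; rewrite ddirE].
Unshelve. all: by end_near. Qed.

Lemma ddir_lin V W (L : {linear V -> W}) v y : continuous L -> ddir L v y = L v.
Proof. by move=> cL; rewrite ddirE deriveE ?diff_lin //; exact: linear_differentiable. Qed.

Lemma diffn_comp_lin k V V' W (L : {linear V -> V'}) (F : V' -> W) y :
  continuous L -> diffn k F (L y) -> diffn k (F \o L) y.
Proof.
move=> cL; elim: k F => [//|k IH] F [dF DF].
have dF' : \forall z \near y, differentiable F (L z) by exact: (cL y _ dF).
split.
  near=> z; apply: differentiable_comp; last by near: z.
  exact: linear_differentiable.
move=> v; apply: diffn_near_eq (IH _ (DF (L v))).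
near=> z; rewrite ddir_chain; last by near: z.
  by rewrite /= ddir_lin.
exact: linear_differentiable.
Unshelve. all: by end_near. Qed.

End Calculus.

(** * Symmetry of second derivatives *)

Section Young.
Context {R : realType} {V : normedModType R}.

Lemma is_derive_line (F : V -> R) (u w : V) (t : R) :
  differentiable F (t *: u + w) ->
  is_derive t 1 (fun s => F (s *: u + w)) ('D_u F (t *: u + w)).
Proof.
move=> dF.
have dl : is_derive t 1 (fun s : R => s *: u + w) u.
  have d1 : is_diff t (fun s : R => s *: u) (fun s => s *: u) by exact: is_diff_scalel.
  have d2 : is_diff t ((fun s : R => s *: u) + cst w) ((fun s => s *: u) + 0).
    exact: is_diffD.
  have ddl : differentiable (fun s : R => s *: u + w) t by case: d2.
  apply: DeriveDef; first exact: diff_derivable.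
  rewrite deriveE //; case: d2 => _.
  rewrite -[(fun s : R => s *: u + w)]/((fun s : R => s *: u) + cst w) => ->.
  by rewrite -[LHS]/(1 *: u + 0) scale1r addr0.
have ddl : differentiable (fun s : R => s *: u + w) t by apply/derivable1_diffP; case: dl.
have dc : differentiable (F \o (fun s : R => s *: u + w)) t by exact: differentiable_comp.
apply: DeriveDef; first exact: (diff_derivable dc).
by have := ddir_chain (1 : R^o) ddl dF; rewrite !ddirE (derive_val (is_derive := dl)).
Qed.

(** The mean value theorem along t |-> F (t u + h v + y) - F (t u + y), followed
    by the first order expansion of the derivative of F in direction u, shows
    that the second difference of F is h^2 times the iterated derivative, up to
    o(h^2).  The second difference is symmetric in u and v, whence
    [young_scalar]. *)
Lemma second_difference (F : V -> R) (y u v : V) :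
  (\forall z \near y, differentiable F z) -> differentiable ('D_u F) y ->
  forall e : R, 0 < e -> exists2 d : R, 0 < d & forall h, 0 < h < d ->
  `|F (h *: u + (h *: v + y)) - F (h *: u + y) - F (h *: v + y) + F y
     - h ^+ 2 * 'D_v ('D_u F) y| <= e * h ^+ 2.
Proof.
move=> dF dg e e0.
(* N bounds the points t u + h v with 0 <= t <= h by h N. *)
pose N := `|u| + `|v| + 1.
have N0 : 0 < N by rewrite /N ltr_wpDl // addr_ge0.
have e'0 : 0 < e / (2 * N) by rewrite divr_gt0 // mulr_gt0.
have [_ /eqaddoP /(_ _ e'0) og] := iffLR (diff_locallyP _ _) dg.
have dF0 : \forall k \near (0 : V), differentiable F (k + y).
  by move: dF; rewrite (near_shift 0 y) /=; apply: filter_app; near=> k; rewrite /= subr0.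
have [d /= d0 dP] := iffLR (nbhs_ballP _ _) (filterI og dF0).
have {dP} dP k : `|k| < d -> differentiable F (k + y) /\
   `|'D_u F (k + y) - 'D_u F y - 'D_k ('D_u F) y| <= e / (2 * N) * `|k|.
  move=> kd; have [] := dP k; first by rewrite -ball_normE /= sub0r normrN.
  move=> ogk dk; split => //; move: ogk.
  rewrite /= -![(_ + _ : _ -> _) _]/(_ + _) -![(- _ : _ -> _) _]/(- _) /=.
  by rewrite -![(_ + _ : _ -> _) _]/(_ + _) /cst /= -deriveE // opprD addrA.
exists (d / N); first by rewrite divr_gt0.
move=> h /andP[h0 hd]; rewrite ltr_pdivlMr // in hd.
have b1 t : 0 <= t <= h -> `|t *: u| <= h * N.
  move=> /andP[t0 th]; rewrite normrZ ger0_norm //.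
  rewrite ler_pM // /N -addrA lerDl addr_ge0 //.
have b2 t : 0 <= t <= h -> `|t *: u + h *: v| <= h * N.
  move=> /andP[t0 th]; apply: le_trans (ler_normD _ _) _.
  rewrite !normrZ ger0_norm // (ger0_norm (ltW h0)) /N.
  apply: (@le_trans _ _ (h * `|u| + h * `|v|)); first by rewrite lerD2r ler_wpM2r.
  by rewrite -mulrDr ler_wpM2l ?(ltW h0) // lerDl.
pose p t := F (t *: u + (h *: v + y)) - F (t *: u + y).
pose dp t := 'D_u F (t *: u + (h *: v + y)) - 'D_u F (t *: u + y).
have Dp t : 0 <= t <= h -> is_derive t 1 p (dp t).
  move=> ht; apply: is_deriveB.
    apply: is_derive_line; rewrite addrA; apply: (dP _ _).1.
    exact: le_lt_trans (b2 _ ht) _.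
  apply: is_derive_line; apply: (dP _ _).1.
  exact: le_lt_trans (b1 _ ht) _.
have [||t] := @MVT _ p dp 0 h h0.
- by move=> t; rewrite in_itv /= => /andP[t0 th]; apply: Dp; rewrite !ltW.
- apply: derivable_within_continuous => t; rewrite in_itv /= => ht.
  by case: (Dp t ht).
rewrite in_itv /= => /andP[t0 th]; rewrite subr0 => pe.
have ht : 0 <= t <= h by rewrite !ltW.
rewrite (_ : _ + F y = p h - p 0); last first.
  by rewrite /p !scale0r !add0r; ring.
rewrite pe /dp.
have [_ c1] := dP _ (le_lt_trans (b1 _ ht) hd).
have [_ c2] := dP _ (le_lt_trans (b2 _ ht) hd).
have DE : 'D_(t *: u + h *: v) ('D_u F) y = 'D_(t *: u) ('D_u F) y + h *: 'D_v ('D_u F) y.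
  by have := ddir_linD (t *: u) (h *: v) dg; rewrite (ddir_linZ h v dg) !ddirE.
rewrite DE addrAC -addrA in c2.
set D1 := 'D_u F (t *: u + h *: v + y) in c2.
rewrite addrA -/D1; set D2 := 'D_u F (t *: u + y) in c1 *.
set Dv := 'D_v _ _ in c2 *; set Dt := 'D_(t *: u) _ _ in c1 c2.
rewrite /GRing.scale /= in c2.
have -> : (D1 - D2) * h - h ^+ 2 * Dv =
  h * ((D1 - (Dt + h * Dv) - 'D_u F y) - (D2 - 'D_u F y - Dt)) by ring.
rewrite normrM gtr0_norm // expr2 mulrCA ler_wpM2l // ?(ltW h0) //.
apply: le_trans (ler_normB _ _) _.
have b c : c <= h * N -> e / (2 * N) * c <= e / 2 * h.
  move=> cN; apply: le_trans (ler_wpM2l (ltW e'0) cN) _.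
  by rewrite le_eqVlt; apply/orP; left; apply/eqP; field; rewrite gt_eqF.
have c1' := le_trans c1 (b _ (b1 _ ht)).
have c2' := le_trans c2 (b _ (b2 _ ht)).
rewrite (_ : D1 - (Dt + h * Dv) - 'D_u F y = D1 + (- (Dt + h * Dv) - 'D_u F y)); last by rewrite addrA.
apply: le_trans (lerD c2' c1') _.
by rewrite -mulrDl -splitr.
Unshelve. all: by end_near. Qed.

Lemma young_scalar (F : V -> R) (y u v : V) :
  (\forall z \near y, differentiable F z) ->
  differentiable ('D_u F) y -> differentiable ('D_v F) y ->
  'D_u ('D_v F) y = 'D_v ('D_u F) y.
Proof.
move=> dF du dv; apply/eqP; rewrite -subr_eq0 -normr_eq0; apply/eqP/le_anti.
rewrite normr_ge0 andbT; apply/ler_addgt0Pr => e e0; rewrite add0r.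
have e20 : 0 < e / 2 by rewrite divr_gt0.
have [d1 d10 P1] := second_difference v dF du e20.
have [d2 d20 P2] := second_difference u dF dv e20.
pose h := Num.min d1 d2 / 2.
have h0 : 0 < h by rewrite divr_gt0 // lt_min d10.
have h1 : h < d1.
  by rewrite /h ltr_pdivrMr // gt_min [d1 * 2]mulr_natr mulr2n ltrDr d10.
have h2 : h < d2.
  by rewrite /h ltr_pdivrMr // gt_min [d2 * 2]mulr_natr mulr2n ltrDr d20 orbT.
have {}P1 := P1 h; have {}P2 := P2 h; rewrite h0 h1 h2 in P1 P2.
move: (P1 isT) (P2 isT); rewrite [h *: v + (_ + y)]addrCA.
set A := F (_ + _); set B := F (_ + y); set C := F (_ + y); set E := F y.
set a := 'D_v _ _; set b := 'D_u _ _ => Pa Pb.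
have hh : 0 < h ^+ 2 by rewrite exprn_gt0.
rewrite -(ler_pM2r hh) -[X in _ * X]gtr0_norm // -normrM.
have -> : (b - a) * h ^+ 2 =
   (A - B - C + E - h ^+ 2 * a) - (A - C - B + E - h ^+ 2 * b) by ring.
apply: le_trans (ler_normB _ _) _; apply: le_trans (lerD Pa Pb) _.
by rewrite -mulrDl -splitr.
Qed.

Lemma young_mx p q (F : V -> 'M[R]_(p,q)) (y u v : V) : diffn 2 F y ->
  ddir (ddir F v) u y = ddir (ddir F u) v y.
Proof.
move=> [dF DF].
have dDe w : ddir F w = 'D_w F by apply/funext => z; rewrite ddirE.
have deE w i j : ddir (fun z => F z i j) w = 'D_w (fun z => F z i j).
  by apply/funext => z; rewrite ddirE.
have ddf w : differentiable (ddir F w) y by case: (DF w) => /nbhs_singleton.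
have dnear w i j : \forall z \near y, ddir F w z i j = ddir (fun z => F z i j) w z.
  by near=> z; rewrite ddir_entry //; near: z.
have dde w i j : differentiable (ddir (fun z => F z i j) w) y.
  exact: (differentiable_near_eq (dnear w i j) (diff_entry i j (ddf w))).
have swap w w' i j : ddir (ddir F w) w' y i j = ddir (ddir (fun z => F z i j) w) w' y.
  by rewrite -ddir_entry //; apply: ddir_near_eq.
apply/matrixP => i j; rewrite swap [RHS]swap !ddirE !deE; apply: young_scalar.
- by near=> z; apply: diff_entry; near: z.
- by rewrite -deE.
- by rewrite -deE.
Unshelve. all: by end_near. Qed.

End Young.

(** * The Levi-Civita connection in coordinates *)

Section Inner.
Context {R : realType} {n : nat}.
Implicit Types (G : 'M[R]_n) (u v w : 'rV[R]_n).

Lemma innerDl G u v w : inner G (u + v) w = inner G u w + inner G v w.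
Proof. by rewrite /inner !mulmxDl mxE. Qed.
Lemma innerDr G u v w : inner G w (u + v) = inner G w u + inner G w v.
Proof. by rewrite /inner linearD mulmxDr mxE. Qed.
Lemma innerZl G a u w : inner G (a *: u) w = a * inner G u w.
Proof. by rewrite /inner -!scalemxAl mxE. Qed.
Lemma innerZr G a u w : inner G w (a *: u) = a * inner G w u.
Proof. by rewrite /inner linearZ -scalemxAr mxE. Qed.
Lemma innerNl G u w : inner G (- u) w = - inner G u w.
Proof. by rewrite -scaleN1r innerZl mulN1r. Qed.
Lemma innerNr G u w : inner G w (- u) = - inner G w u.
Proof. by rewrite -scaleN1r innerZr mulN1r. Qed.
Lemma innerBl G u v w : inner G (u - v) w = inner G u w - inner G v w.
Proof. by rewrite innerDl innerNl. Qed.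
Lemma innerBr G u v w : inner G w (u - v) = inner G w u - inner G w v.
Proof. by rewrite innerDr innerNr. Qed.
Lemma inner0l G w : inner G 0 w = 0.
Proof. by rewrite -(scale0r 0) innerZl mul0r. Qed.
Lemma inner0r G w : inner G w 0 = 0.
Proof. by rewrite -(scale0r 0) innerZr mul0r. Qed.
Lemma inner_suml G (I : Type) (r : seq I) (P : pred I) F w :
  inner G (\sum_(i <- r | P i) F i) w = \sum_(i <- r | P i) inner G (F i) w.
Proof. by elim/big_rec2: _ => [|i a b _ <-]; rewrite ?inner0l ?innerDl. Qed.
Lemma inner_sumr G (I : Type) (r : seq I) (P : pred I) F w :
  inner G w (\sum_(i <- r | P i) F i) = \sum_(i <- r | P i) inner G w (F i).
Proof. by elim/big_rec2: _ => [|i a b _ <-]; rewrite ?inner0r ?innerDr. Qed.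
Lemma innerC G u v : G^T = G -> inner G u v = inner G v u.
Proof.
move=> GT; rewrite /inner; have <- : (v *m G *m u^T)^T = u *m G *m v^T.
  by rewrite !trmx_mul trmxK GT mulmxA.
by rewrite mxE.
Qed.

Lemma inner_expand G u v : inner G u v = \sum_i \sum_j u 0 i * v 0 j * G i j.
Proof.
rewrite /inner mxE exchange_big; apply: eq_bigr => j _ /=.
by rewrite !mxE mulr_suml; apply: eq_bigr => i _; rewrite mulrAC.
Qed.

Lemma innerE G u v : inner G u v = (u *m G *m v^T) 0 0.
Proof. by []. Qed.

Lemma inner_inj G u v : G \in unitmx -> (forall w, inner G u w = inner G v w) -> u = v.
Proof.
move=> uG H; suff e : u *m G = v *m G by rewrite -[u](mulmxK uG) e mulmxK.
apply/rowP => j; have := H (delta_mx 0 j).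
by rewrite /inner trmx_delta -!colE !mxE.
Qed.

Lemma posdef_unitmx G : (forall u, u != 0 -> 0 < inner G u u) -> G \in unitmx.
Proof.
move=> pG; rewrite -row_free_unit -kermx_eq0; apply/eqP/row_matrixP => i.
rewrite row0; apply/eqP/negPn/negP => /pG.
have /sub_kermxP e : (row i (kermx G) <= kermx G)%MS by exact: row_sub.
by rewrite /inner e mul0mx mxE ltxx.
Qed.

End Inner.

Section Connection.
Context {R : realType} {n : nat}.
Variable g : 'rV[R]_n -> 'M[R]_n.
Implicit Types (y u v w : 'rV[R]_n).

(** What the Koszul formula needs at a single point. *)
Record metric1 y : Prop := Metric1 {
  m1_diff : differentiable g y;
  m1_sym : \forall z \near y, (g z)^T = g z;
  m1_unit : g y \in unitmx }.

(** What the curvature tensor needs: it differentiates the Christoffel symbols,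
    hence the metric twice. *)
Record metric_germ y : Prop := MetricGerm {
  mg_dn : diffn 2 g y;
  mg_sym : \forall z \near y, (g z)^T = g z;
  mg_pos : \forall z \near y, forall u, u != 0 -> 0 < inner (g z) u u }.

Lemma metric_germ1 y : metric_germ y -> \forall z \near y, metric1 z.
Proof.
move=> [[dg _] /near_join sg pg]; near=> z; split.
- by near: z.
- by near: z.
- by apply: posdef_unitmx; near: z.
Unshelve. all: by end_near. Qed.

Lemma metric_germ_at y : metric_germ y -> metric1 y.
Proof. by move/metric_germ1/nbhs_singleton. Qed.

Lemma metric_germ_sym y : metric_germ y -> (g y)^T = g y.
Proof. by move/mg_sym/nbhs_singleton. Qed.

(** The Christoffel symbols of the first kind, as a trilinear form. *)
Definition koszul_form y u v w : R := 2^-1 *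
  (inner ((ddir g u y)) v w + inner ((ddir g v y)) u w - inner ((ddir g w y)) u v).

Lemma derive_metric_sym y u : metric1 y -> ((ddir g u y))^T = (ddir g u y).
Proof.
move=> [dg sg _]; rewrite -ddir_tr //; exact: ddir_near_eq.
Qed.

Lemma christoffel_formE y u v : christoffel_form g y u v =
  \sum_i \sum_j (u 0 i * v 0 j) *: \row_k christoffel g y i j k.
Proof.
apply/rowP => k; rewrite mxE summxE; apply: eq_bigr => i _.
rewrite summxE; apply: eq_bigr => j _; rewrite !mxE; set x := christoffel _ _ _ _ _; ring.
Qed.

Lemma christoffel_form_entry y u v k : christoffel_form g y u v 0 k =
  \sum_i \sum_j christoffel g y i j k * u 0 i * v 0 j.
Proof. by rewrite mxE. Qed.


Lemma derive_metric_expand y u v w : differentiable g y ->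
  inner ((ddir g u y)) v w = \sum_i \sum_j \sum_l u 0 i * v 0 j * w 0 l * dmetric g i j l y.
Proof.
move=> dg; rewrite ddir_basis // inner_expand.
under eq_bigr => j _ do under eq_bigr => l _ do rewrite summxE mulr_sumr.
under eq_bigr => j _ do rewrite exchange_big.
rewrite exchange_big; apply: eq_bigr => i _; apply: eq_bigr => j _; apply: eq_bigr => l _.
by rewrite mxE /dmetric -ddirE ddir_entry // !mulrA; congr (_ * _); rewrite mulrC mulrA.
Qed.

(** With constant fields the brackets in the Koszul formula vanish; the lemma
    identifies the classical expression of the Christoffel symbols with it.
    From here on the connection is handled only through this identity. *)
Lemma koszul y u v w : metric1 y ->
  inner (g y) (christoffel_form g y u v) w = koszul_form y u v w.
Proof.
move=> [dg /nbhs_singleton sg ug].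
have rowE i j : inner (g y) (\row_k christoffel g y i j k) w =
    2^-1 * \sum_l w 0 l * (dmetric g i j l y + dmetric g j i l y - dmetric g l i j y).
  have -> : (\row_k christoffel g y i j k) = 2^-1 *:
     ((\row_l (dmetric g i j l y + dmetric g j i l y - dmetric g l i j y)) *m invmx (g y)).
    apply/rowP => k; rewrite !mxE /christoffel; congr (_ * _); apply: eq_bigr => l _.
    by rewrite mxE mulrC -[in X in _ * X](trmxK (invmx (g y))) trmx_inv sg mxE.
  rewrite innerZl; congr (_ * _); rewrite innerE mulmxKV // mxE.
  by apply: eq_bigr => l _; rewrite !mxE mulrC.
rewrite christoffel_formE inner_suml.
under eq_bigr => i _ do rewrite inner_suml.
under eq_bigr => i _ do under eq_bigr => j _ do rewrite innerZl rowE mulrCA.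
under eq_bigr => i _ do rewrite -mulr_sumr.
rewrite -mulr_sumr /koszul_form; congr (_ * _).
rewrite !derive_metric_expand // [X in _ + X - _]exchange_big /=.
rewrite (_ : \sum_i \sum_j \sum_l w 0 i * u 0 j * v 0 l * dmetric g i j l y =
   \sum_i \sum_j \sum_l w 0 l * u 0 i * v 0 j * dmetric g l i j y); last first.
  by rewrite exchange_big; apply: eq_bigr => i _ /=; rewrite exchange_big.
rewrite -big_split -sumrB; apply: eq_bigr => i _ /=.
rewrite -big_split -sumrB; apply: eq_bigr => j _ /=.
rewrite mulr_sumr -big_split -sumrB; apply: eq_bigr => l _ /=.
ring.
Qed.

Lemma christoffel_formDl y u u' v : christoffel_form g y (u + u') v =
  christoffel_form g y u v + christoffel_form g y u' v.
Proof.
rewrite !christoffel_formE -big_split; apply: eq_bigr => i _ /=.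
rewrite -big_split; apply: eq_bigr => j _ /=.
by rewrite mxE mulrDl scalerDl.
Qed.

Lemma christoffel_formDr y u v v' : christoffel_form g y u (v + v') =
  christoffel_form g y u v + christoffel_form g y u v'.
Proof.
rewrite !christoffel_formE -big_split; apply: eq_bigr => i _ /=.
rewrite -big_split; apply: eq_bigr => j _ /=.
by rewrite mxE mulrDr scalerDl.
Qed.

Lemma christoffel_formZl y a u v : christoffel_form g y (a *: u) v = a *: christoffel_form g y u v.
Proof.
rewrite !christoffel_formE scaler_sumr; apply: eq_bigr => i _ /=.
rewrite scaler_sumr; apply: eq_bigr => j _ /=.
by rewrite mxE scalerA mulrA.
Qed.

Lemma christoffel_formZr y a u v : christoffel_form g y u (a *: v) = a *: christoffel_form g y u v.
Proof.
rewrite !christoffel_formE scaler_sumr; apply: eq_bigr => i _ /=.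
rewrite scaler_sumr; apply: eq_bigr => j _ /=.
by rewrite mxE scalerA mulrCA.
Qed.

Lemma christoffel_formC y u v : metric1 y -> christoffel_form g y u v = christoffel_form g y v u.
Proof.
move=> m; apply: (inner_inj (m1_unit m)) => w; rewrite !koszul // /koszul_form.
by rewrite (innerC u v (derive_metric_sym _ m)) [X in X - _]addrC.
Qed.

(** In the sum of two Koszul expressions four of the six derivatives cancel. *)
Lemma metric_compat y x v w : metric1 y ->
  inner ((ddir g x y)) v w = inner (g y) (christoffel_form g y x v) w
                       + inner (g y) v (christoffel_form g y x w).
Proof.
move=> m; have sg := nbhs_singleton (m1_sym m).
rewrite (innerC v _ sg) !koszul // /koszul_form.
rewrite (innerC w v (derive_metric_sym _ m)).
set a := inner _ v w; set b := inner _ x w; set d := inner _ x v; lra.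
Qed.

Lemma christoffel_form_diffn y u v : metric_germ y -> diffn 1 (fun z => christoffel_form g z u v) y.
Proof.
move=> mg; have [dg sg pg] := mg; have [ndg Dg] := dg.
have ug : \forall z \near y, g z \in unitmx.
  by near=> z; apply: posdef_unitmx; near: z.
apply/diffn_mxP => i k; rewrite (ord1 i).
rewrite (_ : (fun z => _) = (fun z => \sum_i \sum_j christoffel g z i j k * u 0 i * v 0 j)); last first.
  by apply/funext => z; rewrite christoffel_form_entry.
apply: diffn_sum => i'; apply: diffn_sum => j; apply: (diffnM (diffnM _ (diffn_cst _ _ _)) (diffn_cst _ _ _)).
rewrite /christoffel; apply: (diffnM (diffn_cst _ _ _)). apply: diffn_sum => l; apply: diffnM.
  have /diffn_mxP/(_ k l) := diffn_invmx ug dg; exact: diffnS.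
have dm a b c : diffn 1 (dmetric g a b c) y.
  have /diffn_mxP/(_ b c) : diffn 1 (ddir g (basis_vec a)) y by exact: Dg.
  apply: diffn_near_eq.
  by near=> z; rewrite /dmetric -ddirE ddir_entry //; near: z.
apply: (diffnD (diffnD (dm _ _ _) (dm _ _ _))).
by rewrite (_ : (fun z => _) = (-1) *: dmetric g l i' j);
  [exact: diffnZ|apply/funext=> z; rewrite -[RHS]/(-1 *: dmetric g l i' j z) scaleN1r].
Unshelve. all: by end_near. Qed.

End Connection.

(** * Covariant derivatives along a map, and the curvature tensor *)

Section Curvature.
Context {R : realType}.

Lemma diff_inner (n p : nat) (F : 'rV[R]_n -> 'M[R]_p) (V W : 'rV[R]_n -> 'rV[R]_p) y :
  differentiable F y -> differentiable V y -> differentiable W y ->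
  differentiable (fun z => inner (F z) (V z) (W z)) y.
Proof.
move=> dF dV dW; apply: diff_entry.
by apply: diff_mulmx; [exact: diff_mulmx|exact: diff_tr].
Qed.

Lemma ddir_inner (n p : nat) (F : 'rV[R]_n -> 'M[R]_p) (V W : 'rV[R]_n -> 'rV[R]_p) u y :
  differentiable F y -> differentiable V y -> differentiable W y ->
  ddir (fun z => inner (F z) (V z) (W z)) u y =
  inner (F y) (ddir V u y) (W y) + inner (ddir F u y) (V y) (W y) + inner (F y) (V y) (ddir W u y).
Proof.
move=> dF dV dW; rewrite ddir_entry; last first.
  by apply: diff_mulmx; [exact: diff_mulmx|exact: diff_tr].
rewrite ddir_mulmx; [|exact: diff_mulmx|exact: diff_tr].
by rewrite ddir_mulmx // ddir_tr // mxE mulmxDl mxE.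
Qed.

Lemma ddir_id (V : normedModType R) (u y : V) : ddir id u y = u.
Proof. by rewrite ddirE derive_id. Qed.

Lemma diff_id (V : normedModType R) (y : V) : differentiable id y.
Proof. by have [] := is_diff_id y. Qed.

Lemma diffn_id (V : normedModType R) k (y : V) : diffn k id y.
Proof.
case: k => [//|k]; split; first by apply: nearW => z; exact: diff_id.
move=> v; rewrite (_ : ddir id v = cst v); first exact: diffn_cst.
by apply/funext => z; rewrite ddir_id.
Qed.

Section Along.
Context {n p : nat}.
Variables (G : 'rV[R]_p -> 'M[R]_p) (P : 'rV[R]_n -> 'rV[R]_p).
Implicit Types (y u v w : 'rV[R]_n) (V W : 'rV[R]_n -> 'rV[R]_p).

Definition dchristoffel (x a b c : 'rV[R]_p) : 'rV[R]_p :=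
  ddir (fun z => christoffel_form G z b c) a x.

(** The pullback of the Levi-Civita connection of G by P, acting on vector fields
    along P. *)
Definition nabla u V y : 'rV[R]_p := ddir V u y + christoffel_form G (P y) (ddir P u y) (V y).

Lemma christoffel_basis x i j k :
  christoffel_form G x (basis_vec i) (basis_vec j) 0 k = christoffel G x i j k.
Proof.
rewrite christoffel_form_entry (bigD1 i) //= (bigD1 j) //= !mxE !eqxx !mulr1.
rewrite !big1 ?addr0 // => [i' ni|j' nj].
  by rewrite big1 // => j' _; rewrite !mxE (negbTE ni) mulr0 mul0r.
by rewrite !mxE (negbTE nj) mulr0.
Qed.

Lemma christoffel_diff x i j k : metric_germ G x ->
  differentiable (fun z => christoffel G z i j k) x.
Proof.
move=> mg; have := diffn_diff (christoffel_form_diffn (basis_vec i) (basis_vec j) mg).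
move=> /(diff_entry 0 k); apply: differentiable_near_eq.
by near=> z; rewrite christoffel_basis.
Unshelve. all: by end_near. Qed.

Lemma dchristoffel_entry x a b c k : metric_germ G x -> dchristoffel x a b c 0 k =
  \sum_i \sum_j ddir (fun z => christoffel G z i j k) a x * b 0 i * c 0 j.
Proof.
move=> mg; rewrite /dchristoffel -ddir_entry; last exact: (diffn_diff (christoffel_form_diffn b c mg)).
rewrite (_ : (fun z => _) = (fun z => \sum_i \sum_j christoffel G z i j k * b 0 i * c 0 j)); last first.
  by apply/funext => z; rewrite christoffel_form_entry.
have dc i j := christoffel_diff i j k mg.
rewrite ddir_sum => [|i]; last first.
  by apply: diff_sum => j; apply: differentiableM => //; apply: differentiableM.
apply: eq_bigr => i _; rewrite ddir_sum => [|j]; last first.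
  by apply: differentiableM => //; apply: differentiableM.
apply: eq_bigr => j _; rewrite ddirM //; last exact: differentiableM.
by rewrite ddirM // !ddir_cst !mulr0 !addr0.
Qed.

(** Product rule for the Christoffel form as a bilinear form depending on the
    point P z. *)
Lemma ddir_christoffel V W w y : metric_germ G (P y) ->
  differentiable P y -> differentiable V y -> differentiable W y ->
  differentiable (fun z => christoffel_form G (P z) (V z) (W z)) y /\
  ddir (fun z => christoffel_form G (P z) (V z) (W z)) w y =
   dchristoffel (P y) (ddir P w y) (V y) (W y) + christoffel_form G (P y) (ddir V w y) (W y)
   + christoffel_form G (P y) (V y) (ddir W w y).
Proof.
move=> mg dP dV dW.
have dc i j k := christoffel_diff i j k mg.
have dcP i j k : differentiable (fun z => christoffel G (P z) i j k) y.
  exact: differentiable_comp dP (dc i j k).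
have E k z : christoffel_form G (P z) (V z) (W z) 0 k =
  \sum_i \sum_j christoffel G (P z) i j k * V z 0 i * W z 0 j.
  exact: christoffel_form_entry.
have dE i j k : differentiable (fun z => christoffel G (P z) i j k * V z 0 i * W z 0 j) y.
  by apply: differentiableM; [apply: differentiableM => //|]; exact: diff_entry.
have dS k : differentiable (fun z => \sum_i \sum_j christoffel G (P z) i j k * V z 0 i * W z 0 j) y.
  by apply: diff_sum => i; apply: diff_sum => j.
have D : differentiable (fun z => christoffel_form G (P z) (V z) (W z)) y.
  apply: diff_mx => i k; rewrite (ord1 i); move: (dS k); apply: differentiable_near_eq.
  by near=> z; rewrite E.
split=> //; apply/rowP => k; rewrite -ddir_entry //.
rewrite (_ : (fun z => _) = (fun z => \sum_i \sum_j christoffel G (P z) i j k * V z 0 i * W z 0 j)); last first.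
  by apply/funext => z; rewrite E.
rewrite !mxE (dchristoffel_entry _ _ _ _ mg) -!big_split /=.
rewrite ddir_sum => [|i]; last exact: diff_sum.
apply: eq_bigr => i _; rewrite ddir_sum // -!big_split; apply: eq_bigr => j _ /=.
rewrite ddirM; [|by apply: differentiableM => //; exact: diff_entry|exact: diff_entry].
rewrite ddirM //; last exact: diff_entry.
by rewrite (ddir_chain w dP (dc i j k)) (ddir_entry _ _ _ dV) (ddir_entry _ _ _ dW) mulrDl.
Unshelve. all: by end_near. Qed.

Lemma nabla_compat u V W y : metric1 G (P y) ->
  differentiable P y -> differentiable V y -> differentiable W y ->
  ddir (fun z => inner (G (P z)) (V z) (W z)) u y =
  inner (G (P y)) (nabla u V y) (W y) + inner (G (P y)) (V y) (nabla u W y).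
Proof.
move=> m dP dV dW; rewrite ddir_inner //; last first.
  exact: differentiable_comp dP (m1_diff m).
rewrite (ddir_chain u dP (m1_diff m)) (metric_compat _ _ _ m) /nabla innerDl innerDr.
ring.
Qed.

(** Torsion freeness is the symmetry of the Christoffel symbols together with the
    symmetry of the second derivatives of P. *)
Lemma nabla_symm u v y : metric1 G (P y) -> diffn 2 P y ->
  nabla u (ddir P v) y = nabla v (ddir P u) y.
Proof.
by move=> m dP; rewrite /nabla (young_mx u v dP) (christoffel_formC _ _ m).
Qed.

Lemma nabla_diff v V y : metric_germ G (P y) -> diffn 2 P y -> diffn 2 V y ->
  differentiable (nabla v V) y.
Proof.
move=> mg dP dV; have [_ dP'] := dP; have [_ dV'] := dV.
apply: differentiableD; first exact: diffn_diff (dV' v : diffn 1 _ _).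
have [] // := @ddir_christoffel (ddir P v) V 0 y mg (diffn_diff dP) _ (diffn_diff dV).
exact: diffn_diff (dP' v : diffn 1 _ _).
Qed.

End Along.

Lemma cov_cst p (G : 'rV[R]_p -> 'M[R]_p) b w :
  cov G b (cst w) = (fun z => christoffel_form G z b w).
Proof. by apply/funext => z; rewrite /cov derive_cst add0r. Qed.

Lemma covE p (G : 'rV[R]_p -> 'M[R]_p) b X x :
  cov G b X x = nabla G id b X x.
Proof. by rewrite /cov /nabla ddirE ddir_id. Qed.

Lemma curvatureE p (G : 'rV[R]_p -> 'M[R]_p) x a b w :
  curvature G x a b w =
   dchristoffel G x a b w + christoffel_form G x a (christoffel_form G x b w)
   - (dchristoffel G x b a w + christoffel_form G x b (christoffel_form G x a w)).
Proof. by rewrite /curvature !cov_cst /dchristoffel !ddirE. Qed.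

(** Expanding both iterated derivatives, all terms containing a second derivative
    of P or of V cancel by symmetry and those with one derivative of V cancel
    in pairs; the rest is the curvature. *)
Lemma ricci_identity n p (G : 'rV[R]_p -> 'M[R]_p) (P V : 'rV[R]_n -> 'rV[R]_p) u v y :
  metric_germ G (P y) -> diffn 2 P y -> diffn 2 V y ->
  nabla G P u (nabla G P v V) y - nabla G P v (nabla G P u V) y =
  curvature G (P y) (ddir P u y) (ddir P v y) (V y).
Proof.
move=> mg dP dV; have [_ dP'] := dP; have [_ dV'] := dV.
have dPv w : differentiable (ddir P w) y by exact: diffn_diff (dP' w : diffn 1 _ _).
have dVv w : differentiable (ddir V w) y by exact: diffn_diff (dV' w : diffn 1 _ _).
have E a b : nabla G P a (nabla G P b V) y =
   ddir (ddir V b) a y + (dchristoffel G (P y) (ddir P a y) (ddir P b y) (V y)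
   + christoffel_form G (P y) (ddir (ddir P b) a y) (V y)
   + christoffel_form G (P y) (ddir P b y) (ddir V a y))
   + (christoffel_form G (P y) (ddir P a y) (ddir V b y)
   + christoffel_form G (P y) (ddir P a y) (christoffel_form G (P y) (ddir P b y) (V y))).
  have [d1 e1] := @ddir_christoffel _ _ G P (ddir P b) V a y mg (diffn_diff dP) (dPv b) (diffn_diff dV).
  rewrite {1}/nabla {2}/nabla christoffel_formDr; congr (_ + _).
  by rewrite [LHS](ddirD _ (dVv b) d1) e1.
rewrite !E curvatureE (young_mx v u dV) (young_mx v u dP).
set a1 := ddir (ddir V v) u y; set c1 := christoffel_form _ _ (ddir (ddir P v) u y) _.
set c2 := christoffel_form _ _ (ddir P v y) (ddir V u y).
set c3 := christoffel_form _ _ (ddir P u y) (ddir V v y).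
set d1 := dchristoffel _ _ (ddir P u y) _ _; set d2 := dchristoffel _ _ (ddir P v y) _ _.
set r1 := christoffel_form _ _ _ (christoffel_form _ _ _ _).
set r2 := christoffel_form _ _ (ddir P v y) (christoffel_form _ _ _ _).
apply/rowP => k; rewrite !mxE; ring.
Qed.

Section Tensor.
Context {p : nat}.
Variable (G : 'rV[R]_p -> 'M[R]_p) (x : 'rV[R]_p).
Hypothesis mg : metric_germ G x.
Implicit Types a b c d : 'rV[R]_p.

(** The curvature tensor with all indices lowered. *)
Definition riem a b c d : R := inner (G x) (curvature G x a b c) d.

Lemma dchristoffelDl a a' b c : dchristoffel G x (a + a') b c = dchristoffel G x a b c + dchristoffel G x a' b c.
Proof. by rewrite /dchristoffel ddir_linD //; exact: (diffn_diff (christoffel_form_diffn b c mg)). Qed.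
Lemma dchristoffelZl k a b c : dchristoffel G x (k *: a) b c = k *: dchristoffel G x a b c.
Proof. by rewrite /dchristoffel ddir_linZ //; exact: (diffn_diff (christoffel_form_diffn b c mg)). Qed.
Lemma dchristoffelDr a b c c' : dchristoffel G x a b (c + c') = dchristoffel G x a b c + dchristoffel G x a b c'.
Proof.
rewrite /dchristoffel -ddirD; [|exact: (diffn_diff (christoffel_form_diffn b _ mg))..].
by congr (ddir _ _ _); apply/funext => z; rewrite christoffel_formDr.
Qed.
Lemma dchristoffelZr k a b c : dchristoffel G x a b (k *: c) = k *: dchristoffel G x a b c.
Proof.
rewrite /dchristoffel -ddirZ; [|exact: (diffn_diff (christoffel_form_diffn b _ mg))].
by congr (ddir _ _ _); apply/funext => z; rewrite christoffel_formZr.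
Qed.
Lemma dchristoffelDm a b b' c : dchristoffel G x a (b + b') c = dchristoffel G x a b c + dchristoffel G x a b' c.
Proof.
rewrite /dchristoffel -ddirD; [|exact: (diffn_diff (christoffel_form_diffn _ c mg))..].
by congr (ddir _ _ _); apply/funext => z; rewrite christoffel_formDl.
Qed.
Lemma dchristoffelZm k a b c : dchristoffel G x a (k *: b) c = k *: dchristoffel G x a b c.
Proof.
rewrite /dchristoffel -ddirZ; [|exact: (diffn_diff (christoffel_form_diffn _ c mg))].
by congr (ddir _ _ _); apply/funext => z; rewrite christoffel_formZl.
Qed.
Lemma dchristoffelC a b c : dchristoffel G x a b c = dchristoffel G x a c b.
Proof.
rewrite /dchristoffel; apply: ddir_near_eq; have := metric_germ1 mg; apply: filter_app.
by near=> z => m; rewrite christoffel_formC.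
Unshelve. all: by end_near. Qed.

Lemma riem_alt12 a b c d : riem a b c d = - riem b a c d.
Proof. by rewrite /riem -innerNl; congr inner; rewrite /curvature opprB. Qed.

Lemma riemD1 a a' b c d : riem (a + a') b c d = riem a b c d + riem a' b c d.
Proof.
rewrite /riem -innerDl; congr inner; rewrite !curvatureE dchristoffelDl dchristoffelDm !christoffel_formDl christoffel_formDr.
by apply/rowP => k; rewrite !mxE; ring.
Qed.
Lemma riemZ1 k a b c d : riem (k *: a) b c d = k * riem a b c d.
Proof.
rewrite /riem -innerZl; congr inner; rewrite !curvatureE dchristoffelZl dchristoffelZm !christoffel_formZl christoffel_formZr.
by rewrite -!scalerDr -scalerBr.
Qed.
Lemma riemD2 a b b' c d : riem a (b + b') c d = riem a b c d + riem a b' c d.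
Proof. by rewrite riem_alt12 riemD1 opprD -!riem_alt12. Qed.
Lemma riemZ2 k a b c d : riem a (k *: b) c d = k * riem a b c d.
Proof. by rewrite riem_alt12 riemZ1 -mulrN -riem_alt12. Qed.
Lemma riemD3 a b c c' d : riem a b (c + c') d = riem a b c d + riem a b c' d.
Proof.
rewrite /riem -innerDl; congr inner; rewrite !curvatureE !dchristoffelDr !christoffel_formDr.
by apply/rowP => k; rewrite !mxE; ring.
Qed.
Lemma riemZ3 k a b c d : riem a b (k *: c) d = k * riem a b c d.
Proof.
rewrite /riem -innerZl; congr inner; rewrite !curvatureE !dchristoffelZr !christoffel_formZr.
by rewrite -!scalerDr -scalerBr.
Qed.
Lemma riemD4 a b c d d' : riem a b c (d + d') = riem a b c d + riem a b c d'.
Proof. exact: innerDr. Qed.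
Lemma riemZ4 k a b c d : riem a b c (k *: d) = k * riem a b c d.
Proof. exact: innerZr. Qed.

Lemma riem_bianchi a b c d : riem a b c d + riem b c a d + riem c a b d = 0.
Proof.
rewrite /riem -!innerDl (_ : _ + _ = 0) ?inner0l // !curvatureE.
have m := metric_germ_at mg.
rewrite (dchristoffelC b c a) (dchristoffelC c a b) (dchristoffelC a c b).
rewrite (christoffel_formC a c m) (christoffel_formC a b m) (christoffel_formC b c m).
by apply/rowP => k; rewrite !mxE; ring.
Qed.

(** The second derivatives of the function z |-> g_z(c, d) are symmetric; metric
    compatibility, used twice, turns this into skew symmetry of the curvature
    operator. *)
Lemma riem_alt34 a b c d : riem a b c d = - riem a b d c.
Proof.
apply/eqP; rewrite -addr_eq0; apply/eqP.
have m := metric_germ_at mg; have [d1 d2] := mg_dn mg.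
have ddn u : differentiable (ddir G u) x by exact: diffn_diff (d2 u : diffn 1 _ _).
have K u v : ddir (ddir (fun z => inner (G z) c d) v) u x = inner (ddir (ddir G v) u x) c d.
  rewrite (_ : ddir _ u x = ddir (fun z => inner (ddir G v z) c d) u x).
    by rewrite ddir_inner // !ddir_cst inner0l inner0r add0r addr0.
  apply: ddir_near_eq; near=> z.
  by rewrite ddir_inner ?ddir_cst ?inner0l ?inner0r ?add0r ?addr0 //; near: z.
have chrd u w : differentiable (fun z => christoffel_form G z u w) x.
  exact: (diffn_diff (christoffel_form_diffn u w mg)).
have mid : metric_germ G (id x) by [].
have E u v : ddir (ddir (fun z => inner (G z) c d) v) u x =
   inner (G x) (dchristoffel G x u v c + christoffel_form G x u (christoffel_form G x v c)) d
 + inner (G x) (christoffel_form G x v c) (christoffel_form G x u d)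
 + (inner (G x) (christoffel_form G x u c) (christoffel_form G x v d)
 + inner (G x) c (dchristoffel G x u v d + christoffel_form G x u (christoffel_form G x v d))).
  have -> : ddir (ddir (fun z => inner (G z) c d) v) u x =
    ddir (fun z => inner (G (id z)) (christoffel_form G z v c) (cst d z)
       + inner (G (id z)) (cst c z) (christoffel_form G z v d)) u x.
    apply: ddir_near_eq; have := metric_germ1 mg; apply: filter_app; near=> z => mz.
    have := @nabla_compat p p G id v (cst c) (cst d) z mz (diff_id z).
    by rewrite /nabla !ddir_cst !ddir_id !add0r; apply.
  rewrite ddirD; last 2 first.
  - by apply: diff_inner => //; exact: m1_diff m.
  - by apply: diff_inner => //; exact: m1_diff m.
  rewrite !(@nabla_compat p p G id) //; try exact: diff_id.
  by rewrite /nabla !ddir_cst !ddir_id !add0r.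
have := E a b; rewrite K (young_mx a b (mg_dn mg)) -K (E b a).
rewrite /riem !curvatureE !innerBl !innerDl !innerDr.
have sG := metric_germ_sym mg.
rewrite (innerC (dchristoffel G x a b d) c sG) (innerC (dchristoffel G x b a d) c sG).
rewrite (innerC (christoffel_form G x a (christoffel_form G x b d)) c sG).
rewrite (innerC (christoffel_form G x b (christoffel_form G x a d)) c sG).
set t1 := inner _ (dchristoffel _ _ a _ _) d; set t2 := inner _ (dchristoffel _ _ b _ _) d.
set t3 := inner _ c (dchristoffel _ _ a _ _); set t4 := inner _ c (dchristoffel _ _ b _ _).
set q1 := inner _ (christoffel_form G x a (christoffel_form G x b c)) d.
set q2 := inner _ (christoffel_form G x b (christoffel_form G x a c)) d.
set q3 := inner _ c (christoffel_form G x a (christoffel_form G x b d)).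
set q4 := inner _ c (christoffel_form G x b (christoffel_form G x a d)).
set s1 := inner _ (christoffel_form G x b c) (christoffel_form G x a d).
set s2 := inner _ (christoffel_form G x a c) (christoffel_form G x b d).
move=> H; have {}H : t1 + q1 + s1 + (s2 + (t3 + q3)) - (t2 + q2 + s2 + (s1 + (t4 + q4))) = 0.
  by rewrite -H subrr.
by rewrite -[RHS]H; ring.
Unshelve. all: by end_near. Qed.

End Tensor.
End Curvature.

(** * The Gauss equation *)

Section Gauss.
Context {R : realType} {n p : nat}.
Variables (g : 'rV[R]_n -> 'M[R]_n) (G : 'rV[R]_p -> 'M[R]_p) (P : 'rV[R]_n -> 'rV[R]_p).
Variable y : 'rV[R]_n.
Hypothesis mg : metric_germ g y.
Hypothesis mG : metric_germ G (P y).
Hypothesis dP : \forall z \near y, diffn 3 P z.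
Hypothesis iso : \forall z \near y, forall u v,
  inner (g z) u v = inner (G (P z)) (ddir P u z) (ddir P v z).

Let mG1 : \forall z \near y, metric1 G (P z).
Proof.
have cP := differentiable_continuous (diffn_diff (nbhs_singleton dP)).
exact: (cP _ (metric_germ1 mG)).
Qed.

(** Both sides satisfy the Koszul formula of g: the right-hand one because the
    ambient connection is compatible with G and torsion free. *)
Lemma tangential_connection : \forall z \near y, forall v w x,
  inner (g z) (christoffel_form g z v w) x =
  inner (G (P z)) (nabla G P v (ddir P w) z) (ddir P x z).
Proof.
have niso := near_join iso; near=> z => v w x.
have mz : metric1 g z by near: z; exact: metric_germ1.
have mPz : metric1 G (P z) by near: z.
have isoz : \forall t \near z, forall u v,
  inner (g t) u v = inner (G (P t)) (ddir P u t) (ddir P v t) by near: z.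
have dPz : diffn 3 P z by near: z.
have dP2 u : diffn 2 (ddir P u) z by exact: diffn_ddir dPz.
have dg a b c : inner (ddir g a z) b c =
   inner (G (P z)) (nabla G P a (ddir P b) z) (ddir P c z) +
   inner (G (P z)) (ddir P b z) (nabla G P a (ddir P c) z).
  rewrite -nabla_compat //; [|exact: diffn_diff dPz|exact: diffn_diff (dP2 _)..].
  rewrite -(@ddir_near_eq _ _ _ (fun t => inner (g t) b c)).
    by rewrite ddir_inner ?ddir_cst ?inner0l ?inner0r ?add0r ?addr0 //; exact: m1_diff mz.
  by move: isoz; apply: filter_app; near=> t => ->.
rewrite (koszul _ _ _ mz) /koszul_form !dg.
have sG := nbhs_singleton (m1_sym mPz).
rewrite (nabla_symm w v mPz (diffnS dPz)) (nabla_symm x v mPz (diffnS dPz)) (nabla_symm x w mPz (diffnS dPz)).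
rewrite (innerC (ddir P w z) _ sG) (innerC (ddir P v z) _ sG).
set t1 := inner _ (nabla _ _ _ _ _) (ddir P x z).
set t2 := inner _ (nabla _ _ _ _ _) (ddir P w z).
set t3 := inner _ (nabla _ _ _ _ _) (ddir P v z).
by field.
Unshelve. all: by end_near. Qed.

Lemma second_ffE u v : second_ff g G P y u v =
  nabla G P u (ddir P v) y - ddir P (christoffel_form g y u v) y.
Proof.
have dPy := diffn_diff (nbhs_singleton dP).
have e1 : 'D_u (fun z => 'D_v P z) y = ddir (ddir P v) u y.
  by rewrite ddirE; congr ('D_u _ y); apply/funext => z; rewrite ddirE.
have e2 w : w *m 'J P y = ddir P w y by rewrite -(deriveEjacobian w dPy) ddirE.
by rewrite /second_ff cov_cst e1 e2 -(ddirE P u y) -(ddirE P v y).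
Qed.

Local Notation h := (second_ff g G P y).

Lemma second_ff_normal u v x : inner (G (P y)) (h u v) (ddir P x y) = 0.
Proof.
rewrite second_ffE innerBl -(nbhs_singleton iso) (nbhs_singleton tangential_connection).
exact: subrr.
Qed.

Lemma second_ffC u v : h u v = h v u.
Proof.
rewrite !second_ffE (christoffel_formC _ _ (metric_germ_at mg)) nabla_symm //.
  exact: metric_germ_at.
exact: diffnS (nbhs_singleton dP).
Qed.

Lemma second_ffDl u u' v : h (u + u') v = h u v + h u' v.
Proof.
have dPy := nbhs_singleton dP.
have d1 w : differentiable (ddir P w) y by exact: diffn_diff (diffn_ddir w dPy).
rewrite !second_ffE /nabla ddir_linD // ddir_linD; last exact: diffn_diff dPy.
rewrite !christoffel_formDl ddir_linD; last exact: diffn_diff dPy.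
by rewrite opprD !addrA; apply/rowP => k; rewrite !mxE; ring.
Qed.

Lemma second_ffZl a u v : h (a *: u) v = a *: h u v.
Proof.
have dPy := nbhs_singleton dP.
have d1 w : differentiable (ddir P w) y by exact: diffn_diff (diffn_ddir w dPy).
rewrite !second_ffE /nabla ddir_linZ // ddir_linZ; last exact: diffn_diff dPy.
rewrite !christoffel_formZl ddir_linZ; last exact: diffn_diff dPy.
by rewrite -!scalerDr -scalerBr.
Qed.

Lemma second_ffDr u v v' : h u (v + v') = h u v + h u v'.
Proof. by rewrite second_ffC second_ffDl !(second_ffC u). Qed.

Lemma second_ffZr a u v : h u (a *: v) = a *: h u v.
Proof. by rewrite second_ffC second_ffZl (second_ffC u). Qed.

(** Differentiate g(D_v w, x) = G(D_v P_w, P_x) in direction u, by compatibility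
    on either side.  The products of first covariant derivatives split into a
    tangential part, which appears on both sides, and the second fundamental
    form; the iterated derivatives are exchanged by the Ricci identity. *)
Theorem gauss_equation u v w x :
  riem g y u v w x =
  riem G (P y) (ddir P u y) (ddir P v y) (ddir P w y) (ddir P x y)
  + inner (G (P y)) (h v w) (h u x) - inner (G (P y)) (h u w) (h v x).
Proof.
have dPy := nbhs_singleton dP.
have m := metric_germ_at mg; have mG' := metric_germ_at mG.
have dPy1 : differentiable P y by exact: diffn_diff dPy.
have dPv2 w' : diffn 2 (ddir P w') y by exact: diffn_ddir dPy.
have dPv w' : differentiable (ddir P w') y by exact: diffn_diff (dPv2 w').
have dnP a b : differentiable (nabla G P a (ddir P b)) y.
  by apply: nabla_diff => //; exact: diffnS.
have chrd a b : differentiable (fun z => christoffel_form g z a b) y.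
  exact: (diffn_diff (christoffel_form_diffn a b mg)).
have E a b c d :
   inner (g y) (dchristoffel g y a b c + christoffel_form g y a (christoffel_form g y b c)) d
   + inner (g y) (christoffel_form g y b c) (christoffel_form g y a d)
   = inner (G (P y)) (nabla G P a (nabla G P b (ddir P c)) y) (ddir P d y)
   + inner (G (P y)) (nabla G P b (ddir P c) y) (nabla G P a (ddir P d) y).
  rewrite -(nabla_compat _ mG') //.
  rewrite -(@ddir_near_eq _ _ _ (fun z => inner (g (id z)) (christoffel_form g z b c) (cst d z))).
    have mid : metric1 g (id y) by [].
    rewrite (@nabla_compat _ _ _ g id a _ _ y mid) //.
    by rewrite /nabla !ddir_cst !ddir_id !add0r.
  by move: tangential_connection; apply: filter_app; near=> z => ->.
have split_nabla a b : nabla G P a (ddir P b) y = h a b + ddir P (christoffel_form g y a b) y.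
  by rewrite second_ffE subrK.
have dot a b c d : inner (G (P y)) (nabla G P a (ddir P b) y) (nabla G P c (ddir P d) y) =
   inner (G (P y)) (h a b) (h c d)
   + inner (g y) (christoffel_form g y a b) (christoffel_form g y c d).
  rewrite !split_nabla innerDl 2!(innerDr _ (h c d)) second_ff_normal.
  rewrite (innerC (ddir P _ y) (h c d)); last exact: metric_germ_sym.
  by rewrite second_ff_normal add0r addr0 -(nbhs_singleton iso).
have := ricci_identity u v mG (diffnS dPy) (dPv2 w) => RI.
rewrite {2}/riem -RI innerBl.
have e1 := E u v w x; have e2 := E v u w x.
rewrite !dot in e1 e2.
rewrite /riem curvatureE innerBl.
move: e1 e2.
set q1 := inner (g y) (dchristoffel g y u v w + _) x; set q2 := inner (g y) (dchristoffel g y v u w + _) x.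
set r1 := inner _ (nabla G P u _ y) _; set r2 := inner _ (nabla G P v _ y) _.
set s1 := inner (g y) _ _; set s2 := inner (g y) _ _.
set h1 := inner _ (h v w) _; set h2 := inner _ (h u w) _.
move=> e1 e2.
have -> : q1 = r1 + h1 by apply: (addIr s1); rewrite e1 addrA.
have -> : q2 = r2 + h2 by apply: (addIr s2); rewrite e2 addrA.
ring.
Unshelve. all: by end_near. Qed.

End Gauss.

(** * Curvature of complex space forms *)

Section KaehlerAlgebra.
Context {R : realType} {V : zmodType}.
Variables (K : V -> V -> V -> V -> R) (J : V -> V).
Hypothesis KD1 : forall a a' b c d, K (a + a') b c d = K a b c d + K a' b c d.
Hypothesis K12 : forall a b c d, K a b c d = - K b a c d.
Hypothesis K34 : forall a b c d, K a b c d = - K a b d c.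
Hypothesis KB : forall a b c d, K a b c d + K b c a d + K c a b d = 0.

(** The four Bianchi identities of the cyclic permutations of a, b, c, d
    (the octahedron argument). *)
Lemma curv_pair a b c d : K a b c d = K c d a b.
Proof.
have := KB a b c d; have := KB b c d a; have := KB c d a b; have := KB d a b c.
have := K34 a b c d; have := K34 b c a d; have := K34 c d a b; have := K34 d a b c.
have := K12 c a b d; have := K34 a c b d; have := K12 d b c a; have := K34 b d c a.
lra.
Qed.

Hypothesis J2 : forall a, J (J a) = - a.
Hypothesis JD : forall a b, J (a + b) = J a + J b.
Hypothesis KJ : forall a b c d, K a b (J c) (J d) = K a b c d.

Lemma curvD2 a b b' c d : K a (b + b') c d = K a b c d + K a b' c d.
Proof. by rewrite K12 KD1 opprD -!K12. Qed.
Lemma curvD3 a b c c' d : K a b (c + c') d = K a b c d + K a b c' d.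
Proof. by rewrite curv_pair KD1 -!(curv_pair _ _ a b). Qed.
Lemma curvD4 a b c d d' : K a b c (d + d') = K a b c d + K a b c d'.
Proof. by rewrite K34 curvD3 opprD -!K34. Qed.
Lemma curvN1 a b c d : K (- a) b c d = - K a b c d.
Proof.
have K0 : K 0 b c d = 0 by apply: (addrI (K 0 b c d)); rewrite -KD1 !addr0.
by apply/eqP; rewrite -addr_eq0 -KD1 addNr K0.
Qed.
Lemma curvN2 a b c d : K a (- b) c d = - K a b c d.
Proof. by rewrite K12 curvN1 -K12. Qed.
Lemma curvN3 a b c d : K a b (- c) d = - K a b c d.
Proof. by rewrite curv_pair curvN1 curv_pair. Qed.
Lemma curvN4 a b c d : K a b c (- d) = - K a b c d.
Proof. by rewrite K34 curvN3 -K34. Qed.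
Lemma curvJ12 a b c d : K (J a) (J b) c d = K a b c d.
Proof. by rewrite curv_pair KJ curv_pair. Qed.

Let Q a := K a (J a) (J a) a.

(** The part of Q (a + b) of bidegree (2, 2) has six terms.  By J-invariance and
    the Bianchi identity, four of them are K(a,Jb,Jb,a), and the other two are
    K(a,b,b,a) + K(a,Jb,Jb,a). *)
Lemma cross_terms a b : Q (a + b) + Q (a - b) =
  (Q a + Q b + K a b b a *+ 2 + K a (J b) (J b) a *+ 6) *+ 2.
Proof.
have JN c : J (- c) = - J c.
  have J0 : J 0 = 0 by apply: (addrI (J 0)); rewrite -JD !addr0.
  by apply/eqP; rewrite -addr_eq0 -JD addNr J0.
rewrite /Q !JD !JN !(KD1, curvD2, curvD3, curvD4, curvN1, curvN2, curvN3, curvN4).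
have e1 : K a (J b) (J a) b = K a (J b) (J b) a.
  by rewrite -KJ J2 curvN3 -K34.
have e2 : K b (J a) (J b) a = K a (J b) (J b) a.
  by rewrite curv_pair K12 K34 opprK e1.
have e3 : K b (J a) (J a) b = K a (J b) (J b) a.
  by rewrite -curvJ12 J2 curvN2 -K12 -KJ J2 curvN3 -K34 curv_pair K12 K34 opprK curv_pair -KJ J2 curvN4 -K34.
have e4 : K a (J a) (J b) b = K a b b a + K a (J b) (J b) a.
  have := KB a (J a) (J b) b.
  have -> : K (J a) (J b) a b = - K a b b a by rewrite curvJ12 K34.
  by rewrite (K12 (J b) a (J a) b) e1; lra.
have e5 : K b (J b) (J a) a = K a b b a + K a (J b) (J b) a.
  by rewrite -e4 curv_pair K12 K34 opprK.
rewrite e1 e2 e3 e4 e5.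
lra.
Qed.

(** [cross_terms] for (a, b) and for (a, J b) are two linear equations in
    K(a,b,b,a) and K(a,Jb,Jb,a); eliminate the latter. *)
Lemma sect_polarization a b :
  K a b b a *+ 32 = Q (a + J b) *+ 3 + Q (a - J b) *+ 3 - Q (a + b) - Q (a - b)
     - Q a *+ 4 - Q b *+ 4.
Proof.
have h1 := cross_terms a b; have h2 := cross_terms a (J b).
have QJ : Q (J b) = Q b by rewrite /Q J2 curvN2 curvN3 opprK K12 K34 opprK.
rewrite QJ J2 curvN2 curvN3 opprK in h2.
lra.
Qed.

End KaehlerAlgebra.

Section SpaceForm.
Context {R : realType} {p : nat}.
Variables (G J : 'rV[R]_p -> 'M[R]_p) (x : 'rV[R]_p) (c : R).
Hypothesis mG : metric_germ G x.
Hypothesis dJ : diffn 2 J x.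
Hypothesis J2 : J x *m J x = - 1%:M.
Hypothesis herm : forall u v, inner (G x) (u *m J x) (v *m J x) = inner (G x) u v.
Hypothesis par : \forall z \near x, forall u v,
  cov G u (fun t => v *m J t) z = cov G u (cst v) z *m J z.

(** A parallel J commutes with covariant differentiation, hence with curvature:
    apply the Ricci identity to the field z |-> w J_z. *)
Lemma curvature_J a b w : curvature G x a b (w *m J x) = curvature G x a b w *m J x.
Proof.
have dW (v : 'rV[R]_p) : diffn 2 (fun z => v *m J z) x by apply: diffn_mulmx => //; exact: diffn_cst.
have nabW u v z : cov G u (fun t => v *m J t) z = nabla G id u (fun t => v *m J t) z.
  exact: covE.
have chrd u v : differentiable (fun z => christoffel_form G z u v) x.
  exact: (diffn_diff (christoffel_form_diffn u v mG)).
have E u v : nabla G id u (nabla G id v (fun t => w *m J t)) x =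
   (dchristoffel G x u v w + christoffel_form G x u (christoffel_form G x v w)) *m J x.
  have e1 : nabla G id u (nabla G id v (fun t => w *m J t)) x =
            nabla G id u (fun t => christoffel_form G t v w *m J t) x.
    have N : \forall z \near x, nabla G id v (fun t => w *m J t) z =
                               christoffel_form G z v w *m J z.
      by move: par; apply: filter_app; near=> z => pz; rewrite -nabW pz cov_cst.
    by rewrite {1}/nabla (ddir_near_eq _ N) (nbhs_singleton N).
  rewrite e1 /nabla ddir_mulmx //; last exact: diffn_diff dJ.
  have := nbhs_singleton par u (christoffel_form G x v w).
  rewrite nabW /nabla cov_cst ddir_mulmx //; last exact: diffn_diff dJ.
  rewrite ddir_cst mul0mx add0r => e.
  by rewrite -addrA e mulmxDl.
have := @ricci_identity _ _ _ G id _ a b x mG (diffn_id _ _) (dW w).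
by rewrite !ddir_id => <-; rewrite !E curvatureE mulmxBl.
Unshelve. all: by end_near. Qed.

Lemma inner_J_skew u v : inner (G x) u (v *m J x) = - inner (G x) (u *m J x) v.
Proof. by rewrite -herm -mulmxA J2 mulmxN mulmx1 innerNr. Qed.

Lemma inner_J_self u : inner (G x) u (u *m J x) = 0.
Proof.
have := inner_J_skew u u; rewrite (innerC _ u (metric_germ_sym mG)) => e.
lra.
Qed.

Hypothesis hol : forall u, u != 0 -> sect G x u (u *m J x) = c.

(** Constant holomorphic curvature means Q u = c |u|^4, and polarization does the
    rest. *)
Theorem space_form_sect a b : riem G x a b b a =
  c / 4 * (inner (G x) a a * inner (G x) b b - inner (G x) a b ^+ 2
           + 3 * inner (G x) a (b *m J x) ^+ 2).
Proof.
pose q u := inner (G x) u u.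
have Q u : riem G x u (u *m J x) (u *m J x) u = c * q u ^+ 2.
  have [->|u0] := eqVneq u 0; first by rewrite /riem /q !inner0r expr0n mulr0.
  have qu : 0 < q u by exact: (nbhs_singleton (mg_pos mG)).
  rewrite -(hol u0) /sect herm inner_J_self -/(q u) -/(riem G x u _ _ u).
  by field; rewrite gt_eqF.
have KJ a0 b0 c0 d0 : riem G x a0 b0 (c0 *m J x) (d0 *m J x) = riem G x a0 b0 c0 d0.
  by rewrite /riem curvature_J herm.
have JJ (a0 : 'rV[R]_p) : a0 *m J x *m J x = - a0 by rewrite -mulmxA J2 mulmxN mulmx1.
have JD (a0 b0 : 'rV[R]_p) : (a0 + b0) *m J x = a0 *m J x + b0 *m J x by exact: mulmxDl.
have := sect_polarization (riemD1 mG) (@riem_alt12 _ _ _ _) (riem_alt34 mG) (riem_bianchi mG) (J := fun v => v *m J x) JJ JD KJ a b.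
rewrite !Q /q !(innerDl, innerDr, innerNl, innerNr).
rewrite herm (innerC (b *m J x) a (metric_germ_sym mG)) (innerC b a (metric_germ_sym mG)).
set A := inner _ a a; set B := inner _ b b; set C := inner _ a b; set D := inner _ a (b *m _).
move=> H; apply: (@mulIf _ 32%:R); first by rewrite pnatr_eq0.
by rewrite mulr_natr H; field.
Qed.

End SpaceForm.

Section Trace.
Context {R : realType} {n : nat}.

(** If the rows of B are orthonormal for g, that is B g B^T = 1, then also
    g B^T B = 1, and the trace of M = M g B^T B is that of B M g B^T. *)
Lemma mxtrace_orthonormal (g M : 'M[R]_n) (b : 'I_n -> 'rV[R]_n) :
  (forall i j, inner g (b i) (b j) = (i == j)%:R) ->
  \tr M = \sum_k inner g (b k *m M) (b k).
Proof.
move=> ob; pose B := \matrix_k b k.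
have e : B *m g *m B^T = 1%:M.
  apply/matrixP => i j; rewrite !mxE -ob innerE.
  rewrite -(rowK b i) -(rowK b j) -/B -row_mul tr_row -row_mul.
  rewrite [in RHS]mxE [in RHS]mxE /=; apply: eq_bigr => k _.
  by rewrite !mxE.
have e' : g *m B^T *m B = 1%:M by rewrite -mulmxA in e; exact: (mulmx1C e).
rewrite -[M in LHS]mulmx1 -e' !mulmxA mxtrace_mulC !mulmxA.
apply: eq_bigr => k _; rewrite innerE -(rowK b k) -/B -!row_mul tr_row.
rewrite !mxE; apply: eq_bigr => l _.
by rewrite !mxE.
Qed.

End Trace.

(** * Curvature of warped products *)

Section KoszulCurvature.
Context {R : realType} {n : nat}.
Variables (g : 'rV[R]_n -> 'M[R]_n) (y : 'rV[R]_n).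
Hypothesis mg : metric_germ g y.

(** The formula for the lowered curvature in which only first kind symbols are
    differentiated. *)
Lemma riem_koszul u v w x : riem g y u v w x =
  ddir (fun z => koszul_form g z v w x) u y - ddir (fun z => koszul_form g z u w x) v y
  - inner (g y) (christoffel_form g y v w) (christoffel_form g y u x)
  + inner (g y) (christoffel_form g y u w) (christoffel_form g y v x).
Proof.
have chrd a b : differentiable (fun z => christoffel_form g z a b) y.
  exact: (diffn_diff (christoffel_form_diffn a b mg)).
have E a b : ddir (fun z => koszul_form g z b w x) a y =
   inner (g y) (dchristoffel g y a b w + christoffel_form g y a (christoffel_form g y b w)) x
 + inner (g y) (christoffel_form g y b w) (christoffel_form g y a x).
  have -> : ddir (fun z => koszul_form g z b w x) a y =
    ddir (fun z => inner (g (id z)) (christoffel_form g z b w) (cst x z)) a y.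
    apply: ddir_near_eq; have := metric_germ1 mg; apply: filter_app; near=> z => mz.
    by rewrite koszul.
  rewrite (@nabla_compat _ _ _ g id a _ _ y (metric_germ_at mg)) //.
  by rewrite /nabla !ddir_cst !ddir_id !add0r.
rewrite !E /riem curvatureE innerBl; ring.
Unshelve. all: by end_near. Qed.

End KoszulCurvature.

Section Hessian.
Context {R : realType} {n : nat}.
Variables (g : 'rV[R]_n -> 'M[R]_n) (F : 'rV[R]_n -> R) (y : 'rV[R]_n).
Hypothesis mg : metric_germ g y.
Hypothesis dF : diffn 2 F y.

Definition hess u v : R := ddir (ddir F v) u y - ddir F (christoffel_form g y u v) y.

Lemma gradE z w : metric1 g z -> differentiable F z ->
  inner (g z) (grad g F z) w = ddir F w z.
Proof.
move=> mz dFz; rewrite innerE /grad mulmxKV; last exact: m1_unit mz.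
rewrite mxE ddir_basis //; apply: eq_bigr => j _.
by rewrite !mxE ddirE mulrC.
Qed.

Lemma grad_diff : differentiable (grad g F) y.
Proof.
apply: diff_mulmx.
  apply: diff_mx => i j.
  have dj : differentiable (ddir F (basis_vec j)) y by exact: diffn_diff (diffn_ddir _ dF).
  apply: differentiable_near_eq dj.
  by near=> z; rewrite mxE ddirE.
apply: (@diffn_diff _ 1); apply: diffn_invmx; last exact: mg_dn.
have := metric_germ1 mg; apply: filter_app; near=> z; exact: m1_unit.
Unshelve. all: by end_near. Qed.

Lemma hess_grad u w : inner (g y) (nabla g id u (grad g F) y) w = hess u w.
Proof.
have mid : metric1 g (id y) by exact: metric_germ_at.
have := @nabla_compat _ _ _ g id u (grad g F) (cst w) y mid (diff_id _) grad_diff (differentiable_cst _ _).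
rewrite -(@ddir_near_eq _ _ _ (ddir F w)); last first.
  have [ndF _] := dF; have := metric_germ1 mg; apply: filter_app; near=> z => mz.
  by rewrite gradE //; near: z.
rewrite {2}/nabla ddir_cst ddir_id add0r => e.
rewrite (gradE _ (metric_germ_at mg) (diffn_diff dF)) in e.
by rewrite /hess e addrK.
Unshelve. all: by end_near. Qed.

(** The divergence of the gradient is the trace of w |-> D_w grad F, and
    g(D_w grad F, w) is the Hessian. *)
Lemma laplacian_trace (b : 'I_n -> 'rV[R]_n) :
  (forall i j, inner (g y) (b i) (b j) = (i == j)%:R) ->
  laplacian g F y = - \sum_i hess (b i) (b i).
Proof.
move=> ob; rewrite /laplacian /divergence; congr (- _).
pose M : 'M[R]_n := \matrix_i nabla g id (basis_vec i) (grad g F) y.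
have dG := grad_diff.
have ME u : u *m M = nabla g id u (grad g F) y.
  rewrite mulmx_sum_row /nabla (ddir_basis u dG) ddir_id.
  have -> : christoffel_form g y u (grad g F y) =
    \sum_(j < n) u 0 j *: christoffel_form g y (basis_vec j) (grad g F y).
    rewrite [u in LHS]row_sum_delta.
    elim/big_rec2: _ => [|i a b' _ <-].
      by have := christoffel_formZl g y 0 0 (grad g F y); rewrite !scale0r.
    by rewrite christoffel_formDl christoffel_formZl.
  rewrite -big_split; apply: eq_bigr => i _.
  by rewrite rowK /nabla ddir_id scalerDr.
transitivity (\tr M); first by apply: eq_bigr => i _; rewrite covE [RHS]mxE.
by rewrite (mxtrace_orthonormal _ ob); apply: eq_bigr => i _; rewrite ME hess_grad.
Qed.

End Hessian.

Section Warped.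
Context {R : realType} {n1 n2 : nat}.
Variables (gT : 'rV[R]_n1 -> 'M[R]_n1) (F : 'rV[R]_n1 -> R) (gP : 'rV[R]_n2 -> 'M[R]_n2).
Variable y : 'rV[R]_(n1 + n2).
Let y1 := lsubmx y.
Let y2 := rsubmx y.
Hypothesis mT : metric_germ gT y1.
Hypothesis mP : metric_germ gP y2.
Hypothesis dF : diffn 2 F y1.
Hypothesis posF : \forall z \near y1, 0 < F z.

(** The warped product metric, for arbitrary coordinate expressions of the two
    metrics and of the warping function. *)
Definition warped (z : 'rV[R]_(n1 + n2)) : 'M[R]_(n1 + n2) :=
  block_mx (gT (lsubmx z)) 0 0 (F (lsubmx z) ^+ 2 *: gP (rsubmx z)).

Lemma inner_warped z u v : inner (warped z) u v = inner (gT (lsubmx z)) (lsubmx u) (lsubmx v)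
  + F (lsubmx z) ^+ 2 * inner (gP (rsubmx z)) (rsubmx u) (rsubmx v).
Proof.
rewrite innerE -{1}(hsubmxK u) -{1}(hsubmxK v) /warped mul_row_block !mulmx0 addr0 add0r.
rewrite tr_row_mx mul_row_col mxE -scalemxAr -scalemxAl !innerE; congr (_ + _).
by rewrite mxE.
Qed.

Let cl : continuous (@lsubmx R 1 n1 n2).
Proof. exact: continuous_lsubmx. Qed.
Let cr : continuous (@rsubmx R 1 n1 n2).
Proof. exact: continuous_rsubmx. Qed.

Lemma near_l (Q : 'rV[R]_n1 -> Prop) :
  (\forall z \near y1, Q z) -> \forall z \near y, Q (lsubmx z).
Proof. exact: (cl (x := y)). Qed.
Lemma near_r (Q : 'rV[R]_n2 -> Prop) :
  (\forall z \near y2, Q z) -> \forall z \near y, Q (rsubmx z).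
Proof. exact: (cr (x := y)). Qed.

Lemma warped_germ : metric_germ warped y.
Proof.
split.
- have dT : diffn 2 (fun z => gT (lsubmx z)) y.
    exact: (diffn_comp_lin (L := @lsubmx R 1 n1 n2) cl (mg_dn mT)).
  have dP' : diffn 2 (fun z => gP (rsubmx z)) y.
    exact: (diffn_comp_lin (L := @rsubmx R 1 n1 n2) cr (mg_dn mP)).
  have dF' : diffn 2 (fun z => F (lsubmx z)) y.
    exact: (diffn_comp_lin (L := @lsubmx R 1 n1 n2) cl dF).
  apply/diffn_mxP => i j.
  case: (split_ordP i) => i' ->; case: (split_ordP j) => j' ->.
  + rewrite (_ : (fun z => _) = (fun z => gT (lsubmx z) i' j')).
      by move/diffn_mxP : dT.
    by apply/funext => z; rewrite block_mxEul.
  + rewrite (_ : (fun z => _) = cst 0); first exact: diffn_cst.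
    by apply/funext => z; rewrite block_mxEur mxE.
  + rewrite (_ : (fun z => _) = cst 0); first exact: diffn_cst.
    by apply/funext => z; rewrite block_mxEdl mxE.
  + rewrite (_ : (fun z => _) = (fun z => F (lsubmx z) * F (lsubmx z) * gP (rsubmx z) i' j')).
      by apply: diffnM; [exact: diffnM|move/diffn_mxP : dP'].
    by apply/funext => z; rewrite block_mxEdr mxE expr2.
- have := near_l (mg_sym mT); have := near_r (mg_sym mP).
  apply: filter_app2; near=> z => sP sT.
  by rewrite /warped tr_block_mx !trmx0 linearZ /= sP sT.
- have h1 := near_l (mg_pos mT); have h2 := near_r (mg_pos mP); have h3 := near_l posF.
  near=> z => u u0; rewrite inner_warped.
  have p1 : forall w, w != 0 -> 0 < inner (gT (lsubmx z)) w w by near: z.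
  have p2 : forall w, w != 0 -> 0 < inner (gP (rsubmx z)) w w by near: z.
  have p3 : 0 < F (lsubmx z) by near: z.
  have q1 w : 0 <= inner (gT (lsubmx z)) w w.
    by have [->|/p1/ltW//] := eqVneq w 0; rewrite inner0l.
  have q2 w : 0 <= inner (gP (rsubmx z)) w w.
    by have [->|/p2/ltW//] := eqVneq w 0; rewrite inner0l.
  have F2 : 0 < F (lsubmx z) ^+ 2 by rewrite exprn_gt0.
  have [e1|n1'] := eqVneq (lsubmx u) 0.
    have n2' : rsubmx u != 0.
      by apply: contra_neq u0 => e2; rewrite -(hsubmxK u) e1 e2 row_mx0.
    by rewrite ltr_wpDl // mulr_gt0 // p2.
  by rewrite ltr_pwDl ?p1 // mulr_ge0 // ltW.
Unshelve. all: by end_near. Qed.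

Lemma ddir_warped : \forall z \near y, forall a b c, inner (ddir warped a z) b c =
  inner (ddir gT (lsubmx a) (lsubmx z)) (lsubmx b) (lsubmx c)
  + 2 * F (lsubmx z) * ddir F (lsubmx a) (lsubmx z) * inner (gP (rsubmx z)) (rsubmx b) (rsubmx c)
  + F (lsubmx z) ^+ 2 * inner (ddir gP (rsubmx a) (rsubmx z)) (rsubmx b) (rsubmx c).
Proof.
have [ndF _] := dF.
have h1 := near_l (metric_germ1 mT); have h2 := near_r (metric_germ1 mP).
have h3 := near_l ndF; have h4 := metric_germ1 warped_germ.
near=> z => a b c.
have m1 : metric1 gT (lsubmx z) by near: z.
have m2 : metric1 gP (rsubmx z) by near: z.
have dFz : differentiable F (lsubmx z) by near: z.
have mw : metric1 warped z by near: z.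
have dl : differentiable (@lsubmx R 1 n1 n2) z by exact: differentiable_lsubmx.
have dr : differentiable (@rsubmx R 1 n1 n2) z by exact: differentiable_rsubmx.
have ddl v : ddir (@lsubmx R 1 n1 n2) v z = lsubmx v by exact: (ddir_lin (L := @lsubmx R 1 n1 n2)).
have ddr v : ddir (@rsubmx R 1 n1 n2) v z = rsubmx v by exact: (ddir_lin (L := @rsubmx R 1 n1 n2)).
have dFl : differentiable (fun t => F (lsubmx t)) z by exact: differentiable_comp dl dFz.
have dgT : differentiable (fun t => gT (lsubmx t)) z by exact: differentiable_comp dl (m1_diff m1).
have dgP : differentiable (fun t => gP (rsubmx t)) z by exact: differentiable_comp dr (m1_diff m2).
have cF : ddir (fun t => F (lsubmx t)) a z = ddir F (lsubmx a) (lsubmx z).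
  by rewrite (ddir_chain _ dl dFz) ddl.
have i1 : differentiable (fun t => inner (gT (lsubmx t)) (lsubmx b) (lsubmx c)) z.
  exact: diff_inner.
have i2 : differentiable (fun t => inner (gP (rsubmx t)) (rsubmx b) (rsubmx c)) z.
  exact: diff_inner.
have cT : ddir (fun t => inner (gT (lsubmx t)) (lsubmx b) (lsubmx c)) a z =
  inner (ddir gT (lsubmx a) (lsubmx z)) (lsubmx b) (lsubmx c).
  rewrite ddir_inner // !ddir_cst inner0l inner0r add0r addr0.
  by rewrite (ddir_chain _ dl (m1_diff m1)) ddl.
have cP : ddir (fun t => inner (gP (rsubmx t)) (rsubmx b) (rsubmx c)) a z =
  inner (ddir gP (rsubmx a) (rsubmx z)) (rsubmx b) (rsubmx c).
  rewrite ddir_inner // !ddir_cst inner0l inner0r add0r addr0.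
  by rewrite (ddir_chain _ dr (m1_diff m2)) ddr.
have -> : inner (ddir warped a z) b c = ddir (fun t => inner (warped t) b c) a z.
  by rewrite ddir_inner ?ddir_cst ?inner0l ?inner0r ?add0r ?addr0 //; exact: m1_diff mw.
rewrite (_ : (fun t => _) = (fun t => inner (gT (lsubmx t)) (lsubmx b) (lsubmx c) +
   F (lsubmx t) * F (lsubmx t) * inner (gP (rsubmx t)) (rsubmx b) (rsubmx c))); last first.
  by apply/funext => t; rewrite inner_warped expr2.
have dFF : differentiable (fun t => F (lsubmx t) * F (lsubmx t)) z by exact: differentiableM.
rewrite ddirD //; last exact: differentiableM.
by rewrite (ddirM _ dFF i2) (ddirM _ dFl dFl) cF cT cP; ring.
Unshelve. all: by end_near. Qed.

Variables u v : 'rV[R]_(n1 + n2).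
Hypothesis hu : rsubmx u = 0.
Hypothesis hv : lsubmx v = 0.

Let dd0 (W : normedModType R) (V : normedModType R) (f : V -> W) z : ddir f 0 z = 0.
Proof. by rewrite ddirE derive0. Qed.

Let dw := ddir_warped.

Let koszul_form_vv (z : 'rV[R]_(n1 + n2)) w : rsubmx w = 0 -> (forall a b c, inner (ddir warped a z) b c =
  inner (ddir gT (lsubmx a) (lsubmx z)) (lsubmx b) (lsubmx c)
  + 2 * F (lsubmx z) * ddir F (lsubmx a) (lsubmx z) * inner (gP (rsubmx z)) (rsubmx b) (rsubmx c)
  + F (lsubmx z) ^+ 2 * inner (ddir gP (rsubmx a) (rsubmx z)) (rsubmx b) (rsubmx c)) ->
  koszul_form warped z v v w = - (F (lsubmx z) * ddir F (lsubmx w) (lsubmx z) *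
      inner (gP (rsubmx z)) (rsubmx v) (rsubmx v)).
Proof.
move=> hw E; have in0 (k : nat) (a b : 'rV[R]_k) : inner 0 a b = 0 by rewrite innerE mulmx0 mul0mx mxE.
by rewrite /koszul_form !E hv hw !dd0 !in0 !inner0l !inner0r; field.
Qed.

(** For constant fields u along the first factor and v along the second, the
    Koszul formula yields D_u u tangent to the first factor, D_u v = (dF(u) / F) v
    and g(D_v v, w) = - F dF(w) gP(v, v) for w along the first factor.
    Inserted in [riem_koszul], the squares of dF(u) cancel and the Hessian
    of F remains. *)
Lemma warped_sect : riem warped y u v v u =
  - (F y1 * inner (gP y2) (rsubmx v) (rsubmx v) * hess gT F y1 (lsubmx u) (lsubmx u)).
Proof.
have Ey := nbhs_singleton dw; have mw := metric_germ_at warped_germ.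
have F0 : F y1 != 0 by rewrite gt_eqF //; exact: nbhs_singleton posF.
have mT' := metric_germ_at mT.
have in0 (k : nat) (a b : 'rV[R]_k) : inner 0 a b = 0 by rewrite innerE mulmx0 mul0mx mxE.
rewrite (riem_koszul warped_germ).
have uu : christoffel_form warped y u u = row_mx (christoffel_form gT y1 (lsubmx u) (lsubmx u)) 0.
  apply: (inner_inj (m1_unit mw)) => w.
  rewrite (koszul _ _ _ mw) inner_warped row_mxKl row_mxKr inner0l mulr0 addr0.
  rewrite (koszul _ _ _ mT') /koszul_form !Ey hu !dd0 !in0 !inner0l; ring.
have uv : christoffel_form warped y u v = (ddir F (lsubmx u) y1 / F y1) *: v.
  apply: (inner_inj (m1_unit mw)) => w.
  rewrite (koszul _ _ _ mw) innerZl inner_warped hv inner0l add0r.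
  rewrite /koszul_form !Ey hv hu !dd0 !in0 ?inner0l ?inner0r -/y1 -/y2; field.
  done.
have k1 : ddir (fun z => koszul_form warped z v v u) u y = - ((ddir F (lsubmx u) y1 ^+ 2
   + F y1 * ddir (ddir F (lsubmx u)) (lsubmx u) y1) * inner (gP y2) (rsubmx v) (rsubmx v)).
  rewrite (@ddir_near_eq _ _ _ _ (fun z => -1 *: (F (lsubmx z) * ddir F (lsubmx u) (lsubmx z) *
      inner (gP (rsubmx z)) (rsubmx v) (rsubmx v)))); last first.
    by move: dw; apply: filter_app; near=> z => E; rewrite koszul_form_vv // scaleN1r.
  have dl : differentiable (@lsubmx R 1 n1 n2) y by exact: differentiable_lsubmx.
  have dr : differentiable (@rsubmx R 1 n1 n2) y by exact: differentiable_rsubmx.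
  have ddl w : ddir (@lsubmx R 1 n1 n2) w y = lsubmx w by exact: (ddir_lin (L := @lsubmx R 1 n1 n2)).
  have ddr w : ddir (@rsubmx R 1 n1 n2) w y = rsubmx w by exact: (ddir_lin (L := @rsubmx R 1 n1 n2)).
  have dF1 : differentiable F (lsubmx y) by exact: diffn_diff dF.
  have dF2 : differentiable (ddir F (lsubmx u)) (lsubmx y) by exact: diffn_diff (diffn_ddir _ dF).
  have dFl : differentiable (fun t => F (lsubmx t)) y by exact: differentiable_comp dl dF1.
  have dFl2 : differentiable (fun t => ddir F (lsubmx u) (lsubmx t)) y by exact: differentiable_comp dl dF2.
  have dgP0 : differentiable gP (rsubmx y) by exact: diffn_diff (mg_dn mP).
  have dgP : differentiable (fun t => gP (rsubmx t)) y by exact: differentiable_comp dr dgP0.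
  have i2 : differentiable (fun t => inner (gP (rsubmx t)) (rsubmx v) (rsubmx v)) y.
    exact: diff_inner.
  have dFF : differentiable (fun t => F (lsubmx t) * ddir F (lsubmx u) (lsubmx t)) y.
    exact: differentiableM.
  rewrite ddirZ; last exact: differentiableM.
  rewrite (ddirM _ dFF i2) (ddirM _ dFl dFl2) (ddir_chain _ dl dF1) (ddir_chain _ dl dF2) ddl.
  rewrite ddir_inner // !ddir_cst inner0l inner0r add0r addr0 (ddir_chain _ dr dgP0) ddr hu dd0 in0.
  rewrite mulr0 addr0 scaleN1r -/y1 -/y2; congr (- _); ring.
have k2 : ddir (fun z => koszul_form warped z u v u) v y = 0.
  rewrite -(ddir_cst (0 : R) v y); apply: ddir_near_eq.
  move: dw; apply: filter_app; near=> z => E.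
  rewrite /koszul_form !E hv hu !dd0 !in0 ?inner0l ?inner0r; rewrite /cst; ring.
rewrite k1 k2 (koszul _ _ _ mw) uu koszul_form_vv ?row_mxKr //.
rewrite (christoffel_formC v u mw) uv innerZl innerZr inner_warped hv inner0l add0r row_mxKl -/y1 -/y2.
by rewrite /hess; field.
Unshelve. all: by end_near. Qed.

End Warped.

(** * Orthonormal bases of tangent subspaces *)

Section Orthonormal.
Context {R : realType} {n : nat}.
Variables (g : 'rV[R]_n -> 'M[R]_n) (y : 'rV[R]_n).
Hypothesis gS : (g y)^T = g y.
Hypothesis gpos : forall u, u != 0 -> 0 < inner (g y) u u.
Local Notation "<< u , v >>" := (inner (g y) u v).
Implicit Types (V W : {vspace 'rV[R]_n}) (e s : seq 'rV[R]_n) (u v w : 'rV[R]_n).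

Definition orthonormal_family e := forall i j, (i < size e)%N -> (j < size e)%N ->
  << e`_i, e`_j >> = (i == j)%:R.

Lemma orthonormal_family_coord e (c : 'I_(size e) -> R) (j : 'I_(size e)) : orthonormal_family e ->
  << \sum_i c i *: e`_i, e`_j >> = c j.
Proof.
move=> oe; rewrite inner_suml (bigD1 j) //= innerZl oe // eqxx mulr1 big1 ?addr0 //.
by move=> i nij; rewrite innerZl oe // (inj_eq val_inj) (negbTE nij) mulr0.
Qed.

Lemma orthonormal_family_free e : orthonormal_family e -> free e.
Proof.
move=> oe; rewrite -[e]in_tupleE; apply/freeP => c.
by move=> H i; rewrite -(orthonormal_family_coord c i oe) H inner0l.
Qed.

Lemma onb_expand V e v : orthonormal_basis g y V e -> v \in V ->
  v = \sum_(i < size e) << v, e`_i >> *: e`_i.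
Proof.
move=> [be oe] vV; have sp : v \in <<in_tuple e>>%VS.
  by rewrite in_tupleE (span_basis be).
have E := coord_span sp.
rewrite [LHS]E; apply: eq_bigr => i _; congr (_ *: _).
by rewrite [in RHS]E /= (orthonormal_family_coord (fun i => coord (in_tuple e) i v)).
Qed.

Lemma onb_parseval V e v w : orthonormal_basis g y V e -> v \in V ->
  << v, w >> = \sum_(i < size e) << v, e`_i >> * << w, e`_i >>.
Proof.
move=> oe vV; rewrite {1}(onb_expand oe vV) inner_suml; apply: eq_bigr => i _.
by rewrite innerZl (innerC _ w gS).
Qed.

(** One step of the Gram-Schmidt process. *)
Lemma extend_orthonormal V s : orthonormal_family s -> (forall u, u \in s -> u \in V) ->
  (size s < \dim V)%N -> exists v, [/\ v \in V, << v, v >> = 1 &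
    forall i, (i < size s)%N -> << s`_i, v >> = 0].
Proof.
move=> os sV sz.
have /subvPn[w wV wns] : ~~ (V <= <<s>>)%VS.
  by apply: contraL sz => /dimvS h; rewrite -leqNgt (leq_trans h) // dim_span.
pose t := \sum_(i < size s) << w, s`_i >> *: s`_i.
have tS : t \in <<s>>%VS.
  by apply: memv_suml => i _; apply/memvZ/memv_span/mem_nth.
have tV : t \in V.
  by apply: memv_suml => i _; apply/memvZ/sV/mem_nth.
have wt0 : w - t != 0 by apply: contraNneq wns => /eqP; rewrite subr_eq0 => /eqP ->.
have q0 := gpos wt0; set q := << w - t, w - t >> in q0.
exists ((Num.sqrt q)^-1 *: (w - t)); split.
- by apply/memvZ/memvB.
- rewrite innerZl innerZr -/q mulrA -invfM -expr2 sqr_sqrtr ?ltW // mulVf //.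
  by rewrite gt_eqF.
- move=> i isz; rewrite innerZr innerBr.
  have := orthonormal_family_coord (fun i => << w, s`_i >>) (Ordinal isz) os => /= e1.
  by rewrite (innerC _ t gS) e1 (innerC _ w gS) subrr mulr0.
Qed.

Lemma orthonormal_extension V s : orthonormal_family s -> (forall u, u \in s -> u \in V) ->
  exists t, orthonormal_basis g y V (s ++ t).
Proof.
have [m] := ubnP (\dim V - size s); elim: m s => // m IH s sm os sV.
have sub : (<<s>> <= V)%VS by apply/span_subvP.
have fs := orthonormal_family_free os.
have le : (size s <= \dim V)%N by rewrite -(eqP fs) dimvS.
move: le; rewrite leq_eqVlt => /orP[/eqP eqs|lts].
  exists [::]; rewrite cats0; split=> //.
  by rewrite basisEfree fs sub eqs leqnn.
have [v [vV v1 vs]] := extend_orthonormal os sV lts.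
have [|||t ht] := IH (rcons s v).
- by rewrite size_rcons subnS -ltnS prednK ?subn_gt0.
- move=> i j; rewrite size_rcons !ltnS !nth_rcons => iS jS.
  move: iS jS; case: (ltngtP i (size s)) => // iS _; case: (ltngtP j (size s)) => // jS _.
  + exact: os.
  + by rewrite vs // jS ltn_eqF.
  + by rewrite (innerC _ _ gS) vs // iS gtn_eqF.
  + by rewrite iS jS eqxx.
- by move=> u; rewrite mem_rcons inE => /orP[/eqP->|/sV].
by exists (v :: t); rewrite -cat_rcons.
Qed.

Lemma onb_exists V : exists e, orthonormal_basis g y V e.
Proof. by have [//|//|t] := @orthonormal_extension V [::]; exists t. Qed.

Lemma onbP V : orthonormal_basis g y V (onb g y V).
Proof. by rewrite /onb; have [e he] := onb_exists V; apply: (xgetPex _ (ex_intro _ e he)). Qed.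

Lemma onb_size V e : orthonormal_basis g y V e -> size e = \dim V.
Proof. by case=> be _; rewrite -(span_basis be) (eqP (basis_free be)). Qed.

Lemma onb_mem V e i : orthonormal_basis g y V e -> (i < size e)%N -> e`_i \in V.
Proof. by move=> [be _] isz; apply: (basis_mem be); exact: mem_nth. Qed.

Lemma trace_onb (W : lmodType R) (B : 'rV[R]_n -> 'rV[R]_n -> W) V e e' :
  (forall u u' v, B (u + u') v = B u v + B u' v) ->
  (forall a u v, B (a *: u) v = a *: B u v) ->
  (forall u v v', B u (v + v') = B u v + B u v') ->
  (forall a u v, B u (a *: v) = a *: B u v) ->
  orthonormal_basis g y V e -> orthonormal_basis g y V e' ->
  \sum_(i < size e) B e`_i e`_i = \sum_(i < size e') B e'`_i e'`_i.
Proof.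
move=> BDl BZl BDr BZr oe oe'.
have B0l v : B 0 v = 0 by rewrite -(scale0r 0) BZl scale0r.
have B0r v : B v 0 = 0 by rewrite -(scale0r 0) BZr scale0r.
have Bsl I (r : seq I) F v : B (\sum_(i <- r) F i) v = \sum_(i <- r) B (F i) v.
  by elim/big_rec2: _ => [|i a b _ <-]; rewrite ?B0l ?BDl.
have Bsr I (r : seq I) F v : B v (\sum_(i <- r) F i) = \sum_(i <- r) B v (F i).
  by elim/big_rec2: _ => [|i a b _ <-]; rewrite ?B0r ?BDr.
transitivity (\sum_(i < size e') \sum_(j < size e) \sum_(k < size e)
   (<< e'`_i, e`_j >> * << e'`_i, e`_k >>) *: B e`_j e`_k); last first.
  apply: eq_bigr => i _; have m := onb_mem oe' (ltn_ord i).
  rewrite [in RHS](onb_expand oe m) Bsl; apply: eq_bigr => j _.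
  rewrite BZl Bsr scaler_sumr; apply: eq_bigr => k _.
  by rewrite BZr scalerA.
rewrite exchange_big /=; apply: eq_bigr => j _.
rewrite exchange_big /= (bigD1 j) //= [X in _ + X]big1 ?addr0 => [|k kj].
   rewrite -scaler_suml; under eq_bigr => i _ do rewrite (innerC _ e`_j gS).
  rewrite -(onb_parseval _ oe' (onb_mem oe (ltn_ord j))).
  by case: oe => _ ->//; rewrite eqxx scale1r.
rewrite -scaler_suml.
under eq_bigr => i _ do rewrite (innerC _ e`_j gS) (innerC _ e`_k gS).
rewrite -(onb_parseval _ oe' (onb_mem oe (ltn_ord j))).
by case: oe => _ ->//; rewrite (inj_eq val_inj) eq_sym (negbTE kj) scale0r.
Qed.

End Orthonormal.

(** * Sectional curvature of planes *)

Section Planes.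
Context {R : realType} {n : nat}.
Variables (g : 'rV[R]_n -> 'M[R]_n) (y : 'rV[R]_n).
Hypothesis mg : metric_germ g y.
Local Notation "<< u , v >>" := (inner (g y) u v).
Implicit Types (V W P : {vspace 'rV[R]_n}) (e s : seq 'rV[R]_n) (u v : 'rV[R]_n).
Let gS := metric_germ_sym mg.
Let gpos := nbhs_singleton (mg_pos mg).

Lemma riem_pair a b c d : riem g y a b c d = riem g y c d a b.
Proof.
exact: (curv_pair (@riem_alt12 _ _ g y) (riem_alt34 mg) (riem_bianchi mg)).
Qed.

Lemma riem_swap u v : riem g y u v v u = riem g y v u u v.
Proof. by rewrite riem_alt12 (riem_alt34 mg) opprK. Qed.

Lemma riem_repeat u w x : riem g y u u w x = 0.
Proof. by have := riem_alt12 g y u u w x => e; lra. Qed.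

Lemma riem_repeat34 u w x : riem g y w x u u = 0.
Proof. by have := riem_alt34 mg w x u u => e; lra. Qed.

Lemma sect_orthonormal u v : << u, u >> = 1 -> << v, v >> = 1 -> << u, v >> = 0 ->
  sect g y u v = riem g y u v v u.
Proof. by move=> uu vv uv; rewrite /sect uu vv uv expr0n mulr1 subr0 divr1. Qed.

Lemma riem_comb a b c d u v :
  riem g y (a *: u + b *: v) (c *: u + d *: v) (c *: u + d *: v) (a *: u + b *: v) =
  (a * d - b * c) ^+ 2 * riem g y u v v u.
Proof.
rewrite !(riemD1 mg, riemZ1 mg, riemD2 mg, riemZ2 mg) !riem_repeat.
rewrite !(riemD3 mg, riemZ3 mg, riemD4, riemZ4) !riem_repeat34.
rewrite (riem_alt12 g y v u) (riem_alt34 mg u v u v).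
rewrite ?(riem_alt12 g y v u) ?(riem_alt34 mg u v u v); ring.
Qed.

Lemma gram_comb a b c d u v :
  << a *: u + b *: v, a *: u + b *: v >> * << c *: u + d *: v, c *: u + d *: v >>
  - << a *: u + b *: v, c *: u + d *: v >> ^+ 2 =
  (a * d - b * c) ^+ 2 * (<< u, u >> * << v, v >> - << u, v >> ^+ 2).
Proof.
rewrite !(innerDl, innerZl) !(innerDr, innerZr) (innerC v u gS); ring.
Qed.

Lemma mem_span2 u v w : w \in <<[:: u; v]>>%VS -> exists a b, w = a *: u + b *: v.
Proof.
rewrite span_cons span_seq1 => /memv_addP[_ /vlineP[a ->]] [_ /vlineP[b ->] ->].
by exists a, b.
Qed.

(** An orthonormal pair of P is a combination of the chosen basis of P; numerator
    and denominator of the sectional curvature both scale by the square of the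
    determinant, and the denominator is 1 on the orthonormal pair. *)
Lemma plane_sect_onb P u v : \dim P = 2%N -> u \in P -> v \in P ->
  << u, u >> = 1 -> << v, v >> = 1 -> << u, v >> = 0 ->
  plane_sect g y P = riem g y u v v u.
Proof.
move=> dimP uP vP uu vv uv; rewrite /plane_sect.
have sz : size (vbasis P) = 2%N by rewrite size_tuple.
have eP : P = <<[:: (vbasis P)`_0; (vbasis P)`_1]>>%VS.
  rewrite -[LHS](span_basis (vbasisP P)); congr <<_>>%VS.
  by case: (tval _) sz => [|? [|? []]].
rewrite eP in uP vP; have [a [b eu]] := mem_span2 uP; have [c [d ev]] := mem_span2 vP.
set w0 := (vbasis P)`_0 in eu ev *; set w1 := (vbasis P)`_1 in eu ev *.
have G := gram_comb a b c d w0 w1; rewrite -eu -ev uu vv uv expr0n mulr1 subr0 in G.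
have K := riem_comb a b c d w0 w1; rewrite -eu -ev in K.
rewrite /sect -/(riem g y w0 w1 w1 w0) K.
set q := << w0, w0 >> * << w1, w1 >> - << w0, w1 >> ^+ 2 in G *.
have q0 : q != 0 by apply/eqP => q0; move: G; rewrite q0 mulr0 => /eqP; rewrite oner_eq0.
by apply: (mulIf q0); rewrite divfK // mulrAC -G mul1r.
Qed.

Lemma span2_dim u v : << u, u >> = 1 -> << v, v >> = 1 -> << u, v >> = 0 ->
  orthonormal_family g y [:: u; v] /\ \dim <<[:: u; v]>> = 2%N.
Proof.
move=> uu vv uv.
have o : orthonormal_family g y [:: u; v].
  move=> [|[|//]] [|[|//]] //= _ _; rewrite ?uu ?vv ?uv //.
  by rewrite (innerC _ _ gS) uv.
by split => //; have /eqP := orthonormal_family_free o.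
Qed.

Lemma plane_onb P : \dim P = 2%N -> exists u v,
  [/\ << u, u >> = 1, << v, v >> = 1, << u, v >> = 0 & P = <<[:: u; v]>>%VS].
Proof.
move=> dP; have [e oe] := onb_exists gS gpos P.
have := onb_size oe; rewrite dP; case: e oe => [|u [|v []]] //= [be oe] _.
exists u, v; split; [exact: (oe 0 0)%N|exact: (oe 1 1)%N|exact: (oe 0 1)%N|].
by rewrite (span_basis be).
Qed.

(** Orthonormal pairs in V are parametrized by their coordinates in a fixed
    orthonormal basis of V.  They form a closed bounded set on which the
    sectional curvature is a polynomial. *)
Lemma min_curvature_pair V : (2 <= \dim V)%N -> exists u v,
  [/\ u \in V, v \in V, [/\ << u, u >> = 1, << v, v >> = 1 & << u, v >> = 0] &
   forall u' v', u' \in V -> v' \in V ->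
     << u', u' >> = 1 -> << v', v' >> = 1 -> << u', v' >> = 0 ->
     riem g y u v v u <= riem g y u' v' v' u'].
Proof.
move=> dV; have [e oe] := onb_exists gS gpos V; have se := onb_size oe.
set k := size e in se; have k2 : (2 <= k)%N by rewrite se.
pose x (w : 'rV[R]_(k + k)) := \sum_(i < k) w 0 (lshift k i) *: e`_i.
pose z (w : 'rV[R]_(k + k)) := \sum_(i < k) w 0 (rshift k i) *: e`_i.
have xV w : x w \in V by apply: memv_suml => i _; apply/memvZ/(onb_mem oe).
have zV w : z w \in V by apply: memv_suml => i _; apply/memvZ/(onb_mem oe).
pose A : set 'rV[R]_(k + k) :=
  [set w | [/\ << x w, x w >> = 1, << z w, z w >> = 1 & << x w, z w >> = 0]].
pose F w := riem g y (x w) (z w) (z w) (x w).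
have dx w : differentiable x w.
  by apply: diff_sum => i; apply: differentiableZl; exact: differentiable_coord.
have dz w : differentiable z w.
  by apply: diff_sum => i; apply: differentiableZl; exact: differentiable_coord.
have di (a b : 'rV[R]_(k + k) -> 'rV[R]_n) w :
    (forall w, differentiable a w) -> (forall w, differentiable b w) ->
    differentiable (fun w => << a w, b w >>) w.
  by move=> da db; apply: diff_inner.
have FE : F = fun w => \sum_(i < k) \sum_(j < k) \sum_(l < k) \sum_(m < k)
   (w 0 (lshift k i) * w 0 (rshift k j) * w 0 (rshift k l) * w 0 (lshift k m)) *
     riem g y e`_i e`_j e`_l e`_m.
  have s1 (c : 'I_k -> R) b c' d : riem g y (\sum_(i < k) c i *: e`_i) b c' d = \sum_(i < k) c i * riem g y e`_i b c' d.
    elim/big_rec2: _ => [|i a b' _ <-]; last by rewrite (riemD1 mg) (riemZ1 mg).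
    by have := riemZ1 mg 0 0 b c' d; rewrite scale0r mul0r.
  have s2 (c : 'I_k -> R) b c' d : riem g y b (\sum_(i < k) c i *: e`_i) c' d = \sum_(i < k) c i * riem g y b e`_i c' d.
    by rewrite riem_alt12 s1 -sumrN; apply: eq_bigr => i _; rewrite -mulrN -riem_alt12.
  have s3 (c : 'I_k -> R) b c' d : riem g y b c' (\sum_(i < k) c i *: e`_i) d = \sum_(i < k) c i * riem g y b c' e`_i d.
    by rewrite riem_pair s1; apply: eq_bigr => i _; rewrite riem_pair.
  have s4 (c : 'I_k -> R) b c' d : riem g y b c' d (\sum_(i < k) c i *: e`_i) = \sum_(i < k) c i * riem g y b c' d e`_i.
    by rewrite (riem_alt34 mg) s3 -sumrN; apply: eq_bigr => i _; rewrite -mulrN -(riem_alt34 mg).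
  apply/funext => w; rewrite /F {1}/x s1; apply: eq_bigr => i _.
  rewrite {1}/z s2 mulr_sumr; apply: eq_bigr => j _.
  rewrite {1}/z s3 !mulr_sumr; apply: eq_bigr => l _.
  rewrite {1}/x s4 !mulr_sumr; apply: eq_bigr => m _.
  by rewrite !mulrA.
have dFw w : differentiable F w.
  rewrite FE; do 4 (apply: diff_sum => ?).
  apply: differentiableM => //; do 3 (apply: differentiableM; last exact: differentiable_coord).
  exact: differentiable_coord.
have coordA u v : u \in V -> v \in V -> exists w, x w = u /\ z w = v.
  move=> uV vV; exists (row_mx (\row_(i < k) << u, e`_i >>) (\row_(i < k) << v, e`_i >>)).
  split.
    rewrite [RHS](onb_expand oe uV); apply: eq_bigr => i _.
    by rewrite row_mxEl mxE.
  rewrite [RHS](onb_expand oe vV); apply: eq_bigr => i _.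
  by rewrite row_mxEr mxE.
have A0 : A !=set0.
  have k0 : (0 < k)%N by apply: leq_trans k2.
  have [w [e1 e2]] := coordA _ _ (onb_mem oe k0) (onb_mem oe k2).
  have oo := oe.2.
  by exists w; rewrite /A /= e1 e2 !oo.
have cA : closed A.
  have cl1 (f : 'rV[R]_(k + k) -> R) (a : R) : (forall w, differentiable f w) -> closed [set w | f w = a].
    move=> df; rewrite (_ : [set w | _] = f @^-1` [set a]) //.
    apply: closed_comp => [w _|]; last exact: closed_eq.
    exact: differentiable_continuous.
  rewrite (_ : A = [set w | << x w, x w >> = 1] `&` [set w | << z w, z w >> = 1] `&`
     [set w | << x w, z w >> = 0]).
    by apply: closedI; [apply: closedI|]; apply: cl1 => w; exact: di.
  by apply/seteqP; split=> w /=; [move=> []|move=> [[]]].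
have bA : bounded_set A.
  exists 1; split; first exact: num_real.
  move=> M M1 w [] xx zz _; apply: le_trans (ltW M1).
  have bnd (c : 'I_k -> R) i : \sum_(i < k) c i ^+ 2 = 1 -> `|c i| <= 1.
    move=> s; rewrite -(@ler_pXn2r _ 2) ?nnegrE // expr1n real_normK ?num_real // -s.
    by rewrite (bigD1 i) //= lerDl sumr_ge0 // => j _; exact: sqr_ge0.
  have cx i : w 0 (lshift k i) = << x w, e`_i >>.
    by have := orthonormal_family_coord (fun i => w 0 (lshift k i)) i oe.2.
  have cz i : w 0 (rshift k i) = << z w, e`_i >>.
    by have := orthonormal_family_coord (fun i => w 0 (rshift k i)) i oe.2.
  have sx : \sum_(i < k) (w 0 (lshift k i)) ^+ 2 = 1.
    rewrite -xx (onb_parseval gS _ oe (xV w)); apply: eq_bigr => i _.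
    by rewrite cx expr2.
  have sz : \sum_(i < k) (w 0 (rshift k i)) ^+ 2 = 1.
    rewrite -zz (onb_parseval gS _ oe (zV w)); apply: eq_bigr => i _.
    by rewrite cz expr2.
  rewrite /Num.Def.normr /= mx_normrE; apply: bigmax_le => // -[i j] _ /=.
  rewrite (ord1 i); case: (split_ordP j) => j' ->.
    exact: (bnd (fun i => w 0 (lshift k i))).
  exact: (bnd (fun i => w 0 (rshift k i))).
have [|w] := @EVT_min_rV _ _ F A A0 (bounded_closed_compact bA cA).
  by apply: continuous_subspaceT => w; exact: differentiable_continuous.
rewrite inE => -[xx zz xz] wmin.
exists (x w), (z w); split=> // u' v' uV vV uu vv uv.
have [w' [e1 e2]] := coordA _ _ uV vV.
have := wmin w'; rewrite /F e1 e2; apply.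
by rewrite inE /A /= e1 e2.
Qed.

Lemma inf_sect_attained V : (2 <= \dim V)%N ->
  (exists2 P, planes V P & plane_sect g y P = inf_sect g y V) /\
  (forall P, planes V P -> inf_sect g y V <= plane_sect g y P).
Proof.
move=> dV; have [u [v [uV vV [uu vv uv] min]]] := min_curvature_pair dV.
have [_ d2] := span2_dim uu vv uv.
pose P0 := <<[:: u; v]>>%VS.
have pP0 : planes V P0.
  split=> //; apply/span_subvP => w; rewrite !inE => /orP[/eqP->|/eqP->] //.
have uP : u \in P0 by apply: memv_span; rewrite inE eqxx.
have vP : v \in P0 by apply: memv_span; rewrite !inE eqxx orbT.
have eP0 : plane_sect g y P0 = riem g y u v v u by apply: plane_sect_onb.
have lb P : planes V P -> plane_sect g y P0 <= plane_sect g y P.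
  move=> [sP dP]; have [u' [v' [uu' vv' uv' eP]]] := plane_onb dP.
  have u'P : u' \in P by rewrite eP; apply: memv_span; rewrite inE eqxx.
  have v'P : v' \in P by rewrite eP; apply: memv_span; rewrite !inE eqxx orbT.
  rewrite eP0 (plane_sect_onb dP u'P v'P uu' vv' uv'); apply: min => //.
    exact: (subvP sP).
  exact: (subvP sP).
have e : inf_sect g y V = plane_sect g y P0.
  apply/le_anti/andP; split.
    apply: ge_inf; last by exists P0.
    by exists (plane_sect g y P0) => _ [P pP <-]; exact: lb.
  apply: lb_le_inf; first by exists (plane_sect g y P0); exists P0.
  by move=> _ [P pP <-]; exact: lb.
by split; [exists P0|move=> P pP; rewrite e; exact: lb].
Qed.

Lemma sum_lt_half (k : nat) (X : nat -> nat -> R) :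
  (forall i j, X i j = X j i) -> (forall i, X i i = 0) ->
  \sum_(j < k) \sum_(i < k | (i < j)%N) X i j = 2^-1 * \sum_(i < k) \sum_(j < k) X i j.
Proof.
move=> XC X0.
have E : \sum_(i < k) \sum_(j < k) X i j =
  \sum_(j < k) \sum_(i < k | (i < j)%N) X i j + \sum_(j < k) \sum_(i < k | (i < j)%N) X i j.
  rewrite [X in _ = _ + X](exchange_big_dep xpredT) //= [in LHS]exchange_big -big_split; apply: eq_bigr => j _ /=.
  rewrite (bigID (fun i : 'I_k => (i < j)%N)) /=; congr (_ + _).
  rewrite (bigID (fun i : 'I_k => i == j)) /= (big_pred1 j) ?X0 ?add0r => [|i].
    apply: eq_big => i; last by rewrite XC.
    by rewrite -leqNgt ltn_neqAle eq_sym andbC.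
  by rewrite /= andbC; case: eqP => //= ->; rewrite ltnn.
by rewrite E; field.
Qed.

(** The double sum is a trace in either index, so it may be moved from one
    orthonormal basis to another one index at a time. *)
Lemma scalar_curv_onb V e : orthonormal_basis g y V e ->
  scalar_curv g y V = 2^-1 * \sum_(i < size e) \sum_(j < size e) riem g y e`_i e`_j e`_j e`_i.
Proof.
move=> oe; rewrite /scalar_curv; set e' := onb g y V.
have oe' : orthonormal_basis g y V e' by exact: onbP.
transitivity (2^-1 * \sum_(i < size e') \sum_(j < size e') riem g y e'`_i e'`_j e'`_j e'`_i).
  rewrite -(@sum_lt_half _ (fun i j => riem g y e'`_i e'`_j e'`_j e'`_i)).
  - apply: eq_bigr => j _; apply: eq_bigr => i ij; apply: sect_orthonormal; rewrite oe'.2 ?eqxx //.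
    by rewrite ltn_eqF.
  - by move=> i j; exact: riem_swap.
  - by move=> i; exact: riem_repeat.
congr (_ * _).
transitivity (\sum_(i < size e') \sum_(j < size e) riem g y e'`_i e`_j e`_j e'`_i).
  apply: eq_bigr => i _.
  apply: (@trace_onb R n g y gS R^o (fun u v => riem g y e'`_i u v e'`_i) V e' e) => //.
  - by move=> *; exact: riemD2.
  - by move=> *; exact: riemZ2.
  - by move=> *; exact: riemD3.
  - by move=> *; exact: riemZ3.
rewrite exchange_big [RHS]exchange_big; apply: eq_bigr => j _ /=.
apply: (@trace_onb R n g y gS R^o (fun u v => riem g y u e`_j e`_j v) V e' e) => //.
- by move=> *; exact: riemD1.
- by move=> *; exact: riemZ1.
- by move=> *; exact: riemD4.
- by move=> *; exact: riemZ4.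
Qed.

End Planes.

(** * The inequality for one leaf *)

Section LeafAlgebra.
Context {R : realType} {p : nat}.
Variables (G : 'M[R]_p).
Hypothesis GS : G^T = G.
Hypothesis Gpos : forall u, u != 0 -> 0 < inner G u u.
Local Notation "<< u , v >>" := (inner G u v).

Lemma norm_ge0 u : 0 <= << u, u >>.
Proof. by have [->|/Gpos/ltW//] := eqVneq u 0; rewrite inner0l. Qed.

Lemma norm_eq0 u : << u, u >> = 0 -> u = 0.
Proof. by move=> e; apply/eqP/negPn/negP => /Gpos; rewrite e ltxx. Qed.

(** The entries that the plane of the first two basis vectors can account for. *)
Definition corner (i j : nat) := (i < 2)%N && (j < 2)%N.

Lemma corner_sum k (X : nat -> nat -> R) :
  \sum_(i < k.+2) \sum_(j < k.+2 | corner i j) X i j = X 0 0 + X 0 1 + X 1 0 + X 1 1.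
Proof.
have E i : \sum_(j < k.+2 | corner i j) X i j = if (i < 2)%N then X i 0%N + X i 1%N else 0.
  rewrite big_mkcond !big_ord_recl /= /corner /= !andbT big1 => [|j _].
    by case: ifP; rewrite addr0 ?addr0.
  by rewrite andbF.
under eq_bigr => i _ do rewrite E.
rewrite !big_ord_recl /= big1 ?addr0 ?addrA // => j _.
Qed.

(** A is the second fundamental form on the basis of the leaf, C its mixed part
    and B its diagonal on the complementary leaf. *)
Variables (k l : nat) (A C : nat -> nat -> 'rV[R]_p) (B : nat -> 'rV[R]_p).
Hypothesis AC : forall i j, A i j = A j i.

Let a := \sum_(i < k.+2) A i i.
Let b := \sum_(j < l) B j.

(** What the Chen inequality loses: a sum of squares. *)
Definition defect : R := 2^-1 * (<< b, b >> + << A 0 0 + A 1 1, A 0 0 + A 1 1 >>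
   + \sum_(i < k.+2) \sum_(j < k.+2 | ~~ corner i j) << A i j, A i j >>)
   + \sum_(i < k.+2) \sum_(j < l) << C i j, C i j >>.

(** Completing squares: |a|^2 / 2 + <a, b> = |a + b|^2 / 2 - |b|^2 / 2, and the
    corner of the sum of the |A_ij|^2 combines with <A_00, A_11> - |A_01|^2 to
    |A_00 + A_11|^2. *)
Lemma leaf_identity :
  2^-1 * (\sum_(i < k.+2) \sum_(j < k.+2) (<< A i i, A j j >> - << A i j, A i j >>))
  - (<< A 0 0, A 1 1 >> - << A 0 1, A 0 1 >>)
  + \sum_(i < k.+2) \sum_(j < l) (<< A i i, B j >> - << C i j, C i j >>)
  = 2^-1 * << a + b, a + b >> - defect.
Proof.
have e1 : \sum_(i < k.+2) \sum_(j < k.+2) (<< A i i, A j j >> - << A i j, A i j >>) =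
    << a, a >> - \sum_(i < k.+2) \sum_(j < k.+2) << A i j, A i j >>.
  rewrite inner_suml -sumrB; apply: eq_bigr => i _.
  by rewrite inner_sumr sumrB.
have e2 : \sum_(i < k.+2) \sum_(j < l) (<< A i i, B j >> - << C i j, C i j >>) =
    << a, b >> - \sum_(i < k.+2) \sum_(j < l) << C i j, C i j >>.
  rewrite inner_suml -sumrB; apply: eq_bigr => i _.
  by rewrite inner_sumr sumrB.
have e3 : \sum_(i < k.+2) \sum_(j < k.+2) << A i j, A i j >> =
   << A 0 0, A 0 0 >> + << A 0 1, A 0 1 >> + << A 0 1, A 0 1 >> + << A 1 1, A 1 1 >>
   + \sum_(i < k.+2) \sum_(j < k.+2 | ~~ corner i j) << A i j, A i j >>.
  have c := corner_sum k (fun i j => << A i j, A i j >>); rewrite /= (AC 1 0) in c.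
  rewrite -c -big_split; apply: eq_bigr => i _ /=.
  by rewrite (bigID (fun j : 'I_k.+2 => corner i j)).
rewrite e1 e2 e3 /defect.
rewrite !(innerDl, innerDr) (innerC b a GS) (innerC (A 1 1) (A 0 0) GS).
by field.
Qed.

Lemma defect_ge0 : 0 <= defect.
Proof.
rewrite addr_ge0 ?mulr_ge0 ?invr_ge0 ?ler0n ?addr_ge0 ?norm_ge0 //.
  by apply: sumr_ge0 => i _; apply: sumr_ge0 => j _; exact: norm_ge0.
by apply: sumr_ge0 => i _; apply: sumr_ge0 => j _; exact: norm_ge0.
Qed.

Lemma defect_eq0 : defect = 0 <->
  [/\ forall i j, (i < k.+2)%N -> (j < k.+2)%N -> ~~ corner i j -> A i j = 0,
      A 0 0 + A 1 1 = 0,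
      forall i j, (i < k.+2)%N -> (j < l)%N -> C i j = 0 & b = 0].
Proof.
have s1 : 0 <= \sum_(i < k.+2) \sum_(j < k.+2 | ~~ corner i j) << A i j, A i j >>.
  by apply: sumr_ge0 => i _; apply: sumr_ge0 => j _; exact: norm_ge0.
have s2 : 0 <= \sum_(i < k.+2) \sum_(j < l) << C i j, C i j >>.
  by apply: sumr_ge0 => i _; apply: sumr_ge0 => j _; exact: norm_ge0.
split; last first.
  move=> [h1 h2 h3 h4]; rewrite /defect h2 h4 !inner0l !add0r.
  rewrite !big1 ?mulr0 ?addr0 // => i _; rewrite big1 // => j.
    by move=> _; rewrite h3 // inner0l.
  by move=> nc; rewrite h1 // inner0l.
have := norm_ge0 b; have := norm_ge0 (A 0 0 + A 1 1).
rewrite /defect; set x1 := << _, _ >>; set x2 := << _, _ >>.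
move: s1 s2; set x3 := \sum_(i < _) _; set x4 := \sum_(i < _) _ => s1 s2 s3 s4 e.
have z1 : x1 = 0 by lra.
have z2 : x2 = 0 by lra.
have z3 : x3 = 0 by lra.
have z4 : x4 = 0 by lra.
split.
- move=> i j ik jk nc; apply: norm_eq0.
  have H : \sum_(j < k.+2 | ~~ corner i j) << A i j, A i j >> = 0.
    apply: (psumr_eq0P _ z3 (i := Ordinal ik)) => // i' _.
    by apply: sumr_ge0 => j' _; exact: norm_ge0.
  by apply: (psumr_eq0P _ H (i := Ordinal jk)) => // j' _; exact: norm_ge0.
- exact: norm_eq0.
- move=> i j ik jk; apply: norm_eq0.
  have H : \sum_(j < l) << C i j, C i j >> = 0.
    apply: (psumr_eq0P _ z4 (i := Ordinal ik)) => // i' _.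
    by apply: sumr_ge0 => j' _; exact: norm_ge0.
  by apply: (psumr_eq0P _ H (i := Ordinal jk)) => // j' _; exact: norm_ge0.
- exact: norm_eq0.
Qed.

End LeafAlgebra.

(** The two statements of the theorem differ only in the role of the factors; the
    following section treats a subspace V with a complement W, for constant
    totals S of the mixed and C of the ambient curvatures. *)
Section Leaf.
Context {R : realType} {n p : nat}.
Variables (g : 'rV[R]_n -> 'M[R]_n) (G : 'rV[R]_p -> 'M[R]_p) (P : 'rV[R]_n -> 'rV[R]_p).
Variable y : 'rV[R]_n.
Hypothesis mg : metric_germ g y.
Hypothesis mG : metric_germ G (P y).
Hypothesis dP : \forall z \near y, diffn 3 P z.
Hypothesis iso : \forall z \near y, forall u v,
  inner (g z) u v = inner (G (P z)) (ddir P u z) (ddir P v z).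

Local Notation h := (second_ff g G P y).
Local Notation T u := (ddir P u y).
Local Notation "<< u , v >>" := (inner (G (P y)) u v).
Local Notation ONB := (orthonormal_basis g y).
Let gS := metric_germ_sym mg.
Let gpos := nbhs_singleton (mg_pos mg).
Let GS := metric_germ_sym mG.
Let Gpos := nbhs_singleton (mg_pos mG).

Definition ambient_riem u v : R := riem G (P y) (T u) (T v) (T v) (T u).

Lemma gauss_sect u v : riem g y u v v u = ambient_riem u v + (<< h u u, h v v >> - << h u v, h u v >>).
Proof.
rewrite (gauss_equation mg mG dP iso) (second_ffC mg mG dP v u) /ambient_riem addrA.
by rewrite (innerC (h v v) (h u u) GS).
Qed.

Lemma differentialE u : differential P y u = T u.
Proof.
have dPy : differentiable P y by exact: diffn_diff (nbhs_singleton dP).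
by rewrite lfunE /= -(deriveEjacobian _ dPy) ddirE.
Qed.

Lemma image_plane_sect u v : inner (g y) u u = 1 -> inner (g y) v v = 1 ->
  inner (g y) u v = 0 ->
  plane_sect G (P y) (differential P y @: <<[:: u; v]>>)%VS = ambient_riem u v.
Proof.
have isoy := nbhs_singleton iso.
move=> uu vv uv; rewrite limg_span /= !differentialE.
have [_ d2'] : orthonormal_family G (P y) [:: T u; T v] /\ \dim <<[:: T u; T v]>> = 2%N.
  by apply: (span2_dim mG); rewrite -isoy.
by apply: (plane_sect_onb mG); rewrite -?isoy //; apply: memv_span; rewrite !inE eqxx ?orbT.
Qed.

Lemma trace_ffE (V : {vspace 'rV[R]_n}) e : ONB V e ->
  trace_ff g G P y V = \sum_(i < size e) h e`_i e`_i.
Proof.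
move=> oe; rewrite /trace_ff (big_nth 0) big_mkord.
apply: (trace_onb gS _ _ _ _ (onbP gS gpos V) oe).
- by move=> *; exact: (second_ffDl g G dP).
- by move=> *; exact: (second_ffZl g G dP).
- by move=> *; exact: (second_ffDr mg mG dP).
- by move=> *; exact: (second_ffZr mg mG dP).
Qed.

Variables (V W : {vspace 'rV[R]_n}) (S C Kmin : R).
Hypothesis dimV : (2 <= \dim V)%N.
Hypothesis full : forall e f, ONB V e -> ONB W f -> ONB fullv (e ++ f).
Hypothesis mixed_sum : forall e f, ONB V e -> ONB W f ->
  \sum_(i < size e) \sum_(j < size f) riem g y e`_i f`_j f`_j e`_i = S.
Hypothesis ambient_sum : forall e f, ONB V e -> ONB W f ->
  2^-1 * (\sum_(i < size e) \sum_(j < size e) ambient_riem e`_i e`_j)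
  + \sum_(i < size e) \sum_(j < size f) ambient_riem e`_i f`_j = C.
Hypothesis Kmin_le : forall Q, planes V Q -> Kmin <= plane_sect G (P y) (differential P y @: Q)%VS.

Let normH2 := let H := mean_curvature g G P y in inner (G (P y)) H H.
Let bound := n%:R ^+ 2 / 2 * normH2 - S + C - Kmin.

(** The vanishing of every square in [defect]. *)
Definition extremal (e f : seq 'rV[R]_n) := [/\
  forall i j, (i < size e)%N -> (j < size e)%N -> ~~ corner i j -> h e`_i e`_j = 0,
  h e`_0 e`_0 + h e`_1 e`_1 = 0,
  forall i j, (i < size e)%N -> (j < size f)%N -> h e`_i f`_j = 0 &
  \sum_(j < size f) h f`_j f`_j = 0].

(* The basis of V has k.+2 vectors in the notation of [defect]. *)
Let def (e f : seq 'rV[R]_n) := defect (G (P y)) (size e - 2) (size f)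
  (fun i j => h e`_i e`_j) (fun i j => h e`_i f`_j) (fun j => h f`_j f`_j).

Let size_ge2 e : ONB V e -> size e = (size e - 2).+2.
Proof. by move/onb_size => se; rewrite -addn2 subnK // se. Qed.

Lemma full_trace e f : ONB V e -> ONB W f ->
  trace_ff g G P y fullv = \sum_(i < size e) h e`_i e`_i + \sum_(j < size f) h f`_j f`_j.
Proof.
move=> oe of_; rewrite (trace_ffE (full oe of_)) size_cat big_split_ord /=.
congr (_ + _); apply: eq_bigr => i _; rewrite nth_cat.
  by rewrite ltn_ord.
by rewrite ltnNge leq_addr /= addKn.
Qed.

(** The inequality with its error term, for an arbitrary basis; the minimality of
    the plane of the first two vectors enters only in [leaf_inequality]. *)
Lemma leaf_delta e f : ONB V e -> ONB W f ->
  scalar_curv g y V - riem g y e`_0 e`_1 e`_1 e`_0 =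
  n%:R ^+ 2 / 2 * normH2 - S + C - ambient_riem e`_0 e`_1 - def e f.
Proof.
move=> oe of_; have sz := size_ge2 oe.
have n0 : n%:R != 0 :> R.
  rewrite pnatr_eq0 -lt0n; apply: (@leq_trans (\dim V)); first exact: leq_trans dimV.
  by apply: leq_trans (dimvS (subvf V)) _; rewrite dimvf /dim /= mul1n.
have -> : n%:R ^+ 2 / 2 * normH2 = 2^-1 * << trace_ff g G P y fullv, trace_ff g G P y fullv >>.
  by rewrite /normH2 /mean_curvature innerZl innerZr; field.
rewrite (full_trace oe of_) (scalar_curv_onb mg oe) -(mixed_sum oe of_) -(ambient_sum oe of_).
have hC i j : h e`_i e`_j = h e`_j e`_i by exact: (second_ffC mg mG dP).
have := @leaf_identity R p (G (P y)) GS (size e - 2)%N (size f) (fun i j => h e`_i e`_j)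
  (fun i j => h e`_i f`_j) (fun j => h f`_j f`_j) hC.
rewrite -sz -/(def e f) => I.
rewrite gauss_sect.
have E1 : \sum_(i < size e) \sum_(j < size e) riem g y e`_i e`_j e`_j e`_i =
   \sum_(i < size e) \sum_(j < size e) ambient_riem e`_i e`_j +
   \sum_(i < size e) \sum_(j < size e) (<< h e`_i e`_i, h e`_j e`_j >> - << h e`_i e`_j, h e`_i e`_j >>).
  rewrite -big_split; apply: eq_bigr => i _; rewrite -big_split; apply: eq_bigr => j _.
  exact: gauss_sect.
have E2 : \sum_(i < size e) \sum_(j < size f) riem g y e`_i f`_j f`_j e`_i =
   \sum_(i < size e) \sum_(j < size f) ambient_riem e`_i f`_j +
   \sum_(i < size e) \sum_(j < size f) (<< h e`_i e`_i, h f`_j f`_j >> - << h e`_i f`_j, h e`_i f`_j >>).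
  rewrite -big_split; apply: eq_bigr => i _; rewrite -big_split; apply: eq_bigr => j _.
  exact: gauss_sect.
rewrite E1 E2; move: I.
set a1 := \sum_(i < _) \sum_(j < _) (_ - _); set a2 := \sum_(i < _) \sum_(j < _) (_ - _).
set b1 := \sum_(i < _) \sum_(j < _) ambient_riem _ _; set b2 := \sum_(i < _) \sum_(j < _) ambient_riem _ _.
set q := inner _ (_ + _) (_ + _); set d := def e f; set k0 := ambient_riem _ _.
set t1 := inner _ (h e`_0 _) _; set t2 := inner _ _ _.
move=> I; lra.
Qed.

Let def_ge0 e f : 0 <= def e f. Proof. exact: defect_ge0. Qed.

Let def_extremal e f : ONB V e -> def e f = 0 <-> extremal e f.
Proof. by move=> oe; rewrite /extremal (size_ge2 oe); exact: defect_eq0. Qed.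

Lemma adapted_onb Q : planes V Q -> exists e f,
  [/\ ONB V e, ONB W f & Q = <<[:: e`_0; e`_1]>>%VS].
Proof.
move=> [sQ dQ]; have [u [v [uu vv uv eQ]]] := plane_onb mg dQ.
have [ouv _] := span2_dim mg uu vv uv.
have [|t ot] := orthonormal_extension gS gpos (V := V) ouv.
  by move=> w wi; apply: (subvP sQ); rewrite eQ; exact: memv_span.
have [f of_] := onb_exists gS gpos W.
by exists (u :: v :: t), f.
Qed.

Lemma span_first_two e : ONB V e -> [/\ planes V <<[:: e`_0; e`_1]>>%VS,
  plane_sect g y <<[:: e`_0; e`_1]>> = riem g y e`_0 e`_1 e`_1 e`_0 &
  plane_sect G (P y) (differential P y @: <<[:: e`_0; e`_1]>>)%VS = ambient_riem e`_0 e`_1].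
Proof.
move=> oe; have sz := size_ge2 oe.
have [s0 s1] : (0 < size e)%N /\ (1 < size e)%N by rewrite sz.
have [uu vv uv] : [/\ inner (g y) e`_0 e`_0 = 1, inner (g y) e`_1 e`_1 = 1 & inner (g y) e`_0 e`_1 = 0].
  by have [_ o] := oe; rewrite !o.
have [_ d2] := span2_dim mg uu vv uv.
split.
- split=> //; apply/span_subvP => w; rewrite !inE => /orP[/eqP->|/eqP->];
    by apply: (onb_mem oe).
- by apply: (plane_sect_onb mg) => //; apply: memv_span; rewrite !inE eqxx ?orbT.
- exact: image_plane_sect.
Qed.

Theorem leaf_inequality : delta_hat g y V <= bound.
Proof.
have [[Q pQ eQ] _] := inf_sect_attained mg dimV.
have [e [f [oe of_ E]]] := adapted_onb pQ.
have [_ k1 k2] := span_first_two oe.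
have := Kmin_le pQ; have := def_ge0 e f; have := leaf_delta oe of_.
rewrite -k1 -k2 -E eQ /delta_hat /bound; lra.
Qed.

(** At a minimizing plane, the defect and the excess of the ambient curvature over
    Kmin are nonnegative and add up to the gap in the inequality. *)
Theorem leaf_equality : delta_hat g y V = bound <-> exists Q, [/\ planes V Q,
  plane_sect g y Q = inf_sect g y V,
  plane_sect G (P y) (differential P y @: Q)%VS = Kmin &
  exists e f, [/\ ONB V e, ONB W f, Q = <<[:: e`_0; e`_1]>>%VS & extremal e f]].
Proof.
split=> [eq|[Q [pQ eQ kQ [e [f [oe of_ E fl]]]]]].
  have [[Q pQ eQ] _] := inf_sect_attained mg dimV.
  have [e [f [oe of_ E]]] := adapted_onb pQ.
  have [_ k1 k2] := span_first_two oe.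
  have K := Kmin_le pQ; have D := def_ge0 e f; have L := leaf_delta oe of_.
  rewrite -k1 -k2 -E eQ in L; rewrite /delta_hat /bound in eq.
  have d0 : def e f = 0 by lra.
  exists Q; split=> //; first by lra.
  by exists e, f; split=> //; apply/def_extremal.
have [_ k1 k2] := span_first_two oe.
have L := leaf_delta oe of_; rewrite -k1 -k2 -E eQ kQ in L.
by rewrite /delta_hat /bound L (iffRL (def_extremal f oe) fl) subr0.
Qed.

Lemma extremal_minimal e f : ONB V e -> ONB W f -> extremal e f -> [/\
  mixed_totally_geodesic_at g G P y V W, partial_minimal_at g G P y V,
  partial_minimal_at g G P y W & minimal_at g G P y].
Proof.
move=> oe of_ [f1 f2 f3 f4].
have h0l v : h 0 v = 0 by have := second_ffZl g G dP 0 0 v; rewrite !scale0r.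
have h0r v : h v 0 = 0 by have := second_ffZr mg mG dP 0 v 0; rewrite !scale0r.
have tV : \sum_(i < size e) h e`_i e`_i = 0.
  move: f1; rewrite (size_ge2 oe) => f1.
  rewrite !big_ord_recl /= addrA f2 add0r big1 // => i _.
  by apply: f1 => //; exact: (ltn_ord (lift ord0 (lift ord0 i))).
split.
- move=> u v uV vW; rewrite (onb_expand oe uV) (onb_expand of_ vW).
  have hsl I (r : seq I) F w : h (\sum_(i <- r) F i) w = \sum_(i <- r) h (F i) w.
    by elim/big_rec2: _ => [|i a b _ <-]; rewrite ?h0l ?(second_ffDl g G dP).
  have hsr I (r : seq I) F w : h w (\sum_(i <- r) F i) = \sum_(i <- r) h w (F i).
    by elim/big_rec2: _ => [|i a b _ <-]; rewrite ?h0r ?(second_ffDr mg mG dP).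
  rewrite hsl big1 // => i _; rewrite hsr big1 // => j _.
  by rewrite (second_ffZl g G dP) (second_ffZr mg mG dP) f3 // !scaler0.
- by rewrite /partial_minimal_at (trace_ffE oe).
- by rewrite /partial_minimal_at (trace_ffE of_).
- by rewrite /minimal_at /mean_curvature (full_trace oe of_) tV f4 addr0 scaler0.
Qed.

Definition corner_entry (s t : R) (i j : nat) : R :=
  if (i == 0%N) && (j == 0%N) then s
  else if (i == 1%N) && (j == 1%N) then - s
  else if (i + j == 1)%N then t else 0.

Lemma second_ff_in_normal u v : h u v \in normal_subspace G P y.
Proof.
rewrite memv_ker lfunE /= mulmxA; apply/eqP/rowP => i; rewrite [RHS]mxE.
have dPy : differentiable P y by exact: diffn_diff (nbhs_singleton dP).
have := second_ff_normal mg mG dP iso u v (basis_vec i).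
rewrite ddirE (deriveEjacobian _ dPy) innerE trmx_mul mulmxA.
by rewrite /basis_vec trmx_delta -colE mxE.
Qed.

Lemma normal_eq0 nu X : orthonormal_basis G (P y) (normal_subspace G P y) nu ->
  X \in normal_subspace G P y -> (forall xi, xi \in nu -> << X, xi >> = 0) -> X = 0.
Proof.
move=> onu XN X0; rewrite (onb_expand onu XN) big1 // => i _.
by rewrite X0 ?scale0r // mem_nth.
Qed.

(** h takes values in the normal space, so it vanishes as soon as its products with
    an orthonormal basis of the normal space do. *)
Lemma extremal_shape e f nu : ONB V e -> ONB W f ->
  orthonormal_basis G (P y) (normal_subspace G P y) nu ->
  extremal e f <-> forall xi, xi \in nu -> exists s t, [/\
    forall i j, (i < size e)%N -> (j < size e)%N -> << h e`_j e`_i, xi >> = corner_entry s t i j,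
    forall i j, (i < size e)%N -> (j < size f)%N -> << h e`_i f`_j, xi >> = 0 &
    \sum_(j < size f) << h f`_j f`_j, xi >> = 0].
Proof.
move=> oe of_ onu; have sz := size_ge2 oe; have hC := second_ffC mg mG dP.
have N X : X \in normal_subspace G P y -> (forall xi, xi \in nu -> << X, xi >> = 0) -> X = 0.
  exact: normal_eq0.
have hN := second_ff_in_normal.
split=> [[f1 f2 f3 f4] xi _|H].
  exists << h e`_0 e`_0, xi >>, << h e`_0 e`_1, xi >>; split.
  - move=> i j ie je; have [c|nc] := boolP (corner i j); last first.
      have nc' : ~~ corner j i by rewrite /corner andbC.
      rewrite f1 // inner0l /corner_entry; move: nc {nc'}; rewrite /corner.
      by case: i ie => [|[|i]] ie; case: j je => [|[|j]].
    move: c {ie je}; rewrite /corner /corner_entry.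
    case: i => [|[|i]] //; case: j => [|[|j]] //= _; first by rewrite hC.
    by move/eqP: f2; rewrite addrC addr_eq0 => /eqP ->; rewrite innerNl.
  - by move=> i j ie jf; rewrite f3 // inner0l.
  - by rewrite -inner_suml f4 inner0l.
have [s0 s1] : (0 < size e)%N /\ (1 < size e)%N by rewrite sz.
split.
- move=> i j ie je nc; apply: N => // xi xinu; have [s [t [H1 _ _]]] := H xi xinu.
  rewrite H1 // /corner_entry; move: nc; rewrite /corner.
  by case: i ie => [|[|i]] ie; case: j je => [|[|j]].
- apply: N => [|xi xinu]; first by apply: memvD.
  have [s [t [H1 _ _]]] := H xi xinu.
  by rewrite innerDl !H1 // /corner_entry /= subrr.
- move=> i j ie jf; apply: N => // xi xinu; have [s [t [_ H2 _]]] := H xi xinu.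
  exact: H2.
- apply: N => [|xi xinu]; first by apply: memv_suml.
  by have [s [t [_ _ H3]]] := H xi xinu; rewrite inner_suml.
Qed.

Lemma shape_entry xi (e : seq 'rV[R]_n) i j :
  shape_operator_mx g G P y xi e i j = << h e`_j e`_i, xi >>.
Proof.
rewrite mxE innerE /shape_operator mulmxKV; last exact: m1_unit (metric_germ_at mg).
have hsr I (r : seq I) F w : h w (\sum_(i <- r) F i) = \sum_(i <- r) h w (F i).
  elim/big_rec2: _ => [|k a b _ <-]; last by rewrite (second_ffDr mg mG dP).
  by have := second_ffZr mg mG dP 0 w 0; rewrite !scale0r.
rewrite [in RHS](row_sum_delta e`_i) hsr inner_suml mxE; apply: eq_bigr => k _.
by rewrite !mxE (second_ffZr mg mG dP) innerZl mulrC.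
Qed.

End Leaf.

(** * Charts and the two factors *)

Section Charts.
Context {R : realType}.

Lemma chart_im_nbhs n (M : chartedSpace R n) (a : chart M) y :
  is_manifold M -> chart_im a y -> nbhs y (chart_im a).
Proof. by move=> hM ay; apply: open_nbhs_nbhs; split=> //; exact: manifold_im_open. Qed.

Lemma metric_germ_chart n (M : chartedSpace R n) (g : matrix_field M) (a : chart M) y :
  is_manifold M -> is_metric g -> chart_im a y -> metric_germ (g a) y.
Proof.
move=> hM hg ay; have na := chart_im_nbhs hM ay; split.
- exact: Ck_diffn na (metric_smooth hg _ 2).
- by apply: filterS na => z az; exact: (Defs.metric_sym hg az).
- by apply: filterS na => z az; exact: (metric_pos hg az).
Qed.

Lemma local_rep_dom_nbhs n1 n2 p (N1 : chartedSpace R n1) (N2 : chartedSpace R n2)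
    (N : chartedSpace R p) (phi : prod_manifold N1 N2 -> N)
    (a : chart (prod_manifold N1 N2)) (b : chart N) (x : prod_manifold N1 N2) :
  is_manifold N1 -> is_manifold N2 -> is_manifold N -> continuous phi ->
  chart_dom a x -> chart_dom b (phi x) ->
  nbhs (chart_map a x) (local_rep_dom phi a b).
Proof.
case: a x => a1 a2 [x1 x2] h1 h2 hN cphi /= [/= ax1 ax2] bx.
set y := row_mx _ _.
have yl : lsubmx y = chart_map a1 x1 by rewrite row_mxKl.
have yr : rsubmx y = chart_map a2 x2 by rewrite row_mxKr.
have im1 : chart_im a1 (lsubmx y) by rewrite yl; exists x1.
have im2 : chart_im a2 (rsubmx y) by rewrite yr; exists x2.
have n1' : \forall z \near y, chart_im a1 (lsubmx z).
  exact: (@continuous_lsubmx R 1 n1 n2 y _ (chart_im_nbhs h1 im1)).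
have n2' : \forall z \near y, chart_im a2 (rsubmx z).
  exact: (@continuous_rsubmx R 1 n1 n2 y _ (chart_im_nbhs h2 im2)).
have c1 : {for y, continuous (fun z => chart_inv a1 (lsubmx z))}.
  apply: continuous_comp; first exact: continuous_lsubmx.
  exact: manifold_inv_continuous.
have c2 : {for y, continuous (fun z => chart_inv a2 (rsubmx z))}.
  apply: continuous_comp; first exact: continuous_rsubmx.
  exact: manifold_inv_continuous.
pose inv z : N1 * N2 := (chart_inv a1 (lsubmx z), chart_inv a2 (rsubmx z)).
have c : {for y, continuous inv} by exact: (cvg_pair c1 c2).
have inv_y : inv y = (x1, x2).
  by rewrite /inv yl yr !manifold_chartK.
have cphi_inv : {for y, continuous (fun z => phi (inv z))}.
  by apply: continuous_comp => //; exact: cphi.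
have nb : nbhs (phi (inv y)) (chart_dom b).
  by apply: open_nbhs_nbhs; split; [exact: manifold_dom_open|rewrite inv_y].
have n3 : \forall z \near y, chart_dom b (phi (inv z)) by exact: (cphi_inv _ nb).
near=> z.
have [z1 d1 e1] : chart_im a1 (lsubmx z) by near: z.
have [z2 d2 e2] : chart_im a2 (rsubmx z) by near: z.
have bz : chart_dom b (phi (inv z)) by near: z.
exists (z1, z2) => /=; last by rewrite e1 e2 hsubmxK.
split; first by split.
by move: bz; rewrite /inv -e1 -e2 !manifold_chartK.
Unshelve. all: by end_near. Qed.

End Charts.

Section Tangent.
Context {R : realType} {n1 n2 : nat}.
Local Notation DT := (@tangent_left R n1 n2).
Local Notation DP := (@tangent_right R n1 n2).

Lemma mem_tangent_left u : (u \in DT) = (rsubmx u == 0).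
Proof. by rewrite memv_ker lfunE. Qed.
Lemma mem_tangent_right u : (u \in DP) = (lsubmx u == 0).
Proof. by rewrite memv_ker lfunE. Qed.

Lemma dim_rV n : \dim {: 'rV[R]_n} = n.
Proof. by rewrite dimvf /dim /= mul1n. Qed.

Lemma dim_tangent_left : \dim DT = n1.
Proof.
have := limg_ker_dim (linfun (@rsubmx R 1 n1 n2)) fullv.
rewrite capfv dim_rV.
have -> : (linfun (@rsubmx R 1 n1 n2) @: fullv)%VS = fullv.
  apply/eqP; rewrite eqEsubv subvf; apply/subvP => v _.
  by apply/memv_imgP; exists (row_mx 0 v); rewrite ?memvf // lfunE /= row_mxKr.
by rewrite dim_rV => /addIn.
Qed.

Lemma dim_tangent_right : \dim DP = n2.
Proof.
have := limg_ker_dim (linfun (@lsubmx R 1 n1 n2)) fullv.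
rewrite capfv dim_rV.
have -> : (linfun (@lsubmx R 1 n1 n2) @: fullv)%VS = fullv.
  apply/eqP; rewrite eqEsubv subvf; apply/subvP => v _.
  by apply/memv_imgP; exists (row_mx v 0); rewrite ?memvf // lfunE /= row_mxKl.
by rewrite dim_rV addnC => /addnI.
Qed.

End Tangent.

Section OnbSplit.
Context {R : realType} {n : nat}.
Variables (g : 'rV[R]_n -> 'M[R]_n) (y : 'rV[R]_n).
Hypothesis gS : (g y)^T = g y.
Local Notation ONB := (orthonormal_basis g y).

Lemma onb_intro (V : {vspace 'rV[R]_n}) e : orthonormal_family g y e ->
  (forall i, (i < size e)%N -> e`_i \in V) -> size e = \dim V -> ONB V e.
Proof.
move=> oe eV sz; split=> //; rewrite basisEfree (orthonormal_family_free oe) -sz leqnn andbT.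
apply/span_subvP => u ue; rewrite -(nth_index 0 ue); apply: eV.
by rewrite index_mem.
Qed.

Lemma onb_cat (V W : {vspace 'rV[R]_n}) e f :
  (forall u w, u \in V -> w \in W -> inner (g y) u w = 0) ->
  (\dim V + \dim W)%N = n -> ONB V e -> ONB W f -> ONB fullv (e ++ f).
Proof.
move=> orth dim oe of_; apply: onb_intro => [i j||].
- rewrite size_cat => ie je; rewrite !nth_cat.
  have [_ oe2] := oe; have [_ of2] := of_.
  have fidx k : (size e <= k)%N -> (k < size e + size f)%N -> (k - size e < size f)%N.
    by move=> ek kf; rewrite ltn_subLR.
  have [i1|i1] := ltnP i (size e); have [j1|j1] := ltnP j (size e).
  + exact: oe2.
  + rewrite orth ?(onb_mem oe) ?(onb_mem of_ (fidx _ j1 je)) //.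
    by rewrite ltn_eqF // (leq_trans i1).
  + rewrite (innerC _ _ gS) orth ?(onb_mem oe) ?(onb_mem of_ (fidx _ i1 ie)) //.
    by rewrite gtn_eqF // (leq_trans j1).
  + rewrite of2 ?fidx //; congr (_%:R); congr nat_of_bool.
    by rewrite -(eqn_add2r (size e)) !subnK.
- by move=> *; exact: memvf.
- by rewrite size_cat (onb_size oe) (onb_size of_) dim_rV.
Qed.

End OnbSplit.

(** * CR-warped products in a complex space form *)

Section CRWarped.
Context {R : realType} {n1 n2 m : nat}.
Variables (c : R) (NT : chartedSpace R n1) (NP : chartedSpace R n2)
    (gT : matrix_field NT) (f : NT -> R) (gP : matrix_field NP)
    (M : chartedSpace R (2 * m)) (gM J : matrix_field M)
    (phi : prod_manifold NT NP -> M).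
Hypothesis hM : is_complex_space_form gM J c.
Hypothesis hphi : is_cr_warped_product gT f gP gM J phi.
Variables (x : prod_manifold NT NP) (a : chart (prod_manifold NT NP)) (b : chart M).
Hypothesis (ha : chart_dom a x) (hb : chart_dom b (phi x)).

Local Notation y := (chart_map a x).
Local Notation Phi := (local_rep phi a b).
Local Notation g := (warped_metric gT f gP a).
Local Notation G := (gM b).
Local Notation Jz := (J b (Phi y)).
Local Notation DT := (@tangent_left R n1 n2).
Local Notation DP := (@tangent_right R n1 n2).
Local Notation h := (second_ff g G Phi y).
Local Notation dphi := (differential Phi y).
Local Notation F := (f \o chart_inv a.1).
Local Notation T u := (ddir Phi u y).
Local Notation ONB := (orthonormal_basis g y).

Let hW := crw_warping hphi.
Let y_l : lsubmx y = chart_map a.1 x.1. Proof. by rewrite /= row_mxKl. Qed.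
Let y_r : rsubmx y = chart_map a.2 x.2. Proof. by rewrite /= row_mxKr. Qed.
Let im_l : chart_im a.1 (lsubmx y).
Proof. by rewrite y_l; exists x.1 => //; case: ha. Qed.
Let im_r : chart_im a.2 (rsubmx y).
Proof. by rewrite y_r; exists x.2 => //; case: ha. Qed.

Let mT : metric_germ (gT a.1) (lsubmx y).
Proof. exact: metric_germ_chart (warped_manifold1 hW) (warped_metric1 hW) im_l. Qed.
Let mP : metric_germ (gP a.2) (rsubmx y).
Proof. exact: metric_germ_chart (warped_manifold2 hW) (warped_metric2 hW) im_r. Qed.
Let dF : diffn 2 F (lsubmx y).
Proof. exact: Ck_diffn (chart_im_nbhs (warped_manifold1 hW) im_l) (warped_smooth hW _ 2). Qed.
Let posF : \forall z \near lsubmx y, 0 < F z.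
Proof.
near=> z; exact: (warped_pos hW).
Unshelve. all: by end_near. Qed.

Let mg : metric_germ g y.
Proof. exact: (warped_germ mT mP dF posF). Qed.

Let nD : nbhs y (local_rep_dom phi a b).
Proof.
apply: local_rep_dom_nbhs => //.
- exact: warped_manifold1 hW.
- exact: warped_manifold2 hW.
- exact: csf_manifold hM.
- by case: (crw_smooth hphi).
Qed.

Let Dy : local_rep_dom phi a b y. Proof. exact: nbhs_singleton nD. Qed.

Let dP : \forall z \near y, diffn 3 Phi z.
Proof.
apply: filterS (near_join nD) => z nz.
by have [_ /(_ a b 3%N)] := crw_smooth hphi; exact: Ck_diffn.
Qed.

Let iso : \forall z \near y, forall u v,
  inner (g z) u v = inner (G (Phi z)) (ddir Phi u z) (ddir Phi v z).
Proof.
near=> z => u v.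
have Dz : local_rep_dom phi a b z by near: z.
have dPz : differentiable Phi z by apply: (@diffn_diff _ 2); near: z.
rewrite !innerE (crw_isometric hphi Dz) !ddirE !deriveEjacobian // trmx_mul.
by rewrite !mulmxA.
Unshelve. all: by end_near. Qed.

Let im_z : chart_im b (Phi y).
Proof.
exists (phi x) => //; rewrite /local_rep /=; congr (chart_map b (phi _)).
have [h1 h2] := ha.
rewrite row_mxKl row_mxKr !manifold_chartK //.
- by case: (x).
- exact: warped_manifold2 hW.
- exact: warped_manifold1 hW.
Qed.

Let hK := csf_kaehler hM.
Let mG : metric_germ G (Phi y).
Proof. exact: metric_germ_chart (csf_manifold hM) (kaehler_metric hK) im_z. Qed.

Let nz := chart_im_nbhs (csf_manifold hM) im_z.

Let Jsq : Jz *m Jz = - 1%:M.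
Proof. by have E := kaehler_square hK im_z. Qed.

Let space_form A B : riem G (Phi y) A B B A =
  c / 4 * (inner (G (Phi y)) A A * inner (G (Phi y)) B B - inner (G (Phi y)) A B ^+ 2
           + 3 * inner (G (Phi y)) A (B *m Jz) ^+ 2).
Proof.
apply: space_form_sect => //.
- exact: Ck_diffn nz (endo_smooth (kaehler_endo hK) b 2).
- by move=> u v; exact: (kaehler_hermitian hK im_z).
- by apply: filterS nz => z iz u v; exact: (kaehler_parallel hK iz).
- by move=> u; exact: (csf_holomorphic_curvature hM im_z).
Qed.

Let isoy u v : inner (g y) u v = inner (G (Phi y)) (T u) (T v).
Proof. exact: (nbhs_singleton iso). Qed.

Let ambient_riemE u v : ambient_riem G Phi y u v = c / 4 * (inner (g y) u u * inner (g y) v v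
  - inner (g y) u v ^+ 2 + 3 * inner (G (Phi y)) (T u) (T v *m Jz) ^+ 2).
Proof. by rewrite /ambient_riem space_form !isoy. Qed.

Let dE u : dphi u = T u. Proof. exact: differentialE dP u. Qed.

(** J preserves the image of the first factor. *)
Let holomorphic u : u \in DT -> exists2 w, w \in DT & T u *m Jz = T w.
Proof.
move=> uT; have : T u *m Jz \in (endo_at Jz @: (dphi @: DT))%VS.
  apply/memv_imgP; exists (T u); last by rewrite lfunE.
  by rewrite -dE; exact: memv_img.
rewrite (crw_holomorphic hphi Dy) => /memv_imgP[w wT ->].
by exists w => //; rewrite dE.
Qed.

Let totally_real v w : v \in DP -> inner (G (Phi y)) (T w) (T v *m Jz) = 0.
Proof.
move=> vP; have : T v *m Jz \in normal_subspace G Phi y.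
  apply: (subvP (crw_totally_real hphi Dy)); apply/memv_imgP.
  exists (T v); last by rewrite lfunE.
  by rewrite -dE; exact: memv_img.
rewrite memv_ker lfunE /= mulmxA => /eqP e.
rewrite (innerC _ _ (metric_germ_sym mG)) innerE.
have dPy : differentiable Phi y by exact: diffn_diff (nbhs_singleton dP).
by rewrite (ddirE Phi w) (deriveEjacobian _ dPy) trmx_mul mulmxA e mul0mx mxE.
Qed.

Let J_skew A B : inner (G (Phi y)) A (B *m Jz) = - inner (G (Phi y)) (A *m Jz) B.
Proof.
apply: inner_J_skew; first exact: Jsq.
by move=> u v; exact: (kaehler_hermitian hK im_z).
Qed.

Let orth u v : u \in DT -> v \in DP -> inner (g y) u v = 0.
Proof.
rewrite mem_tangent_left mem_tangent_right => /eqP uT /eqP vP.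
have := inner_warped (gT a.1) F (gP a.2) y u v.
by rewrite uT vP inner0l inner0r mulr0 addr0.
Qed.

Let orth' u v : u \in DP -> v \in DT -> inner (g y) u v = 0.
Proof. by move=> uP vT; rewrite (innerC _ _ (metric_germ_sym mg)); exact: orth. Qed.

Let size_T e : ONB DT e -> size e = n1.
Proof. by move/onb_size; rewrite dim_tangent_left. Qed.
Let size_P e : ONB DP e -> size e = n2.
Proof. by move/onb_size; rewrite dim_tangent_right. Qed.

Let fullT e e' : ONB DT e -> ONB DP e' -> ONB fullv (e ++ e').
Proof.
apply: onb_cat; [exact: metric_germ_sym|exact: orth|].
by rewrite dim_tangent_left dim_tangent_right.
Qed.
Let fullP e e' : ONB DP e -> ONB DT e' -> ONB fullv (e ++ e').
Proof.
apply: onb_cat; [exact: metric_germ_sym|exact: orth'|].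
by rewrite dim_tangent_left dim_tangent_right addnC.
Qed.

Local Notation lap := (laplacian (gT a.1) F (chart_map a.1 x.1)).

Let mixedT e e' : ONB DT e -> ONB DP e' ->
  \sum_(i < size e) \sum_(j < size e') riem g y e`_i e'`_j e'`_j e`_i = n2%:R * lap / f x.1.
Proof.
move=> oe oe'.
have Fx : F (lsubmx y) = f x.1.
  rewrite y_l /= manifold_chartK //; first exact: warped_manifold1 hW.
  by case: ha.
have f0 : f x.1 != 0 by rewrite gt_eqF //; exact: (warped_pos hW).
have eT i : (i < size e)%N -> rsubmx e`_i = 0.
  by move=> ie; apply/eqP; rewrite -mem_tangent_left; exact: onb_mem oe ie.
have eP j : (j < size e')%N -> lsubmx e'`_j = 0.
  by move=> je; apply/eqP; rewrite -mem_tangent_right; exact: onb_mem oe' je.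
have K i j : (i < size e)%N -> (j < size e')%N -> riem g y e`_i e'`_j e'`_j e`_i =
    - ((f x.1)^-1 * hess (gT a.1) F (lsubmx y) (lsubmx e`_i) (lsubmx e`_i)).
  move=> ie je; rewrite (warped_sect mT mP dF posF (eT _ ie) (eP _ je)) Fx.
  congr (- (_ * _)).
  have := inner_warped (gT a.1) F (gP a.2) y e'`_j e'`_j.
  have [_ oo] := oe'; rewrite eP // inner0l add0r Fx => e1.
  have {}e1 : 1 = f x.1 ^+ 2 * inner (gP a.2 (rsubmx y)) (rsubmx e'`_j) (rsubmx e'`_j).
    by have oj := oo j j je je; rewrite eqxx in oj; exact: etrans (esym oj) e1.
  apply: (mulfI f0); rewrite divff // e1; ring.
transitivity (\sum_(i < size e) n2%:R * - ((f x.1)^-1 * hess (gT a.1) F (lsubmx y) (lsubmx e`_i) (lsubmx e`_i))).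
  apply: eq_bigr => i _.
  transitivity (\sum_(j < size e') - ((f x.1)^-1 * hess (gT a.1) F (lsubmx y) (lsubmx e`_i) (lsubmx e`_i))).
    by apply: eq_bigr => j _; exact: K.
  by rewrite sumr_const card_ord (size_P oe') mulr_natl.
rewrite -mulr_sumr sumrN -mulr_sumr -y_l (size_T oe).
rewrite (laplacian_trace mT dF (b := fun i : 'I_n1 => lsubmx e`_i)).
  by set s := \sum_(i < n1) _; field.
move=> i j; have := inner_warped (gT a.1) F (gP a.2) y e`_i e`_j.
have ie : (i < size e)%N by rewrite (size_T oe).
have je : (j < size e)%N by rewrite (size_T oe).
rewrite eT // inner0l mulr0 addr0 => <-.
by have [_ ->] := oe.
Qed.

Let mixedP e e' : ONB DP e -> ONB DT e' ->
  \sum_(i < size e) \sum_(j < size e') riem g y e`_i e'`_j e'`_j e`_i = n2%:R * lap / f x.1.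
Proof.
move=> oe oe'; rewrite -(mixedT oe' oe) exchange_big; apply: eq_bigr => i _; apply: eq_bigr => j _.
exact: riem_swap.
Qed.

Let ambient_real_l u v : u \in DP -> ambient_riem G Phi y u v =
  c / 4 * (inner (g y) u u * inner (g y) v v - inner (g y) u v ^+ 2).
Proof.
move=> uP; rewrite ambient_riemE J_skew (innerC _ _ (metric_germ_sym mG)) totally_real //.
by rewrite oppr0 expr0n mulr0 addr0.
Qed.

Let ambient_real_r u v : v \in DP -> ambient_riem G Phi y u v =
  c / 4 * (inner (g y) u u * inner (g y) v v - inner (g y) u v ^+ 2).
Proof. by move=> vP; rewrite ambient_riemE totally_real // expr0n mulr0 addr0. Qed.

Let sum_delta (k : nat) : \sum_(i < k) \sum_(j < k) (1 - (i == j)%:R : R) = k%:R * (k%:R - 1).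
Proof.
rewrite (eq_bigr (fun=> k%:R - 1)) ?sumr_const ?card_ord ?mulr_natl // => i _.
rewrite sumrB sumr_const card_ord; congr (_ - _).
by rewrite (bigD1 i) //= eqxx big1 ?addr0 // => j; rewrite eq_sym => /negbTE ->.
Qed.

(** J T e_i lies in the image of the first factor and has norm 1, so that by
    Parseval the squares of its products with the T e_j add up to 1. *)
Let ambientT e e' : ONB DT e -> ONB DP e' ->
  2^-1 * (\sum_(i < size e) \sum_(j < size e) ambient_riem G Phi y e`_i e`_j)
  + \sum_(i < size e) \sum_(j < size e') ambient_riem G Phi y e`_i e'`_j =
  n1%:R * (n1%:R + 2 * n2%:R + 2) / 2 * (c / 4).
Proof.
move=> oe oe'; have [_ o1] := oe; have [_ o2] := oe'.
have eP (j : 'I_(size e')) : e'`_j \in DP by apply: (onb_mem oe').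
have eT (j : 'I_(size e)) : e`_j \in DT by apply: (onb_mem oe).
have -> : \sum_(i < size e) \sum_(j < size e') ambient_riem G Phi y e`_i e'`_j = n1%:R * n2%:R * (c / 4).
  transitivity (\sum_(i < size e) \sum_(j < size e') (c / 4)).
    apply: eq_bigr => i _; apply: eq_bigr => j _; rewrite ambient_real_r // o1 // o2 // orth //.
    by rewrite !eqxx expr0n /= mulr1 subr0 mulr1.
  by rewrite !sumr_const !card_ord (size_T oe) (size_P oe') -[_ *+ n1]mulr_natl -[_ *+ n2]mulr_natl mulrA.
have S3 i : (i < size e)%N -> \sum_(j < size e) inner (G (Phi y)) (T e`_i) (T e`_j *m Jz) ^+ 2 = 1.
  move=> ie; have [w wT ew] := holomorphic (onb_mem oe ie).
  have w1 : inner (g y) w w = 1.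
    rewrite isoy -ew (kaehler_hermitian hK im_z) -isoy.
    by rewrite o1 // eqxx.
  rewrite -[RHS]w1 (onb_parseval (metric_germ_sym mg) _ oe wT); apply: eq_bigr => j _.
  by rewrite J_skew ew -isoy sqrrN expr2.
have -> : \sum_(i < size e) \sum_(j < size e) ambient_riem G Phi y e`_i e`_j =
  c / 4 * (n1%:R * (n1%:R - 1) + 3 * n1%:R).
  transitivity (c / 4 * (\sum_(i < size e) \sum_(j < size e) (1 - (i == j)%:R)
     + 3 * \sum_(i < size e) \sum_(j < size e) inner (G (Phi y)) (T e`_i) (T e`_j *m Jz) ^+ 2)).
    rewrite mulr_sumr -big_split mulr_sumr; apply: eq_bigr => i _ /=.
    rewrite mulr_sumr -big_split mulr_sumr; apply: eq_bigr => j _ /=.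
    rewrite ambient_riemE !o1 // !eqxx mulr1; congr (_ * (_ - _ + _)).
    by rewrite -(inj_eq val_inj) -natrX; case: eqP.
  rewrite sum_delta (eq_bigr (fun=> 1)) => [|i _]; last exact: S3.
  by rewrite sumr_const card_ord (size_T oe).
by field.
Qed.

Let ambientP e e' : ONB DP e -> ONB DT e' ->
  2^-1 * (\sum_(i < size e) \sum_(j < size e) ambient_riem G Phi y e`_i e`_j)
  + \sum_(i < size e) \sum_(j < size e') ambient_riem G Phi y e`_i e'`_j =
  n2%:R * (n2%:R + 2 * n1%:R - 1) / 2 * (c / 4).
Proof.
move=> oe oe'; have [_ o1] := oe; have [_ o2] := oe'.
have eP (j : 'I_(size e)) : e`_j \in DP by apply: (onb_mem oe).
have eT (j : 'I_(size e')) : e'`_j \in DT by apply: (onb_mem oe').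
have -> : \sum_(i < size e) \sum_(j < size e') ambient_riem G Phi y e`_i e'`_j = n1%:R * n2%:R * (c / 4).
  transitivity (\sum_(i < size e) \sum_(j < size e') (c / 4)).
    apply: eq_bigr => i _; apply: eq_bigr => j _; rewrite ambient_real_l // o1 // o2 // orth' //.
    by rewrite !eqxx expr0n /= mulr1 subr0 mulr1.
  rewrite !sumr_const !card_ord (size_P oe) (size_T oe').
  by rewrite -[_ *+ n2]mulr_natl -[_ *+ n1]mulr_natl mulrCA mulrA.
have -> : \sum_(i < size e) \sum_(j < size e) ambient_riem G Phi y e`_i e`_j =
  c / 4 * (n2%:R * (n2%:R - 1)).
  rewrite [n2%:R * _](_ : _ = \sum_(i < size e) \sum_(j < size e) (1 - (i == j)%:R)); last first.
    by rewrite sum_delta (size_P oe).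
  rewrite mulr_sumr; apply: eq_bigr => i _.
  rewrite mulr_sumr; apply: eq_bigr => j _.
  rewrite ambient_real_l // !o1 // !eqxx mulr1; congr (_ * (_ - _)).
  by rewrite -(inj_eq val_inj) -natrX; case: eqP.
by field.
Qed.

Let image_plane (V Q : {vspace 'rV[R]_(n1 + n2)}) : planes V Q -> planes (dphi @: V)%VS (dphi @: Q)%VS.
Proof.
move=> [sQ dQ]; split; first exact: limgS.
rewrite limg_dim_eq //; apply/eqP; rewrite -subv0; apply/subvP => u.
rewrite memv_cap memv_ker dE => /andP[_ /eqP u0]; rewrite memv0.
apply/negPn/negP => /(nbhs_singleton (mg_pos mg)).
by rewrite isoy u0 inner0l ltxx.
Qed.

Local Notation KminT := (inf_sect G (Phi y) (dphi @: DT)%VS).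

(** The infimum over the image of the leaf is attained, hence it is a lower bound
    of its values. *)
Let KminT_le Q : planes DT Q -> KminT <= plane_sect G (Phi y) (dphi @: Q)%VS.
Proof.
move=> pQ; have pI := image_plane pQ.
have d2 : (2 <= \dim (dphi @: DT)%VS)%N.
  by have [sI dI] := pI; have := dimvS sI; rewrite dI.
by have [_] := inf_sect_attained mG d2; apply.
Qed.

Let KP Q : planes DP Q -> plane_sect G (Phi y) (dphi @: Q)%VS = c / 4.
Proof.
move=> [sQ dQ]; have [u [v [uu vv uv eQ]]] := plane_onb mg dQ.
have uP : u \in DP by apply: (subvP sQ); rewrite eQ; apply: memv_span; rewrite inE eqxx.
rewrite eQ (image_plane_sect mG dP iso uu vv uv) ambient_real_l // uu vv uv.
by rewrite expr0n mulr1 subr0 mulr1.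
Qed.

Let hC u v : h u v = h v u. Proof. exact: (second_ffC mg mG dP). Qed.

Let shape_block xi e e' (M1 : 'M[R]_n1) (M2 : 'M[R]_n2) : size e = n1 ->
  shape_operator_mx g G Phi y xi (e ++ e') = block_mx M1 0 0 M2 <->
  [/\ forall i j : 'I_n1, inner (G (Phi y)) (h e`_j e`_i) xi = M1 i j,
      forall (i : 'I_n1) (j : 'I_n2), inner (G (Phi y)) (h e`_i e'`_j) xi = 0 &
      forall i j : 'I_n2, inner (G (Phi y)) (h e'`_j e'`_i) xi = M2 i j].
Proof.
move=> se; have nl (i : 'I_n1) : (e ++ e')`_(lshift n2 i) = e`_i by rewrite nth_cat se /= ltn_ord.
have nr (i : 'I_n2) : (e ++ e')`_(rshift n1 i) = e'`_i.
  by rewrite nth_cat se /= ltnNge leq_addr /= addKn.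
split=> [E|[E1 E2 E3]].
  have K (i j : 'I_(n1 + n2)) : inner (G (Phi y)) (h (e ++ e')`_j (e ++ e')`_i) xi = block_mx M1 0 0 M2 i j.
    by rewrite -E (shape_entry mg mG dP).
  split=> i j.
  - by have := K (lshift n2 i) (lshift n2 j); rewrite !nl block_mxEul.
  - by have := K (rshift n1 j) (lshift n2 i); rewrite nl nr block_mxEdl mxE.
  - by have := K (rshift n1 i) (rshift n1 j); rewrite !nr block_mxEdr.
apply/matrixP => i j; rewrite (shape_entry mg mG dP).
case: (split_ordP i) => i' ->; case: (split_ordP j) => j' ->; rewrite ?nl ?nr.
- by rewrite block_mxEul.
- by rewrite block_mxEur mxE hC E2.
- by rewrite block_mxEdl mxE E2.
- by rewrite block_mxEdr.
Qed.

Let adapted (e : seq 'rV[R]_(n1 + n2)) (nu : seq 'rV[R]_(2 * m)) :=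
    [/\ ONB fullv e,
        forall i, (i < n1)%N -> e`_i \in DT,
        forall i, (n1 <= i < n1 + n2)%N -> e`_i \in DP &
        orthonormal_basis G (Phi y) (normal_subspace G Phi y) nu].

Let adapted_split e nu : adapted e nu -> exists e1 e2,
  [/\ e = e1 ++ e2, ONB DT e1 & ONB DP e2].
Proof.
move=> [oe eT eP _]; have se : size e = (n1 + n2)%N by rewrite (onb_size oe) dim_rV.
have [_ o] := oe.
have s1 : size (take n1 e) = n1 by rewrite size_takel // se leq_addr.
have s2 : size (drop n1 e) = n2 by rewrite size_drop se addKn.
exists (take n1 e), (drop n1 e); split; first by rewrite cat_take_drop.
- apply: onb_intro => [i j|i|]; rewrite ?s1 ?dim_tangent_left //.
    by move=> i1 j1; rewrite !nth_take // o // se ltn_addr.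
  by move=> i1; rewrite nth_take //; exact: eT.
- apply: onb_intro => [i j|i|]; rewrite ?s2 ?dim_tangent_right //.
    by move=> i1 j1; rewrite !nth_drop o ?se ?ltn_add2l // eqn_add2l.
  by move=> i1; rewrite nth_drop; apply: eP; rewrite leq_addr ltn_add2l.
Qed.

Let adapted_cat e1 e2 nu : ONB DT e1 -> ONB DP e2 ->
  orthonormal_basis G (Phi y) (normal_subspace G Phi y) nu -> adapted (e1 ++ e2) nu.
Proof.
move=> o1 o2 onu; have s1 := size_T o1; have s2 := size_P o2; split=> //; first exact: fullT.
- by move=> i i1; rewrite nth_cat s1 i1; apply: (onb_mem o1); rewrite s1.
- move=> i /andP[i1 i2]; rewrite nth_cat s1 ltnNge i1 /=; apply: (onb_mem o2).
  by rewrite s2 ltn_subLR.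
Qed.

Let normal_onb : exists nu, orthonormal_basis G (Phi y) (normal_subspace G Phi y) nu.
Proof. exact: onb_exists (metric_germ_sym mG) (nbhs_singleton (mg_pos mG)) _. Qed.

Lemma equalityT_extremal : (2 <= n1)%N -> forall Q,
  (exists e nu, [/\ adapted e nu, Q = <<[:: e`_0; e`_1]>>%VS &
          forall xi, xi \in nu -> exists Q : 'M[R]_n2,
            [/\ Q^T = Q, \tr Q = 0 &
                shape_operator_mx g G Phi y xi e =
                block_mx (corner_mx n1 (inner (G (Phi y)) (h e`_0 e`_0) xi)
                                       (inner (G (Phi y)) (h e`_0 e`_1) xi)) 0 0 Q]]) <->
  (exists e1 e2, [/\ ONB DT e1, ONB DP e2, Q = <<[:: e1`_0; e1`_1]>>%VS & extremal g G Phi y e1 e2]).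
Proof.
move=> n12 Q.
have dim2 : (2 <= \dim DT)%N by rewrite dim_tangent_left.
have hd e1 e2 (i : nat) : ONB DT e1 -> (i < 2)%N -> (e1 ++ e2)`_i = e1`_i.
  by move=> oe1 i2; rewrite nth_cat (size_T oe1) (leq_trans i2).
split=> [[e [nu [ad eQ sh]]]|[e1 [e2 [oe1 oe2 eQ fl]]]].
  have [e1 [e2 [ee oe1 oe2]]] := adapted_split ad; have [_ _ _ onu] := ad.
  exists e1, e2; split=> //; first by rewrite eQ ee !hd.
  apply/(extremal_shape mg mG dP iso dim2 oe1 oe2 onu) => xi xinu.
  have [M2 [_ tr0 E]] := sh xi xinu.
  rewrite ee !hd // in E; have [E1 E2 E3] := iffLR (shape_block _ _ _ _ (size_T oe1)) E.
  exists (inner (G (Phi y)) (h e1`_0 e1`_0) xi), (inner (G (Phi y)) (h e1`_0 e1`_1) xi).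
  rewrite (size_T oe1) (size_P oe2); split.
  - by move=> i j ie je; rewrite (E1 (Ordinal ie) (Ordinal je)) mxE.
  - by move=> i j ie je; rewrite (E2 (Ordinal ie) (Ordinal je)).
  - by apply: etrans tr0; apply: eq_bigr => j _; exact: E3.
have [nu onu] := normal_onb.
exists (e1 ++ e2), nu; split; first exact: adapted_cat.
  by rewrite !hd.
move=> xi xinu; have [s [t [H1 H2 H3]]] := iffLR (extremal_shape mg mG dP iso dim2 oe1 oe2 onu) fl xi xinu.
(* Q is the matrix of the shape operator on the totally real factor. *)
exists (\matrix_(i, j) inner (G (Phi y)) (h e2`_j e2`_i) xi); split.
- by apply/matrixP => i j; rewrite !mxE hC.
- by rewrite -H3 (size_P oe2); apply: eq_bigr => i _; rewrite mxE.
have [l0 l1] : (0 < size e1)%N /\ (1 < size e1)%N.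
  by rewrite (size_T oe1); split=> //; exact: leq_trans n12.
apply/(shape_block _ _ _ _ (size_T oe1)); split=> i j.
- rewrite H1 ?(size_T oe1) // mxE !hd // (H1 0%N 0%N) // (H1 1%N 0%N) //.
- by rewrite H2 ?(size_T oe1) ?(size_P oe2).
- by rewrite mxE.
Qed.

Lemma equalityP_extremal : (2 <= n2)%N -> forall Q,
  (exists e nu, [/\ adapted e nu, Q = <<[:: e`_n1; e`_n1.+1]>>%VS &
          forall xi, xi \in nu -> exists (Q : 'M[R]_n1) (s t : R),
            [/\ Q^T = Q, \tr Q = 0 &
                shape_operator_mx g G Phi y xi e = block_mx Q 0 0 (corner_mx n2 s t)]]) <->
  (exists e2 e1, [/\ ONB DP e2, ONB DT e1, Q = <<[:: e2`_0; e2`_1]>>%VS & extremal g G Phi y e2 e1]).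
Proof.
move=> n22 Q.
have dim2 : (2 <= \dim DP)%N by rewrite dim_tangent_right.
have hd0 e1 e2 : ONB DT e1 -> (e1 ++ e2)`_n1 = e2`_0.
  by move=> oe1; rewrite nth_cat (size_T oe1) ltnn subnn.
have hd1 e1 e2 : ONB DT e1 -> (e1 ++ e2)`_n1.+1 = e2`_1.
  by move=> oe1; rewrite nth_cat (size_T oe1) ltnNge leqnSn /= subSn // subnn.
split=> [[e [nu [ad eQ sh]]]|[e2 [e1 [oe2 oe1 eQ fl]]]].
  have [e1 [e2 [ee oe1 oe2]]] := adapted_split ad; have [_ _ _ onu] := ad.
  exists e2, e1; split=> //; first by rewrite eQ ee hd0 // hd1.
  apply/(extremal_shape mg mG dP iso dim2 oe2 oe1 onu) => xi xinu.
  have [M1 [s [t [_ tr0 E]]]] := sh xi xinu.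
  rewrite ee in E; have [E1 E2 E3] := iffLR (shape_block _ _ _ _ (size_T oe1)) E.
  exists s, t; rewrite (size_T oe1) (size_P oe2); split.
  - by move=> i j ie je; rewrite (E3 (Ordinal ie) (Ordinal je)) mxE.
  - by move=> i j ie je; rewrite hC (E2 (Ordinal je) (Ordinal ie)).
  - by apply: etrans tr0; apply: eq_bigr => j _; exact: E1.
have [nu onu] := normal_onb.
exists (e1 ++ e2), nu; split; first exact: adapted_cat.
  by rewrite hd0 // hd1.
move=> xi xinu; have [s [t [H1 H2 H3]]] := iffLR (extremal_shape mg mG dP iso dim2 oe2 oe1 onu) fl xi xinu.
(* Q is the matrix of the shape operator on the holomorphic factor. *)
exists (\matrix_(i, j) inner (G (Phi y)) (h e1`_j e1`_i) xi), s, t; split.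
- by apply/matrixP => i j; rewrite !mxE hC.
- by rewrite -H3 (size_T oe1); apply: eq_bigr => i _; rewrite mxE.
apply/(shape_block _ _ _ _ (size_T oe1)); split=> i j.
- by rewrite mxE.
- by rewrite hC H2 ?(size_T oe1) ?(size_P oe2).
- by rewrite H1 ?(size_P oe2) // mxE.
Qed.

Local Notation normH2 := (let H := mean_curvature g G Phi y in inner (G (Phi y)) H H).
Local Notation boundT := ((n1 + n2)%:R ^+ 2 / 2 * normH2 - n2%:R * lap / f x.1
    + n1%:R * (n1%:R + 2 * n2%:R + 2) / 2 * (c / 4) - KminT).
Local Notation boundP := ((n1 + n2)%:R ^+ 2 / 2 * normH2 - n2%:R * lap / f x.1
    + n2%:R * (n2%:R + 2 * n1%:R - 1) / 2 * (c / 4) - c / 4).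
Local Notation minimality := [/\ mixed_totally_geodesic_at g G Phi y DT DP,
        partial_minimal_at g G Phi y DT,
        partial_minimal_at g G Phi y DP &
        minimal_at g G Phi y].

Lemma chen_holomorphic : (2 <= n1)%N -> [/\ delta_hat g y DT <= boundT,
  delta_hat g y DT = boundT <-> exists P : {vspace 'rV[R]_(n1 + n2)},
    [/\ planes DT P, plane_sect g y P = inf_sect g y DT,
        plane_sect G (Phi y) (dphi @: P)%VS = KminT &
        exists e nu, [/\ adapted e nu, P = <<[:: e`_0; e`_1]>>%VS &
          forall xi, xi \in nu -> exists Q : 'M[R]_n2,
            [/\ Q^T = Q, \tr Q = 0 &
                shape_operator_mx g G Phi y xi e =
                block_mx (corner_mx n1 (inner (G (Phi y)) (h e`_0 e`_0) xi)
                                       (inner (G (Phi y)) (h e`_0 e`_1) xi)) 0 0 Q]]] &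
  delta_hat g y DT = boundT -> minimality].
Proof.
move=> n12; have dim2 : (2 <= \dim DT)%N by rewrite dim_tangent_left.
have L := leaf_equality mg mG dP iso dim2 fullT mixedT ambientT KminT_le.
split.
- exact: (leaf_inequality mg mG dP iso dim2 fullT mixedT ambientT KminT_le).
- apply: (iff_trans L); split=> [[Q [h1 h2 h3 h4]]|[Q [h1 h2 h3 h4]]]; exists Q; split=> //.
    by apply/equalityT_extremal.
  by apply/(equalityT_extremal n12).
- move=> /L [Q [_ _ _ [e [e' [oe oe' _ fl]]]]].
  exact: (extremal_minimal mg mG dP dim2 fullT oe oe' fl).
Qed.

Lemma chen_totally_real : (2 <= n2)%N -> [/\ delta_hat g y DP <= boundP,
  delta_hat g y DP = boundP <-> exists P : {vspace 'rV[R]_(n1 + n2)},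
    [/\ planes DP P, plane_sect g y P = inf_sect g y DP,
        plane_sect G (Phi y) (dphi @: P)%VS = c / 4 &
        exists e nu, [/\ adapted e nu, P = <<[:: e`_n1; e`_n1.+1]>>%VS &
          forall xi, xi \in nu -> exists (Q : 'M[R]_n1) (s t : R),
            [/\ Q^T = Q, \tr Q = 0 &
                shape_operator_mx g G Phi y xi e = block_mx Q 0 0 (corner_mx n2 s t)]]] &
  delta_hat g y DP = boundP -> minimality].
Proof.
move=> n22; have dim2 : (2 <= \dim DP)%N by rewrite dim_tangent_right.
have KPle Q : planes DP Q -> c / 4 <= plane_sect G (Phi y) (dphi @: Q)%VS by move/KP ->.
have L := leaf_equality mg mG dP iso dim2 fullP mixedP ambientP KPle.
split.
- exact: (leaf_inequality mg mG dP iso dim2 fullP mixedP ambientP KPle).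
- apply: (iff_trans L); split=> [[Q [h1 h2 h3 h4]]|[Q [h1 h2 h3 h4]]]; exists Q; split=> //.
    by apply/equalityP_extremal.
  by apply/(equalityP_extremal n22).
- move=> /L [Q [_ _ _ [e [e' [oe oe' _ fl]]]]].
  have [mx mP' mT' mn] := extremal_minimal mg mG dP dim2 fullP oe oe' fl.
  by split=> // u v uT vP; rewrite hC; exact: mx.
Qed.

End CRWarped.

Unset Implicit Arguments.

Theorem theorem4p1 (R : realType) (n1 n2 m : nat) (c : R)
    (NT : chartedSpace R n1) (NP : chartedSpace R n2)
    (gT : matrix_field NT) (f : NT -> R) (gP : matrix_field NP)
    (M : chartedSpace R (2 * m)) (gM J : matrix_field M)
    (phi : prod_manifold NT NP -> M)
    (hM : is_complex_space_form gM J c)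
    (hphi : is_cr_warped_product gT f gP gM J phi)
    (x : prod_manifold NT NP)
    (a : chart (prod_manifold NT NP)) (b : chart M)
    (ha : chart_dom a x) (hb : chart_dom b (phi x)) :
  let y := chart_map a x in
  let Phi := local_rep phi a b in
  let g := warped_metric gT f gP a in
  let G := gM b in
  let z := Phi y in
  let DT := tangent_left n1 n2 in
  let DP := tangent_right n1 n2 in
  let dphi := differential Phi y in
  let h := second_ff g G Phi y in
  let normH2 := let H := mean_curvature g G Phi y in inner (G z) H H in
  let lap := laplacian (gT a.1) (f \o chart_inv a.1) (chart_map a.1 x.1) in
  let KminT := inf_sect G z (dphi @: DT)%VS in
  let boundT := (n1 + n2)%:R ^+ 2 / 2 * normH2 - n2%:R * lap / f x.1
    + n1%:R * (n1%:R + 2 * n2%:R + 2) / 2 * (c / 4) - KminT in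
  let boundP := (n1 + n2)%:R ^+ 2 / 2 * normH2 - n2%:R * lap / f x.1
    + n2%:R * (n2%:R + 2 * n1%:R - 1) / 2 * (c / 4) - c / 4 in
  let adapted (e : seq 'rV[R]_(n1 + n2)) (nu : seq 'rV[R]_(2 * m)) :=
    [/\ orthonormal_basis g y fullv e,
        forall i, (i < n1)%N -> e`_i \in DT,
        forall i, (n1 <= i < n1 + n2)%N -> e`_i \in DP &
        orthonormal_basis G z (normal_subspace G Phi y) nu] in
  let equalityT := exists P : {vspace 'rV[R]_(n1 + n2)},
    [/\ planes DT P, plane_sect g y P = inf_sect g y DT,
        plane_sect G z (dphi @: P)%VS = KminT &
        exists e nu, [/\ adapted e nu, P = <<[:: e`_0; e`_1]>>%VS &
          forall xi, xi \in nu -> exists Q : 'M[R]_n2,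
            [/\ Q^T = Q, \tr Q = 0 &
                shape_operator_mx g G Phi y xi e =
                block_mx (corner_mx n1 (inner (G z) (h e`_0 e`_0) xi)
                                       (inner (G z) (h e`_0 e`_1) xi)) 0 0 Q]]] in
  let equalityP := exists P : {vspace 'rV[R]_(n1 + n2)},
    [/\ planes DP P, plane_sect g y P = inf_sect g y DP,
        plane_sect G z (dphi @: P)%VS = c / 4 &
        exists e nu, [/\ adapted e nu, P = <<[:: e`_n1; e`_n1.+1]>>%VS &
          forall xi, xi \in nu -> exists (Q : 'M[R]_n1) (s t : R),
            [/\ Q^T = Q, \tr Q = 0 &
                shape_operator_mx g G Phi y xi e = block_mx Q 0 0 (corner_mx n2 s t)]]] in
  let minimality :=
    [/\ mixed_totally_geodesic_at g G Phi y DT DP,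
        partial_minimal_at g G Phi y DT,
        partial_minimal_at g G Phi y DP &
        minimal_at g G Phi y] in
  ((2 <= n1)%N ->
     [/\ delta_hat g y DT <= boundT,
         delta_hat g y DT = boundT <-> equalityT &
         delta_hat g y DT = boundT -> minimality]) /\
  ((2 <= n2)%N ->
     [/\ delta_hat g y DP <= boundP,
         delta_hat g y DP = boundP <-> equalityP &
         delta_hat g y DP = boundP -> minimality]).
Proof.
move=> y Phi g G z DT DP dphi h normH2 lap KminT boundT boundP adapted eqT eqP.
move=> minimality.
split; [exact: (chen_holomorphic hM hphi ha hb)|exact: (chen_totally_real hM hphi ha hb)].
Qed.
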